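(* Let $a^{ij}$ be measurable with $(a^{ij}(x))$ symmetric and $0<\lambda I\le(a^{ij}(x))\le\Lambda I$ for a.e. $x\in B_1$. A nonnegative strong solution of $a^{ij}D_{ij}w=\chi_{\{w>0\}}$ in $B_1$ with fixed values on $\partial B_1$ is unique: if $w_1,w_2\ge0$ are two strong solutions with $w_1=w_2$ on $\partial B_1$, then $w_1=w_2$ in $B_1$.
   Context: $B_1$ is the open unit ball of $\mathbb R^n$ centered at $0$. Repeated indices are summed, and $\chi_D$ is the characteristic function of $D$. A strong solution is here a function $w\in W^{2,p}_{loc}(B_1)\cap C^0(\overline{B_1})$ with $p\ge n$ satisfying the equation almost everywhere. No regularity of the $a^{ij}$ beyond ellipticity is assumed. *)

(* Defs.v *)
From HB Require Import structures.
From mathcomp Require Import all_boot all_order all_algebra.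
From mathcomp Require Import all_classical all_reals all_analysis.
From mathcomp Require Import measurable_realfun.

Set Implicit Arguments.
Unset Strict Implicit.
Unset Printing Implicit Defensive.

Import Order.TTheory GRing.Theory Num.Theory numFieldNormedType.Exports.

Local Open Scope classical_set_scope.
Local Open Scope ring_scope.

(* R^n is 'rV[R]_n. The library norm on it is the sup norm, used only for its
   topology and for differentiation; the Euclidean ball is defined below. *)

Definition rV_display : measure_display.
Proof. exact: default_measure_display. Qed.

Section measurable_rV.
Context {R : realType} {n : nat}.

(* The sigma-algebra generated by the coordinates, i.e. the Borel sets. *)
Let coord (i : 'I_n) (x : 'rV[R]_n) : measurableTypeR R := x ord0 i.

Let rV_set0 : g_sigma_preimage coord set0.
Proof. exact: sigma_algebra0. Qed.

Let rV_setC A : g_sigma_preimage coord A -> g_sigma_preimage coord (~` A).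
Proof. exact: sigma_algebraC. Qed.

Let rV_bigcup (F : (set 'rV[R]_n)^nat) :
  (forall i, g_sigma_preimage coord (F i)) ->
  g_sigma_preimage coord (\bigcup_i F i).
Proof. exact: sigma_algebra_bigcup. Qed.

HB.instance Definition _ := @isMeasurable.Build rV_display 'rV[R]_n
  (g_sigma_preimage coord) rV_set0 rV_setC rV_bigcup.

Lemma measurable_coord (i : 'I_n) :
  measurable_fun setT (fun x : 'rV[R]_n => x ord0 i : measurableTypeR R).
Proof.
move=> _ Y mY; rewrite setTI; apply: sub_sigma_algebra => /=.
rewrite -bigcup_seq/=; exists i => /=; first by rewrite mem_index_enum.
by exists Y => //; rewrite setTI.
Qed.

Lemma measurable_fun_coordP d (T : measurableType d) (f : T -> 'rV[R]_n) :
  (forall i, measurable_fun setT (fun t => f t ord0 i : measurableTypeR R)) ->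
  measurable_fun setT f.
Proof.
move=> mf; suff H : g_sigma_preimage (fun i t => coord i (f t)) `<=` measurable.
  move=> _ A mA; apply: H.
  rewrite (_ : (fun i t => _) = (fun i => coord i \o f))//.
  by rewrite g_sigma_preimage_comp; exists A.
apply: smallest_sub; first exact: sigma_algebra_measurable.
by rewrite -bigcup_seq => A [i _ [B mB <-]]; exact: mf.
Qed.

End measurable_rV.

Section lebesgue_rV.
Context {R : realType}.
Local Open Scope ereal_scope.

Section cons.
Variable n : nat.

Definition rV_cons (p : measurableTypeR R * 'rV[R]_n) : 'rV[R]_n.+1 :=
  row_mx (const_mx p.1 : 'rV[R]_1) p.2.

Definition rV_uncons (v : 'rV[R]_n.+1) : measurableTypeR R * 'rV[R]_n :=
  (v ord0 ord0, rsubmx (v : 'rV[R]_(1 + n))).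

Lemma rV_consK : cancel rV_cons rV_uncons.
Proof.
move=> [x v]; rewrite /rV_uncons /rV_cons row_mxKr; congr pair.
have -> : @ord0 n = lshift n (@ord0 0) by exact: val_inj.
by apply: etrans (row_mxEl _ _ _ _) _; rewrite mxE.
Qed.

Lemma measurable_rV_cons : measurable_fun setT rV_cons.
Proof.
apply: measurable_fun_coordP => i.
case: (split_ordP (i : 'I_(1 + n))) => j ->.
  rewrite (_ : (fun _ => _) = fst); first exact: measurable_fst.
  by apply/funext => p; apply: etrans (row_mxEl _ _ _ _) _; rewrite mxE.
rewrite (_ : (fun _ => _) =
    (fun x : 'rV[R]_n => x ord0 j : measurableTypeR R) \o snd).
  exact: (measurableT_comp (measurable_coord j) measurable_snd).
by apply/funext => p; exact: row_mxEr.
Qed.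

Lemma measurable_rV_uncons : measurable_fun setT rV_uncons.
Proof.
apply: measurable_fun_pair; first exact: measurable_coord.
apply: measurable_fun_coordP => i; under eq_fun do rewrite mxE.
exact: measurable_coord.
Qed.

Variable m : {sigma_finite_measure set 'rV[R]_n -> \bar R}.

Definition lebesgue_cons : set 'rV[R]_n.+1 -> \bar R :=
  pushforward (@lebesgue_measure R \x m) rV_cons.

Let lebesgue_cons0 : lebesgue_cons set0 = 0.
Proof. by rewrite /lebesgue_cons /pushforward preimage_set0 measure0. Qed.

Let lebesgue_cons_ge0 A : 0 <= lebesgue_cons A.
Proof. by rewrite /lebesgue_cons /pushforward. Qed.

Let mcons (A : set 'rV[R]_n.+1) :
  measurable A -> measurable (rV_cons @^-1` A).
Proof. by move=> mA; rewrite -[X in measurable X]setTI; exact: measurable_rV_cons. Qed.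

Let lebesgue_cons_sigma_additive : semi_sigma_additive lebesgue_cons.
Proof.
move=> F mF tF mUF; rewrite /lebesgue_cons /pushforward preimage_bigcup.
apply: measure_semi_sigma_additive.
- by move=> k; exact: mcons.
- apply/trivIsetP => /= i j _ _ ij; rewrite -preimage_setI.
  by move/trivIsetP : tF => /(_ _ _ _ _ ij) ->//; rewrite preimage_set0.
- by rewrite -preimage_bigcup; exact: mcons.
Qed.

HB.instance Definition _ := isMeasure.Build _ _ _ lebesgue_cons
  lebesgue_cons0 lebesgue_cons_ge0 lebesgue_cons_sigma_additive.

Let lebesgue_cons_sigma_finite : sigma_finite setT lebesgue_cons.
Proof.
have /sigma_finiteP[F [FT ndF mF]] := sigma_finiteT (@lebesgue_measure R).
have /sigma_finiteP[G [GT ndG mG]] := sigma_finiteT m.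
exists (fun k => rV_uncons @^-1` (F k `*` G k)).
  rewrite predeqE => v; split=> // _.
  have [k _ Fk] : (\bigcup_i F i) (rV_uncons v).1 by rewrite -FT.
  have [l _ Gl] : (\bigcup_i G i) (rV_uncons v).2 by rewrite -GT.
  exists (maxn k l) => //; split.
    by move: Fk; exact/subsetPset/ndF/leq_maxl.
  by move: Gl; exact/subsetPset/ndG/leq_maxr.
move=> k; have [mFk Fk] := mF k; have [mGk Gk] := mG k; split.
  rewrite -[X in measurable X]setTI; apply: measurable_rV_uncons => //.
  exact: measurableX.
rewrite /lebesgue_cons /pushforward (_ : rV_cons @^-1` _ = F k `*` G k).
  by rewrite product_measure1E// lte_mul_pinfty// ge0_fin_numE.
by rewrite -comp_preimage (_ : _ \o _ = id)//; exact/funext/rV_consK.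
Qed.

HB.instance Definition _ := Measure_isSigmaFinite.Build _ _ _ lebesgue_cons
  lebesgue_cons_sigma_finite.

End cons.

(* n-dimensional Lebesgue measure (on Borel sets), as the n-fold product of the
   one-dimensional one; on R^0 it is the unit mass. *)
Fixpoint lebesgue_rV (n : nat) :
    {sigma_finite_measure set 'rV[R]_n -> \bar R} :=
  match n with
  | 0 => @dirac _ 'rV[R]_0 0%R R
  | m.+1 => lebesgue_cons (lebesgue_rV m)
  end.

End lebesgue_rV.

Section sobolev.
Context {R : realType} {n : nat}.
Implicit Types (U : set 'rV[R]_n) (f u v w phi : 'rV[R]_n -> R).
Implicit Types (i j : 'I_n) (s : seq 'I_n).

Definition unit_ball : set 'rV[R]_n :=
  [set x | \sum_(i < n) x ord0 i ^+ 2 < 1].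

Definition unit_sphere : set 'rV[R]_n := closure unit_ball `\` unit_ball.

(* Measurability with respect to the completed (Lebesgue) sigma-algebra. *)
Definition Lebesgue_measurable_fun U f : Prop :=
  forall Y : set R, measurable Y ->
    completed_algebra_gen (lebesgue_rV n) (U `&` f @^-1` Y).

Definition partial i f : 'rV[R]_n -> R := 'D_(delta_mx ord0 i) f.

(* The iterated classical derivative along the indices listed in s. *)
Definition partials s f : 'rV[R]_n -> R := foldr partial f s.

Definition smooth f : Prop :=
  forall s, continuous (partials s f) /\
    forall i x, derivable (partials s f) x (delta_mx ord0 i).

(* C_c^oo(U) *)
Definition test_function U phi : Prop :=
  [/\ smooth phi, compact (closure [set x | phi x != 0])
    & closure [set x | phi x != 0] `<=` U].

Definition Lp_loc (p : R) U f : Prop :=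
  forall K, compact K -> K `<=` U -> f \_ K \in Lfun (lebesgue_rV n) p%:E.

(* v is the weak derivative of u in U along the indices listed in s. *)
Definition weak_derivative U s u v : Prop :=
  Lp_loc 1 U v /\
  forall phi, test_function U phi ->
    \int[lebesgue_rV n]_(x in U) (u x * partials s phi x) =
    (-1) ^+ size s * \int[lebesgue_rV n]_(x in U) (v x * phi x).

(* W^{k,p}_loc(U) *)
Definition sobolev_loc (k : nat) (p : R) U u : Prop :=
  Lp_loc p U u /\
  forall s, (size s <= k)%N -> exists2 v, Lp_loc p U v & weak_derivative U s u v.

(* The order A <= B of quadratic forms. *)
Definition loewner_le (A B : 'M[R]_n) : Prop :=
  forall xi : 'rV[R]_n,
    (xi *m A *m xi^T) ord0 ord0 <= (xi *m B *m xi^T) ord0 ord0.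

(* w is a strong solution of a^{ij} D_{ij} w = f in the unit ball. The Hessian
   is determined only almost everywhere, so any representative will do. *)
Definition strong_solution (a : 'rV[R]_n -> 'M[R]_n) f w : Prop :=
  [/\ exists2 p : R, n%:R <= p & sobolev_loc 2 p unit_ball w,
      {within closure unit_ball, continuous w}
    & exists2 D2w : 'I_n -> 'I_n -> 'rV[R]_n -> R,
        forall i j, weak_derivative unit_ball [:: i; j] w (D2w i j)
      & {ae lebesgue_rV n, forall x, unit_ball x ->
           \sum_(i < n) \sum_(j < n) a x i j * D2w i j x = f x}].

End sobolev.

(* Main.v *)
Require Import Defs.
From mathcomp Require Import all_boot all_order all_algebra.
From mathcomp Require Import all_classical all_reals all_analysis.
From mathcomp Require Import measurable_realfun ring lra.
Import Order.TTheory GRing.Theory Num.Theory numFieldNormedType.Exports.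
Set Implicit Arguments.
Unset Strict Implicit.
Unset Printing Implicit Defensive.
Local Open Scope classical_set_scope.
Local Open Scope ring_scope.

(** Let u = w1 - w2.  Where u > 0 we have w1 > w2 >= 0, so a^{ij} D_ij w1 = 1
    while a^{ij} D_ij w2 <= 1; hence a^{ij} D_ij u >= 0 almost everywhere on
    the set {u > 0}, and u = 0 on the sphere.  A maximum principle then gives
    u <= 0, and exchanging w1 and w2 gives equality.

    Since the a^{ij} are merely measurable, the maximum principle has to be the
    one of Aleksandrov, Bakelman and Pucci (abp_max_principle), and this is
    where second derivatives in L^n are needed.  Suppose that u has a positive
    value m.  Mollify u at a scale eta.  For every slope p in a small cube
    [0, delta]^n, with delta of the order of m / n, the mollified function minus
    p . x attains its maximum at an interior point where u >= m / 2; the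
    gradient there is p and the Hessian is nonpositive (slope_attained).  So
    the gradient maps the set of these contact points onto a cube of volume
    delta^n, a number that does not depend on eta.

    The volume of this image is also small (contact_volume).  Cut space into
    grid cubes of side h.  On a cube that meets the contact set, the gradient
    varies by about h times the size of the Hessian H of the mollified
    function.  Let V be the weak Hessian of u.  From H <= 0, a^{ij} V_ij >= 0
    and ellipticity it follows that |H| is at most a constant times |V - H|
    (hessian_bound), and since H is the mollification of V, Jensen's inequality
    bounds |V - H|^n by the averaged oscillation of V in the power n at scale
    eta (moll_sub_le).  Adding over the cubes (image_volume_le) and letting h
    tend to 0 gives delta^n <= C osc, with C independent of eta.  The right-hand
    side tends to 0 with eta because V is locally in L^n (vanishing_osc_Lm),
    which is a contradiction.  Covering the image by boxes in this way takes the
    place of the change of variables formula and of determinants.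

    The Hessian that satisfies the equation is only assumed to be a locally
    integrable weak derivative; it agrees almost everywhere with the one in L^p
    provided by the Sobolev space because weak derivatives are unique
    (weak_derivative_unique), which follows from the same facts on
    oscillations. *)

(** * Directional derivatives *)

Section calculus.
Context {R : realType}.

(** Covers both affine functions (C = 0) and functions that vanish to second
    order at x. *)
Lemma is_derive_quadratic (V : normedModType R) (f : V -> R) (x v : V) (d C : R) :
  (forall h : R, `|f (h *: v + x) - f x - h * d| <= C * h ^+ 2) ->
  is_derive x v f d.
Proof.
move=> fC.
have dq : h^-1 *: ((f \o shift x) (h *: v) - f x) @[h --> 0^'] --> d.
  apply/cvgrPdist_le => /= e e0.
  have C0 : 0 < `|C| + 1 by rewrite ltr_wpDl.
  near=> h.
  have h0 : h != 0 by near: h; exact: nbhs_dnbhs_neq.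
  have he : `|h| <= e / (`|C| + 1).
    near: h; apply: dnbhs0_le; exact: divr_gt0.
  have -> : d - h^-1 *: (f (h *: v + x) - f x) =
      - h^-1 * (f (h *: v + x) - f x - h * d).
    by rewrite /GRing.scale/=; field.
  rewrite normrM normrN normfV ler_pdivrMl ?normr_gt0//.
  rewrite (le_trans (fC h))// -real_normK ?num_real// expr2 mulrCA.
  rewrite ler_wpM2l//.
  apply: (@le_trans _ _ ((`|C| + 1) * `|h|)).
    by rewrite ler_wpM2r// (le_trans (ler_norm _))// lerDl.
  by rewrite -ler_pdivlMl// mulrC.
by apply: DeriveDef; [apply/cvg_ex; exists d|exact/cvg_lim].
Unshelve. all: by end_near. Qed.

Lemma is_derive1_comp (f g : R -> R) (x df dg : R) :
  is_derive x 1 g dg -> is_derive (g x) 1 f df ->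
  is_derive x 1 (f \o g) (df * dg).
Proof.
move=> [dg1 dg2] [df1 df2]; apply: DeriveDef.
  by apply/derivable1_diffP/differentiable_comp; exact/derivable1_diffP.
by rewrite -derive1E derive1_comp// !derive1E df2 dg2.
Qed.

Lemma is_derive_line (V : normedModType R) (f : V -> R) (z v : V) (t d : R) :
  is_derive (z + t *: v) v f d -> is_derive t 1 (fun s : R => f (z + s *: v)) d.
Proof.
have E : (fun h : R => h^-1 *: (((fun s : R => f (z + s *: v)) \o shift t) (h *: 1)
      - f (z + t *: v))) =
    (fun h : R => h^-1 *: ((f \o shift (z + t *: v)) (h *: v) - f (z + t *: v))).
  apply/funext => h /=; congr (_ *: (f _ - _)).
  by rewrite [_%:A]mulr1 scalerDl addrCA.
move=> [df1 df2]; apply: DeriveDef; first by rewrite /derivable E.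
by rewrite /derive E.
Qed.

End calculus.

(** * Mollifiers on the line *)

Section bump.
Context {R : realType}.

(** The functions exp (- 1 / t) P (1 / t), extended by zero to t <= 0. Letting
    P vary makes the family stable under differentiation, so smoothness at the
    origin needs no induction on the order of vanishing. *)
Definition flat (P : {poly R}) (t : R) : R :=
  if 0 < t then P.[t^-1] * expR (- t^-1) else 0.

(** Each power x ^+ k is at most k! times expR x. *)
Lemma poly_le_expR (P : {poly R}) :
  exists C, forall x : R, 0 <= x -> `|P.[x]| <= C * expR x.
Proof.
elim/poly_ind: P => [|P c [C PC]].
  by exists 0 => x x0; rewrite horner0 normr0 mul0r.
pose D : R := \sum_(i < (size P)) `|P`_i| * (i.+1)`!%:R.
exists (D + `|c|) => x x0.
rewrite !hornerE mulrDl (le_trans (ler_normD _ _))// lerD//; last first.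
  rewrite ler_peMr// -expR0 ler_expR//.
rewrite horner_coef mulr_suml /D mulr_suml (le_trans (ler_norm_sum _ _ _))//.
apply: ler_sum => i _; rewrite -mulrA -exprSr normrM -mulrA ler_wpM2l//.
rewrite normrX ger0_norm// -ler_pdivrMl ?ltr0n ?fact_gt0//.
by rewrite (le_trans _ (expR_ge1Dxn i x0))// mulrC lerDr.
Qed.

(** Dividing by t ^+ 2 only replaces P by P * 'X ^+ 2, and exp (1 / t)
    dominates every polynomial in 1 / t. This is what makes the derivative at
    the origin exist and vanish. *)
Lemma flat_quadratic (P : {poly R}) :
  exists C, forall t, `|flat P t| <= C * t ^+ 2.
Proof.
have [C PC] := poly_le_expR (P * 'X ^+ 2).
have C0 : 0 <= C.
  have := PC 0 (lexx _); rewrite expR0 mulr1; exact: le_trans.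
exists C => t; rewrite /flat; case: ifPn => t0; last first.
  by rewrite normr0 mulr_ge0// sqr_ge0.
have : `|P.[t^-1]| * (t^-1) ^+ 2 <= C * expR t^-1.
  have := PC t^-1; rewrite invr_ge0 (ltW t0) => /(_ isT).
  by rewrite hornerM hornerXn normrM [X in _ * X <= _]ger0_norm ?sqr_ge0.
rewrite exprVn ler_pdivrMr ?exprn_gt0// => PC'.
rewrite normrM [X in _ * X]ger0_norm ?expR_ge0// expRN.
by rewrite ler_pdivrMr ?expR_gt0// mulrAC.
Qed.

Lemma is_derive_flat (P : {poly R}) (t : R) :
  is_derive t 1 (flat P) (flat ('X ^+ 2 * (P - P^`())) t).
Proof.
have [t0|t0|->] := ltgtP t 0.
- rewrite {2}/flat ltNge (ltW t0)/=.
  apply: (@near_eq_is_derive _ _ _ (cst 0)).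
  + near=> s; rewrite /flat/= ltNge ltW//.
    by near: s; exact: lt_nbhsl.
- rewrite {2}/flat t0.
  apply: (@near_eq_is_derive _ _ _ ((fun x => P.[x] * expR (- x)) \o GRing.inv)).
  + near=> s; rewrite /flat/= ifT//.
    by near: s; exact: lt_nbhsr.
  + have dV : is_derive t 1 (GRing.inv : R -> R) (- t ^- 2).
      apply: DeriveDef; first by apply: derivableV => //; rewrite gt_eqF.
      rewrite (_ : GRing.inv = (fun x => (id x)^-1))//.
      rewrite deriveV ?gt_eqF// derive_id/=.
      by rewrite [_ *: _]mulr1.
    have dE : is_derive t^-1 1 (fun x : R => expR (- x)) (- expR (- t^-1)).
      have dN : is_derive t^-1 1 (-%R : R -> R) (-1) by exact: is_deriveNid.
      have := is_derive1_comp dN (is_derive_expR _).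
      by move=> /is_derive_eq; apply; rewrite mulrN1.
    have dP := is_derive_poly P t^-1.
    have := is_derive1_comp dV (is_deriveM dP dE).
    move=> /is_derive_eq; apply.
    rewrite !hornerE /GRing.scale/= exprVn; ring.
- have [C fC] := flat_quadratic P.
  have f0 Q : flat Q 0 = 0 by rewrite /flat ltxx.
  apply: (@is_derive_quadratic _ _ _ _ _ _ C) => h.
  by rewrite !f0 addr0 mulr0 !subr0 [_%:A]mulr1.
Unshelve. all: by end_near. Qed.

(** The algebra generated by the functions flat P of affine arguments. Closure
    under differentiation makes all its members smooth. *)
Inductive flat_alg : (R -> R) -> Prop :=
| flat_alg_flat P a b : flat_alg (fun t => flat P (b * t + a))
| flat_alg_cst c : flat_alg (cst c)
| flat_alg_add f g : flat_alg f -> flat_alg g -> flat_alg (f + g)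
| flat_alg_mul f g : flat_alg f -> flat_alg g -> flat_alg (f * g).

Lemma flat_alg_derive f : flat_alg f ->
  exists2 g, flat_alg g & forall t : R, is_derive t 1 f (g t).
Proof.
elim => {f} [P a b|c|f g _ [f' Ff' df] _ [g' Fg' dg]
  |f g Ff [f' Ff' df] Fg [g' Fg' dg]].
- exists ((fun t => flat ('X ^+ 2 * (P - P^`())) (b * t + a)) * cst b).
    by apply: flat_alg_mul; [exact: flat_alg_flat|exact: flat_alg_cst].
  move=> t.
  have dl : is_derive t 1 (fun t => b * t + a) b.
    apply: (@is_derive_quadratic _ _ _ _ _ _ 0) => h.
    by rewrite [_%:A]mulr1 mul0r normr_le0 subr_eq0; apply/eqP; ring.
  exact: is_derive1_comp dl (is_derive_flat _ _).
- by exists (cst 0); [exact: flat_alg_cst|move=> t; exact: is_derive_cst].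
- exists (f' + g'); first exact: flat_alg_add.
  by move=> t; exact: is_deriveD.
- exists (f * g' + g * f').
    by apply: flat_alg_add; exact: flat_alg_mul.
  by move=> t; exact: is_deriveM.
Qed.

(** The density psi 0 comes with the sequence of its derivatives: the partial
    derivatives of a product of densities are then obtained by changing
    indices. *)
Definition mollifier (eta : R) (psi : nat -> R -> R) : Prop :=
  0 < eta /\
  [/\ forall k (t : R), is_derive t 1 (psi k) (psi k.+1 t),
      forall k t, eta < `|t| -> psi k t = 0,
      forall t, 0 <= psi 0%N t,
      forall t, psi 0%N (- t) = psi 0%N t &
      (\int[lebesgue_measure]_t (psi 0%N t)%:E = 1)%E].

Lemma flat_alg_sequence f : flat_alg f -> exists psi : nat -> R -> R,
  psi 0%N = f /\ forall k (t : R), is_derive t 1 (psi k) (psi k.+1 t).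
Proof.
move=> Ff; exists (fun k => derive1n k f); split; first exact: derive1n0.
have H k : flat_alg (derive1n k f).
  elim: k => [|k /flat_alg_derive[g Fg dg]]; first by rewrite derive1n0.
  rewrite derive1nS (_ : derive1 (derive1n k f) = g)//.
  by apply/funext => t; rewrite derive1E; have [] := dg t.
move=> k t; have [g Fg dg] := flat_alg_derive (H k).
rewrite derive1nS derive1E.
by apply: DeriveDef => //; have [] := dg t.
Qed.

Lemma is_derive_continuous (f g : R -> R) :
  (forall t : R, is_derive t 1 f (g t)) -> continuous f.
Proof.
move=> df t; apply/differentiable_continuous; rewrite -derivable1_diffP.
by have [] := df t.
Qed.

(** The region eta < |t| is open, so derivatives vanish there as well. *)
Lemma derive_support (eta : R) (psi : nat -> R -> R) :
  (forall k (t : R), is_derive t 1 (psi k) (psi k.+1 t)) ->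
  (forall t, eta < `|t| -> psi 0%N t = 0) ->
  forall k t, eta < `|t| -> psi k t = 0.
Proof.
move=> dpsi supp; elim => [//|k IH] t teta.
have : is_derive t 1 (psi k) 0.
  apply: (@near_eq_is_derive _ _ _ (cst 0)).
  near=> s; rewrite IH//.
  near: s; apply: (@cvgr_gt _ _ _ _ Num.norm `|t|) => //.
  exact: norm_continuous.
move=> [_ <-].
by have [_ <-] := dpsi k t.
Unshelve. all: by end_near. Qed.

Lemma continuous_support_bounded (eta : R) (f : R -> R) :
  continuous f -> (forall t, eta < `|t| -> f t = 0) ->
  exists2 B : R, 0 <= B & forall t, `|f t| <= B.
Proof.
move=> cf supp.
have [eta0|eta0] := leP 0 eta; last first.
  exists 0 => // t; rewrite supp ?normr0//.
  by rewrite (lt_le_trans eta0).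
have ab : - eta <= eta by rewrite lerNl (le_trans _ eta0)// oppr_le0.
have cf' : {within `[- eta, eta], continuous (fun t => `|f t|)}.
  apply: continuous_subspaceT => t.
  by apply: (@continuous_comp _ _ _ f Num.norm); [exact: cf|exact: norm_continuous].
have [c _ cmax] := EVT_max ab cf'.
exists `|f c| => // t.
have [te|te] := ltP eta `|t|; first by rewrite supp ?normr0.
by apply: cmax; rewrite in_itv/= -ler_norml.
Qed.

(** The density is a multiple of exp (- 1 / (eta + t)) exp (- 1 / (eta - t))
    on the interval ]-eta, eta[. *)
Lemma mollifier_exists (eta : R) : 0 < eta -> exists psi, mollifier eta psi.
Proof.
move=> eta0.
pose f0 : R -> R := (fun t => flat 1 (1 * t + eta)) * (fun t => flat 1 (-1 * t + eta)).
have flat_ge0 t : 0 <= flat 1 t :> R.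
  by rewrite /flat; case: ifPn => // _; rewrite hornerC mul1r expR_ge0.
have flat_homo (s t : R) : s <= t -> flat 1 s <= flat 1 t.
  rewrite /flat => st; case: ifPn => s0; last first.
    by case: ifPn => // _; rewrite hornerC mul1r expR_ge0.
  rewrite (lt_le_trans s0 st) !hornerC !mul1r ler_expR lerN2.
  by rewrite lef_pV2// posrE// (lt_le_trans s0 st).
have f0E t : f0 t = flat 1 (1 * t + eta) * flat 1 (-1 * t + eta) by [].
have flat0 (t : R) : t <= 0 -> flat 1 t = 0 by rewrite /flat leNgt; case: ifP.
have f0_ge0 t : 0 <= f0 t by exact: mulr_ge0.
have Ff0 : flat_alg f0 by apply: flat_alg_mul; exact: flat_alg_flat.
have supp0 t : eta < `|t| -> f0 t = 0.
  rewrite lter_normr f0E => /orP[] et.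
    by rewrite /= [X in _ * X]flat0 ?mulr0//; lra.
  by rewrite /= [X in X * _]flat0 ?mul0r//; lra.
have even0 t : f0 (- t) = f0 t.
  by rewrite !f0E mulrC mulrN !mulN1r !mul1r opprK.
have [p0 [p0E dp0]] := flat_alg_sequence Ff0.
have cf0 : continuous f0.
  by rewrite -p0E; exact: (is_derive_continuous (dp0 0%N)).
have [B B0 fB] := continuous_support_bounded cf0 supp0.
have mf0 : measurable_fun setT f0 by exact: continuous_measurable_fun.
pose I := (\int[lebesgue_measure]_t (f0 t)%:E)%E.
have I_lty : (I < +oo)%E.
  apply: (@le_lt_trans _ _ (\int[lebesgue_measure]_(t in `[(- eta)%R, eta]) (cst B%:E t))%E).
    rewrite [leRHS]integral_mkcond; apply: ge0_le_integral => //.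
    - by move=> t _; rewrite lee_fin.
    - exact/measurable_EFinP.
    - apply/measurable_restrict => //; rewrite setTI; exact: measurable_cst.
    - move=> t _; rewrite patchE; case: ifPn => [_|].
        by rewrite lee_fin (le_trans (ler_norm _)).
      rewrite notin_setE /= in_itv/= -ler_norml => /negP.
      by rewrite -ltNge => /supp0 ->.
  rewrite integral_cst//= lebesgue_measure_itv/= lte_fin.
  by case: ifP => _; rewrite ?mule0 ?ltry.
pose c := flat 1 (eta / 2) ^+ 2 : R.
have c0 : 0 < c.
  by rewrite exprn_gt0// /flat divr_gt0// hornerC mul1r expR_gt0.
have I_gt0 : (0 < I)%E.
  apply: (@lt_le_trans _ _ (\int[lebesgue_measure]_(t in `[(- (eta/2))%R, (eta/2)%R]) (cst c%:E t))%E).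
    rewrite integral_cst//= lebesgue_measure_itv/= lte_fin ifT; last by lra.
    by rewrite -EFinD -EFinM lte_fin mulr_gt0//; lra.
  rewrite [leLHS]integral_mkcond; apply: ge0_le_integral => //.
  - by move=> t _; rewrite patchE; case: ifPn => //; rewrite lee_fin ltW.
  - apply/measurable_restrict => //; rewrite setTI; exact: measurable_cst.
  - exact/measurable_EFinP.
  - move=> t _; rewrite patchE; case: ifPn => [|_]; last by rewrite lee_fin.
    rewrite inE /= in_itv/= => /andP[t1 t2].
    rewrite lee_fin /c expr2 f0E ler_pM//; apply: flat_homo; lra.
have I_fin : I \is a fin_num by rewrite ge0_fin_numE// ltW.
have fI0 : 0 < fine I by rewrite fine_gt0// I_gt0.
pose f1 : R -> R := cst (fine I)^-1 * f0.
have f1E t : f1 t = (fine I)^-1 * f0 t by [].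
have Ff1 : flat_alg f1 by apply: flat_alg_mul => //; exact: flat_alg_cst.
have [p [pE dp]] := flat_alg_sequence Ff1.
exists p; split => //; split => //.
- apply: derive_support => // t te; by rewrite pE f1E supp0// mulr0.
- by move=> t; rewrite pE f1E mulr_ge0// invr_ge0 ltW.
- by move=> t; rewrite pE !f1E even0.
- rewrite pE; under eq_integral do rewrite f1E EFinM.
  rewrite ge0_integralZl//=.
  + rewrite -/I -{2}(fineK I_fin) -EFinM mulVf//.
    by rewrite gt_eqF.
  + exact/measurable_EFinP.
  + by move=> t _; rewrite lee_fin.
  + by rewrite lee_fin invr_ge0 ltW.
Qed.

End bump.

(** * Lebesgue measure as a product *)

Section lebesgue_product.
Context {R : realType}.
Local Notation mu := (@lebesgue_measure R).

Lemma rV_cons0 n (p : measurableTypeR R * 'rV[R]_n) : rV_cons p ord0 ord0 = p.1.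
Proof. by have /(congr1 fst) := rV_consK p. Qed.

Lemma rV_cons_lift n (p : measurableTypeR R * 'rV[R]_n) (i : 'I_n) :
  rV_cons p ord0 (lift ord0 i) = p.2 ord0 i.
Proof.
rewrite (_ : lift ord0 i = rshift 1 i); first exact: row_mxEr.
exact: val_inj.
Qed.

Lemma ge0_integral_rV_cons n (f : 'rV[R]_n.+1 -> \bar R) :
  measurable_fun setT f -> (forall x, 0 <= f x)%E ->
  (\int[lebesgue_rV n.+1]_x f x =
   \int[mu]_t \int[lebesgue_rV n]_v f (rV_cons (t, v)))%E.
Proof.
move=> mf f0.
have mc : measurable_fun setT (@rV_cons R n) := measurable_rV_cons (n:=n).
transitivity (\int[mu \x lebesgue_rV n]_p (f \o @rV_cons R n) p)%E.
  rewrite -(@ge0_integral_pushforward _ _ _ _ _ _ mc _ setT)//.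
rewrite fubini_tonelli1//.
  exact: measurableT_comp mf mc.
by move=> x; exact: f0.
Qed.

(** Induction on the dimension, with Tonelli's theorem for the first
    coordinate. *)
Lemma integral_rV_prod n (f : 'I_n -> R -> R) (c : 'I_n -> R) :
  (forall i, measurable_fun setT (f i)) -> (forall i t, 0 <= f i t) ->
  (forall i, \int[mu]_t (f i t)%:E = (c i)%:E)%E ->
  (\int[lebesgue_rV n]_x (\prod_i f i (x ord0 i))%:E = (\prod_i c i)%:E)%E.
Proof.
elim: n f c => [|n IH] f c mf f0 fc.
  rewrite big_ord0 integral_dirac//=; last first.
    by under eq_fun do rewrite big_ord0; exact: measurable_cst.
  by rewrite big_ord0 diracT mul1e.
rewrite ge0_integral_rV_cons; last first.
- by move=> x; rewrite lee_fin prodr_ge0.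
- apply/measurable_EFinP; apply: measurable_prod => i _.
  exact: measurableT_comp (mf i) (measurable_coord i).
under eq_integral => t _.
  under eq_integral => v _.
    rewrite big_ord_recl EFinM.
    rewrite rV_cons0; under eq_bigr => i _ do rewrite rV_cons_lift.
    over.
  rewrite /= ge0_integralZl_EFin//; last first.
  - apply/measurable_EFinP; apply: measurable_prod => i _.
    exact: measurableT_comp (mf _) (measurable_coord i).
  - by move=> x _; rewrite lee_fin prodr_ge0.
  rewrite (IH (fun i => f (lift ord0 i)) (fun i => c (lift ord0 i)))//.
  over.
rewrite /= ge0_integralZr//=.
- by rewrite fc -EFinM big_ord_recl.
- by apply/measurable_EFinP; exact: mf.
- by move=> t _; rewrite lee_fin.
- rewrite lee_fin prodr_ge0// => i _; rewrite -lee_fin -fc.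
  by apply: integral_ge0 => t _; rewrite lee_fin.
Qed.

Definition rect n (A : 'I_n -> set R) : set 'rV[R]_n :=
  [set x | forall i, A i (x ord0 i)].

Lemma rect_indicator n (A : 'I_n -> set R) (x : 'rV[R]_n) :
  \1_(rect A) x = \prod_i \1_(A i) (x ord0 i) :> R.
Proof.
have [xb|xb] := pselect (rect A x).
  by rewrite indicE mem_set// big1// => i _; rewrite indicE mem_set.
rewrite indicE memNset//.
move/existsNP : xb => [i xi].
by rewrite (bigD1 i)//= indicE memNset ?mul0r.
Qed.

Lemma measurable_rect n (A : 'I_n -> set R) : (forall i, measurable (A i : set (measurableTypeR R))) ->
  measurable (rect A).
Proof.
move=> mA.
have -> : rect A = (fun x : 'rV[R]_n => \prod_i \1_(A i) (x ord0 i) : R)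
    @^-1` [set 1].
  apply/seteqP; split => x /=; rewrite -rect_indicator indicE.
    by move=> xb; rewrite mem_set.
  have [xb _|xb] := pselect (rect A x); first by [].
  by rewrite memNset// => /eqP; rewrite eq_sym oner_eq0.
rewrite -[X in measurable X]setTI.
have : measurable_fun setT (fun x : 'rV[R]_n => \prod_i \1_(A i) (x ord0 i) : R).
  apply: measurable_prod => i _.
  apply: measurableT_comp (measurable_coord i).
  exact: measurable_indic.
by apply.
Qed.

Lemma lebesgue_rV_rect n (A : 'I_n -> set R) (c : 'I_n -> R) :
  (forall i, measurable (A i : set (measurableTypeR R))) -> (forall i, mu (A i) = (c i)%:E) ->
  lebesgue_rV n (rect A) = (\prod_i c i)%:E.
Proof.
move=> mA muA.
transitivity (\int[lebesgue_rV n]_x (\1_(rect A) x)%:E)%E.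
  by rewrite integral_indic ?setIT//; exact: measurable_rect.
under eq_integral do rewrite rect_indicator.
apply: (integral_rV_prod (f := fun i => \1_(A i))) => //.
  move=> i; exact: (measurable_indic (mA i)).
by move=> i; rewrite integral_indic//= setIT muA.
Qed.

Definition box n (a b : 'I_n -> R) : set 'rV[R]_n :=
  [set x | forall i, a i <= x ord0 i <= b i].

Lemma boxE n (a b : 'I_n -> R) : box a b = rect (fun i => `[a i, b i]%classic).
Proof.
by apply/seteqP; split => x xb i; have := xb i; rewrite /= in_itv.
Qed.

Lemma measurable_box n (a b : 'I_n -> R) : measurable (box a b).
Proof. by rewrite boxE; exact: measurable_rect. Qed.

Lemma lebesgue_rV_box n (a b : 'I_n -> R) : (forall i, a i <= b i) ->
  lebesgue_rV n (box a b) = (\prod_i (b i - a i))%:E.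
Proof.
move=> ab; rewrite boxE; apply: lebesgue_rV_rect => // i.
rewrite lebesgue_measure_itv/= lte_fin.
case: ifP => //; rewrite lt_neqAle ab andbT => /negbFE/eqP ->.
by rewrite subrr.
Qed.

Lemma lebesgue_measure_shift (s : R) (A : set R) : measurable A ->
  pushforward mu (fun t : R => (t + s : measurableTypeR R)) A = mu A.
Proof.
have ms : measurable_fun setT (fun t : measurableTypeR R => (t + s : measurableTypeR R)).
  exact: measurable_funD.
move=> mA; apply/esym/lebesgue_measure_unique => //= _ [[a b]] _ <-.
rewrite /pushforward (_ : _ @^-1` _ = `]a - s, b - s]%classic).
  rewrite !lebesgue_measure_itv/= !lte_fin ltrD2r.
  by case: ifP => // _; rewrite -!EFinD; congr EFin; ring.
by apply/seteqP; split => t /=; rewrite !in_itv/= ltrBlDr lerBrDr.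
Qed.

Lemma ge0_integral_shift (s : R) (f : R -> R) : measurable_fun setT f ->
  (forall t, 0 <= f t) ->
  (\int[mu]_t (f (t - s))%:E = \int[mu]_t (f t)%:E)%E.
Proof.
move=> mf f0.
have ms : measurable_fun setT (fun t : measurableTypeR R => (t + - s : measurableTypeR R)).
  exact: measurable_funD.
transitivity (\int[pushforward mu (fun t : R => ((t + - s)%R : measurableTypeR R))]_t (f t)%:E)%E.
  rewrite (@ge0_integral_pushforward _ _ _ _ _ _ ms mu setT (EFin \o f))//.
    by apply/measurable_EFinP.
  by move=> t _; rewrite lee_fin.
by apply: eq_measure_integral => A mA _; exact: lebesgue_measure_shift.
Qed.

End lebesgue_product.

(** * Product kernels *)

Section kernel.
Context {R : realType} {n : nat}.
Implicit Types (al : 'I_n -> nat) (x y v : 'rV[R]_n).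

(** A multi-index al counts the derivatives in each coordinate of y. *)
Definition kern (psi : nat -> R -> R) al x y : R :=
  \prod_i psi (al i) (y ord0 i - x ord0 i).

Definition incr (j : 'I_n) al : 'I_n -> nat := fun i => ((j == i) + al i)%N.

Lemma is_derive_line0 (V : normedModType R) (f : V -> R) (x v : V) (d : R) :
  is_derive (0 : R) 1 (fun h : R => f (h *: v + x)) d -> is_derive x v f d.
Proof.
have E : (fun h : R => h^-1 *: (((fun h : R => f (h *: v + x)) \o shift 0) (h *: 1)
      - f (0 *: v + x))) =
    (fun h : R => h^-1 *: ((f \o shift x) (h *: v) - f x)).
  apply/funext => h /=; congr (_ *: (f _ - f _)).
    by rewrite [_%:A]mulr1 addr0.
  by rewrite scale0r add0r.
move=> [df1 df2]; apply: DeriveDef; first by rewrite /derivable -E.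
by rewrite /derive -E.
Qed.

(** The family g j holds the factors of the product in which the j-th one has
    been differentiated, whence the condition that g j and f agree off j. *)
Lemma is_derive_bigprod (V : normedModType R) (I : eqType) (s : seq I)
    (f : I -> V -> R) (g : I -> I -> V -> R) (d : I -> R) (x v : V) :
  uniq s ->
  (forall i, is_derive x v (f i) (d i * g i i x)) ->
  (forall i j, i != j -> g j i = f i) ->
  is_derive x v (fun z => \prod_(i <- s) f i z)
    (\sum_(j <- s) d j * \prod_(i <- s) g j i x).
Proof.
move=> us df gf; elim: s us => [_|i s IH /= /andP[ius us]].
  under eq_fun do rewrite big_nil.
  by rewrite big_nil; exact: is_derive_cst.
have -> : (fun z => \prod_(k <- i :: s) f k z) =
    f i * (fun z => \prod_(k <- s) f k z).
  by apply/funext => z; rewrite big_cons.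
apply: (is_derive_eq (is_deriveM (df i) (IH us))).
rewrite big_cons addrC; congr (_ + _).
  rewrite /GRing.scale/= big_cons mulrC -mulrA; congr (_ * (_ * _)).
  apply: eq_big_seq => k ks.
  by rewrite gf//; apply: contraNneq ius => <-.
rewrite /GRing.scale/= big_distrr/=; apply: eq_big_seq => k ks.
rewrite big_cons mulrCA gf//.
by apply: contraNneq ius => ->.
Qed.

Section psi.
Variable psi : nat -> R -> R.
Hypothesis dpsi : forall k (t : R), is_derive t 1 (psi k) (psi k.+1 t).

Lemma is_derive_kern al x y v :
  is_derive y v (kern psi al x) (\sum_j v ord0 j * kern psi (incr j al) x y).
Proof.
rewrite /kern.
apply: (@is_derive_bigprod 'rV[R]_n _ (index_enum 'I_n)
  (fun i z => psi (al i) (z ord0 i - x ord0 i))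
  (fun j i z => psi (incr j al i) (z ord0 i - x ord0 i)) (fun i => v ord0 i)).
- exact: index_enum_uniq.
- move=> i; apply: is_derive_line0.
  have dl : is_derive (0 : R) 1 (fun h : R => (h *: v + y) ord0 i - x ord0 i) (v ord0 i).
    apply: (@is_derive_quadratic _ _ _ _ _ _ 0) => h.
    rewrite mul0r normr_le0 subr_eq0 addr0 [_%:A]mulr1 !mxE; apply/eqP; ring.
  rewrite /incr eqxx add1n mulrC.
  have E : y ord0 i - x ord0 i = (fun h : R => (h *: v + y) ord0 i - x ord0 i) 0.
    by rewrite /= scale0r add0r.
  rewrite E; exact: (is_derive1_comp dl (dpsi _ _)).
- by move=> i j ij; rewrite /incr eq_sym (negbTE ij).
Qed.

Lemma kern_shift al x y v : kern psi al (x + v) y = kern psi al x (y - v).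
Proof. by apply: eq_bigr => i _; rewrite !mxE opprD addrAC addrA. Qed.

(** The kernel depends on y - x only, so moving the centre instead of y
    changes the sign. *)
Lemma is_derive_kern_center al x y v (t : R) :
  is_derive t 1 (fun s : R => kern psi al (s *: v + x) y)
    (- \sum_j v ord0 j * kern psi (incr j al) (t *: v + x) y).
Proof.
have -> : (fun s : R => kern psi al (s *: v + x) y) =
    (fun s : R => kern psi al x (y + s *: (- v))).
  by apply/funext => s; rewrite addrC kern_shift scalerN.
apply: is_derive_line.
apply: (is_derive_eq (is_derive_kern _ _ _ _)).
rewrite -sumrN; apply: eq_bigr => j _.
by rewrite mxE mulNr [_ *: v + x]addrC kern_shift scalerN.
Qed.

Lemma continuous_psi k : continuous (psi k).
Proof. exact: (is_derive_continuous (dpsi k)). Qed.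

Lemma continuous_kern al x : continuous (kern psi al x).
Proof.
apply: (@continuous_big R 'I_n *%R 1 xpredT (@mul_continuous R) 'rV[R]_n (index_enum _)
  (fun i z => psi (al i) (z ord0 i - x ord0 i))) => i _ y.
apply: (@continuous_comp _ _ _ (fun z : 'rV[R]_n => z ord0 i - x ord0 i) (psi (al i))).
  have c1 : {for y, continuous (fun z : 'rV[R]_n => z ord0 i)}.
    exact: (@coord_continuous R 1 n ord0 i).
  exact: cvgB c1 (cvg_cst _).
exact: continuous_psi.
Qed.

Lemma measurable_psi k : measurable_fun setT (psi k).
Proof. by apply: continuous_measurable_fun; exact: continuous_psi. Qed.

Lemma measurable_kern2 al :
  measurable_fun setT (fun p : 'rV[R]_n * 'rV[R]_n => kern psi al p.1 p.2).
Proof.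
apply: measurable_prod => i _.
apply: (measurableT_comp (measurable_psi (al i))).
by apply: measurable_funB; apply: (measurableT_comp (measurable_coord i)).
Qed.

Lemma measurable_kern al x : measurable_fun setT (kern psi al x).
Proof.
apply: measurable_prod => i _.
apply: (measurableT_comp (measurable_psi (al i))).
by apply: measurable_funB => //; exact: measurable_coord.
Qed.

Lemma partials_kern (s : seq 'I_n) x :
  partials s (kern psi (fun=> 0%N) x) = kern psi (fun i => count_mem i s) x.
Proof.
elim: s => [//|j s IH]; rewrite /partials/= -/(partials s _) IH.
apply/funext => y; rewrite /partial.
have [_ ->] := is_derive_kern (fun i => count_mem i s) x y (delta_mx ord0 j).
rewrite (bigD1 j)//= big1 ?addr0 ?mxE ?eqxx ?mul1r//.
by move=> i ij; rewrite mxE (negbTE ij) andbF mul0r.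
Qed.

Lemma smooth_kern x : smooth (kern psi (fun=> 0%N) x).
Proof.
move=> s; rewrite partials_kern; split; first exact: continuous_kern.
by move=> i y; have [] := is_derive_kern (fun i => count_mem i s) x y (delta_mx ord0 i).
Qed.

End psi.

Section mollifier.
Variables (eta : R) (psi : nat -> R -> R).
Hypothesis mpsi : mollifier eta psi.
Local Notation phi := (kern psi (fun=> 0%N)).

Let dpsi : forall k (t : R), is_derive t 1 (psi k) (psi k.+1 t).
Proof. by have [_ []] := mpsi. Qed.

Lemma kern_support al x y i : eta < `|y ord0 i - x ord0 i| -> kern psi al x y = 0.
Proof.
have [_ [_ supp _ _ _]] := mpsi => yx.
by rewrite /kern (bigD1 i)//= supp ?mul0r.
Qed.

Lemma kern_bounded al :
  exists2 B : R, 0 <= B & forall x y, `|kern psi al x y| <= B.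
Proof.
have [_ [_ supp _ _ _]] := mpsi.
have bB k : exists B : R, 0 <= B /\ forall t, `|psi k t| <= B.
  by have [B B0 kB] := continuous_support_bounded (continuous_psi dpsi (k:=k)) (supp k); exists B.
have [B BP] := choice bB.
exists (\prod_i B (al i)); first by apply: prodr_ge0 => i _; case: (BP (al i)).
move=> x y; rewrite /kern normr_prod; apply: ler_prod => i _.
by rewrite normr_ge0/=; case: (BP (al i)).
Qed.

Lemma phi_ge0 x y : 0 <= phi x y.
Proof. by have [_ [_ _ p0 _ _]] := mpsi; exact: prodr_ge0. Qed.

Lemma phi_sym x y : phi x y = phi y x.
Proof.
have [_ [_ _ _ pN _]] := mpsi; apply: eq_bigr => i _.
by rewrite -pN opprB.
Qed.

Lemma integral_phi x : (\int[lebesgue_rV n]_y (phi x y)%:E = 1)%E.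
Proof.
have [_ [_ _ p0 _ p1]] := mpsi.
have mp : measurable_fun setT (psi 0%N) by exact: measurable_psi.
rewrite (@integral_rV_prod _ _ (fun i t => psi 0%N (t - x ord0 i)) (fun=> 1))//.
- by rewrite big1.
- move=> i; apply: measurableT_comp => //.
  exact: measurable_funB.
- by move=> i; rewrite ge0_integral_shift.
Qed.

Lemma test_function_phi (U : set 'rV[R]_n) x :
  (forall y, (forall i, `|y ord0 i - x ord0 i| <= eta) -> U y) ->
  test_function U (phi x).
Proof.
move=> xU.
pose B : set 'rV[R]_n := [set y | forall i, `[x ord0 i - eta, x ord0 i + eta]%classic (y ord0 i)].
have cB : compact B.
  apply: (@rV_compact _ _ (fun i => `[x ord0 i - eta, x ord0 i + eta]%classic)) => i.
  exact: segment_compact.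
have sB : closure [set y | phi x y != 0] `<=` B.
  rewrite [X in _ `<=` X](_ : B = closure B); last first.
    apply/closure_id; apply: compact_closed cB; exact: norm_hausdorff.
  apply: closureS => y /=; apply: contra_neqP => /existsNP[i yi].
  apply: (@kern_support _ _ _ i); rewrite ltNge; apply/negP => H; apply: yi.
  by rewrite /= in_itv/= -ler_distlC distrC.
split.
- exact: smooth_kern.
- by apply: subclosed_compact sB => //; exact: closed_closure.
- move=> y /sB yB; apply: xU => i.
  by have := yB i; rewrite /= in_itv/= -ler_distlC distrC.
Qed.

End mollifier.

End kernel.

(** * Derivatives of mollified functions *)

Lemma Rintegral_bigsum d (T : measurableType d) (R : realType)
    (mu : {measure set T -> \bar R}) (I : Type) (s : seq I) (h : I -> T -> R) :
  (forall j, mu.-integrable setT (EFin \o h j)) ->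
  \int[mu]_y (\sum_(j <- s) h j y) = \sum_(j <- s) \int[mu]_y h j y.
Proof.
move=> inth.
have ints s' : mu.-integrable setT (EFin \o (fun y => \sum_(j <- s') h j y)).
  apply: (eq_integrable _ (fun y => \sum_(j <- s') (h j y)%:E)%E) => //.
    by move=> y _; rewrite /= sumEFin.
  by apply: integrable_sum => // j _; exact: inth.
elim: s => [|j s IH].
  by under eq_Rintegral do rewrite big_nil; rewrite Rintegral_cst// mul0r big_nil.
under eq_Rintegral do rewrite big_cons.
rewrite (RintegralD measurableT (inth j) (ints s)).
by rewrite IH big_cons.
Qed.

Section mollification.
Context {R : realType} {n : nat}.
Variables (eta : R) (psi : nat -> R -> R).
Hypothesis mpsi : mollifier eta psi.
Local Notation mu := (lebesgue_rV (R := R) n).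
Implicit Types (f : 'rV[R]_n -> R) (al : 'I_n -> nat) (x y v : 'rV[R]_n).

Definition moll f al x : R := \int[mu]_y (f y * kern psi al x y).

Let dpsi : forall k (t : R), is_derive t 1 (psi k) (psi k.+1 t).
Proof. by have [_ []] := mpsi. Qed.

Lemma integrable_EFinZ (c : R) f : mu.-integrable setT (EFin \o f) ->
  mu.-integrable setT (EFin \o (fun y => c * f y)).
Proof.
move=> intf; apply: (eq_integrable _ (fun y => c%:E * (EFin \o f) y)%E) => //.
exact: integrableZl.
Qed.

Lemma integrable_mul_kern f al x : mu.-integrable setT (EFin \o f) ->
  mu.-integrable setT (fun y => (f y * kern psi al x y)%:E).
Proof.
move=> intf; have [B B0 kB] := kern_bounded (n := n) mpsi al.
have [/measurable_EFinP mf _] := integrableP _ _ _ intf.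
apply: (@le_integrable _ _ _ mu setT _ _ (fun y => B%:E * (EFin \o f) y)%E) => //.
- apply/measurable_EFinP; apply: measurable_funM => //.
  exact: measurable_kern.
- move=> y _; rewrite /= lee_fin !normrM mulrC ler_wpM2r//.
  by rewrite [leRHS]ger0_norm.
- exact: integrableZl.
Qed.

Lemma moll_bounded f al : mu.-integrable setT (EFin \o f) ->
  exists2 C : R, 0 <= C & forall x, `|moll f al x| <= C.
Proof.
move=> intf; have [B B0 kB] := kern_bounded (n := n) mpsi al.
exists (\int[mu]_y (B * `|f y|)).
  by apply: Rintegral_ge0 => y _; rewrite mulr_ge0.
move=> x; rewrite /moll.
apply: (le_trans (le_normr_Rintegral _ (integrable_mul_kern al x intf))) => //.
apply: le_Rintegral => //.
- by have := integrable_norm (integrable_mul_kern al x intf).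
- exact: (integrable_EFinZ B (integrable_norm intf)).
- by move=> y _; rewrite normrM mulrC ler_wpM2r.
Qed.

(** Differentiation under the integral sign: the derivatives of the kernel are
    bounded, so a multiple of |f| dominates. *)
Lemma is_derive_moll f al x v : mu.-integrable setT (EFin \o f) ->
  is_derive x v (moll f al) (- \sum_j v ord0 j * moll f (incr j al) x).
Proof.
move=> intf; apply: is_derive_line0.
pose g (t : R) y := f y * kern psi al (t *: v + x) y.
pose D (t : R) y := f y * - \sum_j v ord0 j * kern psi (incr j al) (t *: v + x) y.
have dg (t : R) y : is_derive t 1 (g ^~ y) (D t y).
  have dk := is_derive_kern_center dpsi al x y v t.
  have := is_deriveZ (f y) dk; exact.
have dgE (t : R) y : partial1of2 g t y = D t y.
  by rewrite partial1of2E; have [_ ->] := dg t y.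
have bB j : exists B : R, 0 <= B /\ forall x y, `|kern psi (incr j al) x y| <= B.
  by have [B B0 kB] := kern_bounded (n := n) mpsi (incr j al); exists B.
have [B BP] := choice bB.
pose C := \sum_j `|v ord0 j| * B j.
have C0 : 0 <= C.
  by apply: sumr_ge0 => j _; rewrite mulr_ge0//; case: (BP j).
have I0 : `](-1 : R), 1[%classic 0 by rewrite /= in_itv/= ltrN10 ltr01.
have intg t : `](-1 : R), 1[%classic t -> mu.-integrable setT (EFin \o g t).
  by move=> _; exact: integrable_mul_kern.
have derg t y : `](-1 : R), 1[%classic t -> setT y -> derivable (g ^~ y) t 1.
  by move=> _ _; have [] := dg t y.
have G0 y : 0 <= C * `|f y| by rewrite mulr_ge0.
have intG : mu.-integrable setT (EFin \o (fun y => C * `|f y|)).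
  exact: (integrable_EFinZ C (integrable_norm intf)).
have Gub t y : `](-1 : R), 1[%classic t -> setT y -> `|partial1of2 g t y| <= C * `|f y|.
  move=> _ _; rewrite dgE /D normrM mulrC ler_wpM2r// normrN.
  apply: (le_trans (ler_norm_sum _ _ _)); apply: ler_sum => j _.
  by rewrite normrM ler_wpM2l//; case: (BP j).
have dF := derivable_under_integral measurableT I0 intg derg G0 intG Gub.
have eF := differentiation_under_integral measurableT I0 intg derg G0 intG Gub.
apply: DeriveDef; first exact: dF.
rewrite -derive1E eF.
rewrite (_ : (fun y => _) = D 0); last by apply/funext => y; exact: dgE.
rewrite /D scale0r add0r.
transitivity (\int[mu]_y (\sum_j (- v ord0 j) * (f y * kern psi (incr j al) x y))).
  apply: eq_Rintegral => y _; rewrite mulrN mulr_sumr -sumrN.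
  by apply: eq_bigr => j _; rewrite mulrCA mulNr.
rewrite -sumrN.
rewrite (Rintegral_bigsum _ (fun j => integrable_EFinZ (- v ord0 j)
  (integrable_mul_kern (incr j al) x intf))).
apply: eq_bigr => j _; rewrite RintegralZl ?mulNr//.
exact: integrable_mul_kern.
Qed.

End mollification.

(** * Oscillation at small scales *)

(** For splitting f y - f x as (f y - g y) + (g y - g x) - (f x - g x). *)
Lemma norm3_exp (R : realDomainType) (m : nat) (a b c : R) :
  `|a + b - c| ^+ m <= 3 ^+ m * (`|b| ^+ m + (`|c| ^+ m + `|a| ^+ m)).
Proof.
pose M := Num.max `|b| (Num.max `|c| `|a|).
have abc : `|a + b - c| <= 3 * M.
  have := ler_normB (a + b) c; have := ler_normD a b.
  have : `|a| <= M by rewrite !le_max lexx !orbT.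
  have : `|b| <= M by rewrite !le_max lexx.
  have : `|c| <= M by rewrite !le_max lexx !orbT.
  by lra.
apply: (@le_trans _ _ ((3 * M) ^+ m)).
  by apply: lerXn2r; rewrite ?nnegrE// (le_trans _ abc).
rewrite exprMn ler_wpM2l ?exprn_ge0//.
have [a0 b0 c0] : [/\ 0 <= `|a| ^+ m, 0 <= `|b| ^+ m & 0 <= `|c| ^+ m].
  by split; exact: exprn_ge0.
by rewrite /M; case: (leP `|b|) => _; [case: (leP `|c|) => _|]; lra.
Qed.

Section oscillation.
Context {R : realType} {n : nat}.
Local Notation mu := (lebesgue_rV (R := R) n).
Implicit Types (f g : 'rV[R]_n -> R).

Definition unit_box : set 'rV[R]_n := box (fun=> -1) (fun=> 1).
Local Notation D := unit_box.

(** How much f varies, in the power m, over the width of the kernel; by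
    Jensen's inequality this controls the distance of f to its mollification.
    *)
Definition osc (psi : nat -> R -> R) (m : nat) f : \bar R :=
  (\int[mu \x mu]_p (\1_D p.1 * \1_D p.2 *
    (kern psi (fun=> 0%N) p.1 p.2 * `|f p.2 - f p.1| ^+ m))%:E)%E.

(** Continuity of translations in L^m, in averaged form. *)
Definition vanishing_osc (m : nat) f : Prop := forall e : R, 0 < e ->
  exists2 eta0 : R, 0 < eta0 & forall eta psi, eta <= eta0 -> mollifier eta psi ->
    (osc psi m f <= e%:E)%E.

Lemma measurable_unit_box : measurable D.
Proof. exact: measurable_box. Qed.

Let mind : measurable_fun setT (\1_D : 'rV[R]_n -> R).
Proof. by apply: measurable_indic; exact: measurable_unit_box. Qed.

Section fixed_mollifier.
Variables (eta : R) (psi : nat -> R -> R).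
Hypothesis mpsi : mollifier eta psi.
Local Notation phi := (kern psi (fun=> 0%N)).

Let mphi : measurable_fun setT (fun p : 'rV[R]_n * 'rV[R]_n => phi p.1 p.2).
Proof. by apply: measurable_kern2; have [_ []] := mpsi. Qed.

Let mphi1 (x : 'rV[R]_n) : measurable_fun setT (phi x).
Proof. by apply: measurable_kern; have [_ []] := mpsi. Qed.

Lemma integral_phi_fst (h : 'rV[R]_n -> R) : measurable_fun setT h ->
  (forall x, 0 <= h x) ->
  (\int[mu \x mu]_p (phi p.1 p.2 * h p.1)%:E = \int[mu]_x (h x)%:E)%E.
Proof.
move=> mh h0; rewrite fubini_tonelli1; last 2 first.
- apply/measurable_EFinP; apply: measurable_funM => //.
  exact: measurableT_comp.
- by move=> p; rewrite lee_fin mulr_ge0// (phi_ge0 mpsi).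
apply: eq_integral => x _; rewrite /fubini_F/=.
under eq_integral do rewrite mulrC EFinM.
rewrite ge0_integralZl_EFin//.
- by rewrite (integral_phi mpsi) mule1.
- by move=> y _; rewrite lee_fin (phi_ge0 mpsi).
- by apply/measurable_EFinP.
Qed.

Lemma integral_phi_snd (h : 'rV[R]_n -> R) : measurable_fun setT h ->
  (forall x, 0 <= h x) ->
  (\int[mu \x mu]_p (phi p.1 p.2 * h p.2)%:E = \int[mu]_x (h x)%:E)%E.
Proof.
move=> mh h0; rewrite fubini_tonelli2; last 2 first.
- apply/measurable_EFinP; apply: measurable_funM => //.
  exact: measurableT_comp.
- by move=> p; rewrite lee_fin mulr_ge0// (phi_ge0 mpsi).
apply: eq_integral => x _; rewrite /fubini_G/=.
under eq_integral do rewrite mulrC EFinM (phi_sym mpsi).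
rewrite ge0_integralZl_EFin//.
- by rewrite (integral_phi mpsi) mule1.
- by move=> y _; rewrite lee_fin (phi_ge0 mpsi).
- by apply/measurable_EFinP.
Qed.

Lemma measurable_osc_integrand (m : nat) f : measurable_fun setT f ->
  measurable_fun setT (fun p : 'rV[R]_n * 'rV[R]_n => \1_D p.1 * \1_D p.2 *
    (phi p.1 p.2 * `|f p.2 - f p.1| ^+ m)).
Proof.
move=> mf; apply: measurable_funM.
  by apply: measurable_funM; exact: measurableT_comp.
apply: measurable_funM => //; apply: measurable_funX; apply: measurableT_comp => //.
by apply: measurable_funB; exact: measurableT_comp.
Qed.

Lemma osc_integrand_ge0 (m : nat) f (p : 'rV[R]_n * 'rV[R]_n) :
  0 <= \1_D p.1 * \1_D p.2 * (phi p.1 p.2 * `|f p.2 - f p.1| ^+ m).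
Proof. by rewrite !mulr_ge0 ?exprn_ge0// (phi_ge0 mpsi). Qed.

Lemma osc_scale (m : nat) (c : R) f : measurable_fun setT f ->
  osc psi m (fun x => c * f x) = ((`|c| ^+ m)%:E * osc psi m f)%E.
Proof.
move=> mf; rewrite /osc -ge0_integralZl_EFin//.
- apply: eq_integral => p _; rewrite -EFinM; congr EFin.
  by rewrite -mulrBr normrM exprMn; ring.
- by move=> p _; rewrite lee_fin osc_integrand_ge0.
- by apply/measurable_EFinP; exact: measurable_osc_integrand.
Qed.

(** The kernel has integral one in each of its two variables, so replacing f
    by g costs the distance of f to g in L^m twice. *)
Lemma osc_approx (m : nat) f g : measurable_fun setT f -> measurable_fun setT g ->
  (osc psi m f <= (3 ^+ m)%:E *
    (osc psi m g + (\int[mu]_x (\1_D x * `|f x - g x| ^+ m)%:E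
                  + \int[mu]_x (\1_D x * `|f x - g x| ^+ m)%:E)))%E.
Proof.
move=> mf mg.
pose h x := \1_D x * `|f x - g x| ^+ m.
have mh : measurable_fun setT h.
  apply: measurable_funM => //; apply: measurable_funX; apply: measurableT_comp => //.
  exact: measurable_funB.
have h0 x : 0 <= h x by rewrite mulr_ge0// exprn_ge0.
have mh1 : measurable_fun setT (fun p : 'rV[R]_n * 'rV[R]_n => phi p.1 p.2 * h p.1).
  by apply: measurable_funM => //; exact: measurableT_comp.
have mh2 : measurable_fun setT (fun p : 'rV[R]_n * 'rV[R]_n => phi p.1 p.2 * h p.2).
  by apply: measurable_funM => //; exact: measurableT_comp.
have h10 p : 0 <= phi p.1 p.2 * h p.1 by rewrite mulr_ge0// (phi_ge0 mpsi).
have h20 p : 0 <= phi p.1 p.2 * h p.2 by rewrite mulr_ge0// (phi_ge0 mpsi).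
rewrite [X in (_ + (X + _))%E](esym (integral_phi_fst mh h0)).
rewrite [X in (_ + (_ + X))%E](esym (integral_phi_snd mh h0)).
rewrite /osc -ge0_integralD//; last 4 first.
- by move=> p _; rewrite lee_fin.
- by apply/measurable_EFinP.
- by move=> p _; rewrite lee_fin.
- by apply/measurable_EFinP.
rewrite -ge0_integralD//; last 4 first.
- by move=> p _; rewrite lee_fin osc_integrand_ge0.
- by apply/measurable_EFinP; exact: measurable_osc_integrand.
- by move=> p _; rewrite -EFinD lee_fin addr_ge0.
- by apply/measurable_EFinP; exact: measurable_funD.
rewrite -ge0_integralZl_EFin//; last 2 first.
- by move=> p _; rewrite -!EFinD lee_fin !addr_ge0// osc_integrand_ge0.
- apply/measurable_EFinP; apply: measurable_funD; last exact: measurable_funD.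
  exact: measurable_osc_integrand.
apply: ge0_le_integral => //.
- by move=> p _; rewrite lee_fin osc_integrand_ge0.
- by apply/measurable_EFinP; exact: measurable_osc_integrand.
- apply/measurable_EFinP; apply: measurable_funM => //.
  apply: measurable_funD; last exact: measurable_funD.
  exact: measurable_osc_integrand.
- move=> [x y] _ /=; rewrite -!EFinD -EFinM lee_fin /h.
  set rhs := (X in _ <= X).
  have rhs0 : 0 <= rhs.
    by rewrite mulr_ge0 ?exprn_ge0// !addr_ge0// ?mulr_ge0 ?exprn_ge0// (phi_ge0 mpsi).
  have [xD|xD] := boolP (x \in D); last first.
    by apply: le_trans rhs0; rewrite [\1_D x]indicE (negbTE xD) !mul0r.
  have [yD|yD] := boolP (y \in D); last first.
    by apply: le_trans rhs0; rewrite [\1_D y]indicE (negbTE yD) mulr0 !mul0r.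
  rewrite {rhs0}/rhs.
  rewrite !indicE xD yD !mul1r -!mulrDr mulrCA ler_wpM2l ?(phi_ge0 mpsi)//.
  rewrite (_ : f y - f x = (f y - g y) + (g y - g x) - (f x - g x)); last by ring.
  exact: norm3_exp.
Qed.

End fixed_mollifier.

End oscillation.

Section vanishing_oscillation.
Context {R : realType} {n : nat}.
Local Notation mu := (lebesgue_rV (R := R) n).
Implicit Types (f g : 'rV[R]_n -> R).
Local Notation D := (@unit_box R n).

Lemma unit_box_lty : (mu D < +oo)%E.
Proof. by rewrite lebesgue_rV_box ?ltry// => i; lra. Qed.

Lemma measurable_indic_unit_box : measurable_fun setT (\1_D : 'rV[R]_n -> R).
Proof. by apply: measurable_indic; exact: measurable_unit_box. Qed.

Lemma integrable_unit_box : mu.-integrable setT (EFin \o (\1_D : 'rV[R]_n -> R)).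
Proof.
apply/integrableP; split.
  by apply/measurable_EFinP; exact: measurable_indic_unit_box.
under eq_integral do rewrite /= ger0_norm//.
by rewrite integral_indic ?setIT ?unit_box_lty//; exact: measurable_unit_box.
Qed.

Section power.
Variable m : nat.
Hypothesis m_gt0 : (0 < m)%N.

Lemma vanishing_oscD f g : measurable_fun setT f -> measurable_fun setT g ->
  vanishing_osc m f -> vanishing_osc m g -> vanishing_osc m (fun x => f x + g x).
Proof.
move=> mf mg vf vg e e0.
have e3 : 0 < e / 3 ^+ m / 2 by rewrite !divr_gt0// exprn_gt0.
have [a a0 fa] := vf _ e3; have [b b0 gb] := vg _ e3.
exists (Num.min a b); first by rewrite lt_min a0.
move=> eta psi; rewrite le_min => /andP[ea eb] mpsi.
have -> : e = 3 ^+ m * (e / 3 ^+ m / 2 + e / 3 ^+ m / 2).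
  by rewrite -splitr mulrC divfK// gt_eqF// exprn_gt0.
rewrite EFinM EFinD.
apply: (@le_trans _ _ ((3 ^+ m)%:E * (osc psi m f + osc psi m g))%E); last first.
  by rewrite lee_wpmul2l ?lee_fin ?exprn_ge0// leeD ?(fa eta) ?(gb eta).
have mo (h : 'rV[R]_n -> R) : measurable_fun setT h -> measurable_fun setT
    (fun p : 'rV[R]_n * 'rV[R]_n => (\1_D p.1 * \1_D p.2 *
    (kern psi (fun=> 0%N) p.1 p.2 * `|h p.2 - h p.1| ^+ m))%:E).
  by move=> mh; apply/measurable_EFinP; exact: (measurable_osc_integrand mpsi).
rewrite /osc -ge0_integralD//; last 4 first.
- by move=> p _; rewrite lee_fin (osc_integrand_ge0 mpsi).
- exact: mo.
- by move=> p _; rewrite lee_fin (osc_integrand_ge0 mpsi).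
- exact: mo.
rewrite -ge0_integralZl_EFin//; last 2 first.
- by move=> p _; rewrite adde_ge0// lee_fin (osc_integrand_ge0 mpsi).
- by apply: emeasurable_funD; exact: mo.
apply: ge0_le_integral => //.
- by move=> p _; exact: (osc_integrand_ge0 mpsi m (fun x => f x + g x) p).
- by apply: (mo (fun x => f x + g x)); exact: measurable_funD.
- by apply: measurable_funeM; apply: emeasurable_funD; exact: mo.
- move=> [x y] _ /=; rewrite -EFinD -EFinM lee_fin.
  rewrite -!mulrDr [leRHS]mulrCA ler_wpM2l ?mulr_ge0//.
  rewrite [leRHS]mulrCA ler_wpM2l ?(phi_ge0 mpsi)//.
  have := norm3_exp m (g y - g x) (f y - f x) 0.
  rewrite normr0 expr0n gtn_eqF// add0r subr0.
  by rewrite (_ : f y + g y - (f x + g x) = g y - g x + (f y - f x))//; ring.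
Qed.

Lemma vanishing_oscZ (c : R) f : measurable_fun setT f ->
  vanishing_osc m f -> vanishing_osc m (fun x => c * f x).
Proof.
move=> mf vf e e0.
have c1 : 0 < `|c| ^+ m + 1 by rewrite ltr_wpDl ?exprn_ge0.
have [a a0 fa] := vf _ (divr_gt0 e0 c1).
exists a => // eta psi ea mpsi; rewrite (osc_scale mpsi)//.
apply: (@le_trans _ _ ((`|c| ^+ m)%:E * (e / (`|c| ^+ m + 1))%:E)%E).
  by rewrite lee_wpmul2l ?lee_fin ?exprn_ge0// (fa eta).
rewrite -EFinM lee_fin mulrCA ger_pMr// ler_pdivrMr// mul1r.
by rewrite lerDl.
Qed.

Lemma vanishing_osc_approx f : measurable_fun setT f ->
  (forall e : R, 0 < e -> exists g, [/\ measurable_fun setT g, vanishing_osc m g &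
    (\int[mu]_x (\1_D x * `|f x - g x| ^+ m)%:E <= e%:E)%E]) ->
  vanishing_osc m f.
Proof.
move=> mf H e e0.
have e3 : 0 < e / 3 ^+ m / 3 by rewrite !divr_gt0// exprn_gt0.
have [g [mg vg fg]] := H _ e3.
have [a a0 ga] := vg _ e3.
exists a => // eta psi ea mpsi.
apply: (le_trans (osc_approx mpsi m mf mg)).
have -> : e = 3 ^+ m * (e / 3 ^+ m / 3 + (e / 3 ^+ m / 3 + e / 3 ^+ m / 3)).
  by field; rewrite expf_neq0.
rewrite EFinM lee_wpmul2l ?lee_fin ?exprn_ge0// !EFinD.
by rewrite leeD ?leeD// (ga eta).
Qed.

(** Dominated convergence makes g_ k close to f in L^m. *)
Lemma vanishing_osc_dominated (g_ : nat -> 'rV[R]_n -> R) f (G : 'rV[R]_n -> R) :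
  measurable_fun setT f -> (forall k, measurable_fun setT (g_ k)) ->
  (forall k, vanishing_osc m (g_ k)) ->
  (forall x, g_ k x @[k --> \oo] --> f x) ->
  (forall k x, `|f x - g_ k x| <= G x) ->
  mu.-integrable setT (fun x => (\1_D x * G x ^+ m)%:E) ->
  vanishing_osc m f.
Proof.
move=> mf mg vg gf fG intG; apply: vanishing_osc_approx => // e e0.
pose h k x := (\1_D x * `|f x - g_ k x| ^+ m)%:E.
have mh k : measurable_fun setT (h k).
  apply/measurable_EFinP; apply: measurable_funM; first exact: measurable_indic_unit_box.
  apply: measurable_funX; apply: measurableT_comp => //.
  exact: measurable_funB.
have hx x : h ^~ x @ \oo --> (cst 0%E x).
  apply: cvg_EFin; first exact: nearW.
  rewrite /comp/=.
  have : (\1_D x * `|f x - g_ k x| ^+ m) @[k --> \oo] --> \1_D x * `|f x - f x| ^+ m.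
    apply: cvgM; first exact: cvg_cst.
    apply: (@cvg_comp _ _ _ (fun k => `|f x - g_ k x|) (fun t : R => t ^+ m)
        _ (nbhs `|f x - f x|)).
      by apply: cvg_norm; apply: cvgB => //; exact: cvg_cst.
    exact: exprn_continuous.
  by rewrite subrr normr0 expr0n gtn_eqF// mulr0.
have hG : {ae mu, forall x k, setT x -> (`|h k x| <= (\1_D x * G x ^+ m)%:E)%E}.
  apply: aeW => x k _; rewrite /h /= lee_fin ger0_norm; last first.
    by rewrite mulr_ge0// exprn_ge0.
  rewrite ler_wpM2l//; apply: lerXn2r; rewrite ?nnegrE//.
  exact: le_trans (fG k x).
have [_ + _] := @dominated_convergence _ _ _ mu _ measurableT h (cst 0%E)
  (fun x => (\1_D x * G x ^+ m)%:E) mh (measurable_cst _) (aeW _ (fun x _ => hx x)) intG hG.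
move=> /fine_cvgP[fin0 /cvgrPdist_le/(_ _ e0) conv0].
near \oo => N.
exists (g_ N); split => //.
have finN : (\int[mu]_x `|h N x - cst 0%E x|)%E \is a fin_num by near: N.
have convN : `|0 - fine (\int[mu]_x `|h N x - cst 0%E x|)%E| <= e by near: N.
rewrite (_ : (\int[mu]_x _)%E = (\int[mu]_x `|h N x - cst 0%E x|)%E).
  rewrite -(fineK finN) lee_fin; apply: le_trans convN.
  by rewrite sub0r normrN ler_norm.
apply: eq_integral => x _; rewrite [cst _ _]/(0%E) sube0 gee0_abs// lee_fin.
by rewrite mulr_ge0// exprn_ge0.
Unshelve. all: by end_near. Qed.

End power.

Lemma indic_norm_exp (A : set 'rV[R]_n) (m : nat) x y : (0 < m)%N ->
  `|\1_A y - \1_A x : R| ^+ m = `|\1_A y - \1_A x|.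
Proof.
move=> m0; rewrite !indicE; case: (_ \in _); case: (_ \in _) => /=;
  rewrite ?subrr ?subr0 ?sub0r ?normrN ?normr0 ?normr1 ?expr1n ?expr0n//.
all: by rewrite gtn_eqF.
Qed.

Lemma vanishing_osc_indicX (A : set 'rV[R]_n) (m : nat) : (0 < m)%N ->
  vanishing_osc 1 \1_A -> vanishing_osc m \1_A.
Proof.
move=> m0 vA e e0; have [a a0 Aa] := vA _ e0; exists a => // eta psi ea mpsi.
apply: le_trans (Aa _ _ ea mpsi); rewrite /osc.
by under eq_integral do rewrite indic_norm_exp// -[`|_|]expr1.
Qed.

(** The integrand vanishes unless x lies in the strip of width 2 eta about the
    bounding hyperplane, and the part of the strip in the box has measure at
    most 2 ^+ n * eta. *)
Lemma vanishing_osc_halfspace (i : 'I_n) (a : R) :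
  vanishing_osc 1 \1_[set x : 'rV[R]_n | a < x ord0 i].
Proof.
move=> e e0.
pose c : R := 2 ^+ n.
have c0 : 0 < c by rewrite exprn_gt0.
exists (e / c); first by rewrite divr_gt0.
move=> eta psi ea mpsi.
have [eta0 _] := mpsi.
pose S : set 'rV[R]_n := box (fun j => if j == i then a - eta else -1)
  (fun j => if j == i then a + eta else 1).
have mS : measurable S by exact: measurable_box.
have muS : (mu S <= e%:E)%E.
  rewrite lebesgue_rV_box; last by move=> j; case: ifP => _; lra.
  rewrite lee_fin; apply: (@le_trans _ _ (\prod_(j < n) ((if j == i then eta else 1) * 2))).
    rewrite le_eqVlt; apply/orP; left; apply/eqP/eq_bigr => j _.
    by case: ifP => _; ring.
  rewrite big_split/= -/c big_const_ord iter_mulr_1 -/c.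
  rewrite (bigD1 i)//= eqxx big1 ?mulr1; last by move=> j /negbTE ->.
  by rewrite -ler_pdivlMr.
apply: (@le_trans _ _ (mu S)) => //.
have mi : measurable_fun setT (\1_S : 'rV[R]_n -> R) by exact: measurable_indic.
rewrite -[X in mu X]setIT -integral_indic//.
rewrite -(integral_phi_fst mpsi mi)//.
have mA : measurable [set x : 'rV[R]_n | a < x ord0 i].
  rewrite -[X in measurable X]setTI.
  rewrite (_ : [set x : 'rV[R]_n | a < x ord0 i] = (fun x : 'rV[R]_n => x ord0 i) @^-1` `]a, +oo[).
    exact: measurable_coord.
  by apply/seteqP; split => x /=; rewrite in_itv/= andbT.
apply: ge0_le_integral => //.
- by move=> p _; rewrite lee_fin (osc_integrand_ge0 mpsi).
- apply/measurable_EFinP; apply: (measurable_osc_integrand mpsi).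
  exact: measurable_indic.
- apply/measurable_EFinP; apply: measurable_funM; last exact: measurableT_comp.
  by apply: measurable_kern2; have [_ []] := mpsi.
- move=> [x y] _ /=; rewrite lee_fin expr1.
  have [xy|xy] := ltP eta `|y ord0 i - x ord0 i|.
    by rewrite (kern_support mpsi _ xy) !mul0r mulr0.
  rewrite mulrCA ler_wpM2l ?(phi_ge0 mpsi)//.
  have [xS|xS] := pselect (S x).
    rewrite [\1_S x]indicE mem_set// !indicE.
    by do !case: (_ \in _); rewrite /= ?(mul0r,mulr0,mul1r,subrr,subr0,sub0r,normr0,normrN,normr1,ler01).
  have [xD|xD] := pselect (D x); last by rewrite indicE memNset// !mul0r.
  have ax : (a < x ord0 i) = (a < y ord0 i).
    move: xS; rewrite /S /box /= => /existsNP[j]; case: eqP => [->|_] xj; last first.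
      by exfalso; apply: xj; exact: xD.
    move: xy; rewrite ler_distlC => /andP[xy1 xy2].
    apply/idP/idP => ax; rewrite ltNge; apply/negP => axy; apply: xj; lra.
  rewrite (_ : \1_[set x : 'rV[R]_n | a < x ord0 i] y = \1_[set x : 'rV[R]_n | a < x ord0 i] x).
    by rewrite subrr normr0 mulr0.
  by rewrite !indicE; congr ((nat_of_bool _)%:R); apply/idP/idP; rewrite !inE /= ax.
Qed.

(** The sets whose indicator has vanishing oscillation form a sigma-algebra,
    and this contains the half-spaces orthogonal to the axes, which generate
    the Borel sets. *)
Lemma vanishing_osc_indic (A : set 'rV[R]_n) : measurable A ->
  vanishing_osc 1 \1_A.
Proof.
have mi (B : set 'rV[R]_n) : measurable B -> measurable_fun setT (\1_B : 'rV[R]_n -> R).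
  by move=> mB; exact: measurable_indic.
pose good (B : set 'rV[R]_n) := measurable B /\ vanishing_osc 1 \1_B.
have good0 : good set0.
  split => // e e0; exists 1 => // eta psi _ mpsi.
  rewrite /osc; under eq_integral do rewrite !indicE !in_set0 subrr normr0 expr1 !mulr0.
  by rewrite integral0 lee_fin ltW.
have goodC B : good B -> good (~` B).
  move=> [mB vB]; split; first exact: measurableC.
  move=> e e0; have [a a0 Ba] := vB _ e0; exists a => // eta psi ea mpsi.
  apply: le_trans (Ba _ _ ea mpsi); rewrite /osc le_eqVlt; apply/orP; left; apply/eqP.
  apply: eq_integral => p _; congr (_ * (_ * (_ ^+ _)))%:E.
  rewrite !indicE !in_setC.
  by do 2 case: (_ \in _); rewrite /= ?(subrr,subr0,sub0r,normrN).
have goodU B C : good B -> good C -> good (B `|` C).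
  move=> [mB vB] [mC vC]; split; first exact: measurableU.
  have := vanishing_oscD (ltn0Sn 0) (mi _ mB) (mi _ mC) vB vC.
  move=> vBC e e0; have [a a0 Ha] := vBC _ e0.
  exists a => // eta psi ea mpsi; apply: le_trans (Ha _ _ ea mpsi).
  apply: ge0_le_integral => //.
  - by move=> p _; rewrite lee_fin (osc_integrand_ge0 mpsi).
  - apply/measurable_EFinP; apply: (measurable_osc_integrand mpsi).
    by apply: mi; exact: measurableU.
  - apply/measurable_EFinP.
    exact: (measurable_osc_integrand mpsi 1 (measurable_funD (mi _ mB) (mi _ mC))).
  - move=> [x y] _ /=; rewrite lee_fin !expr1 ler_wpM2l ?mulr_ge0//.
    rewrite ler_wpM2l ?(phi_ge0 mpsi)// !indicE !in_setU.
    do 4 case: (_ \in _); rewrite /= ?(subrr,subr0,sub0r,addr0,add0r) ?normrN ?normr0 ?normr1 ?ler01 ?ler_norm//.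
    all: try (apply: le_trans (ler_norm _); lra).
    all: try (rewrite -normrN; apply: le_trans (ler_norm _); lra).
have goodbig (F : (set 'rV[R]_n)^nat) : (forall k, good (F k)) -> good (\bigcup_k F k).
  move=> gF.
  have gU k : good (\big[setU/set0]_(i < k) F i).
    elim: k => [|k IH]; first by rewrite big_ord0.
    by rewrite big_ord_recr; exact: goodU.
  have mU : measurable (\bigcup_k F k).
    by apply: bigcup_measurable => k _; case: (gF k).
  split => //.
  apply: (@vanishing_osc_dominated 1 _ (fun k => \1_(\big[setU/set0]_(i < k) F i)) _ (cst 1)) => //.
  - by move=> k; apply: mi; case: (gU k).
  - by move=> k; case: (gU k).
  - move=> x; have [[k _ xk]|xF] := pselect ((\bigcup_k F k) x).
      rewrite [\1_(\bigcup_k F k) x]indicE mem_set//; last by exists k.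
      apply: cvg_near_cst; exists k.+1 => // l /= kl.
      rewrite indicE mem_set//.
      by rewrite -bigcup_mkord; exists k.
    rewrite [\1_(\bigcup_k F k) x]indicE memNset//.
    apply: cvg_near_cst; apply: nearW => l.
    rewrite indicE memNset// => xl; apply: xF.
    by move: xl; rewrite -bigcup_mkord => -[k _ xk]; exists k.
  - move=> k x /=; rewrite !indicE.
    by do 2 case: (_ \in _); rewrite /= ?(subrr,subr0,sub0r) ?normrN ?normr0 ?normr1 ?ler01.
  - apply: (eq_integrable _ (EFin \o \1_D)) => //.
      by move=> x _; rewrite /= expr1n mulr1.
    exact: integrable_unit_box.
move=> mA; suff [] : good A by [].
have sgood : sigma_algebra setT good.
  by split => // B gB; rewrite setTD; exact: goodC.
apply: smallest_sub mA => //.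
rewrite -bigcup_seq => B [i _ [Y mY <-]].
rewrite setTI.
suff : (@measurable _ (measurableTypeR R)) `<=` [set Y | good ((fun x : 'rV[R]_n => x ord0 i) @^-1` Y)].
  exact.
rewrite RGenOInfty.measurableE.
apply: smallest_sub.
  split => /=.
  - by rewrite preimage_set0.
  - by move=> Z gZ; rewrite setTD preimage_setC; exact: goodC.
  - by move=> Z gZ; rewrite preimage_bigcup; exact: goodbig.
move=> _ [a ->] /=.
have E : (fun x : 'rV[R]_n => x ord0 i) @^-1` `]a, +oo[ = [set x : 'rV[R]_n | a < x ord0 i].
  by apply/seteqP; split => x /=; rewrite in_itv/= andbT.
rewrite E; split; last exact: vanishing_osc_halfspace.
by rewrite -E -[X in measurable X]setTI; exact: measurable_coord.
Qed.

End vanishing_oscillation.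

Section vanishing_oscillation_Lm.
Import HBNNSimple.
Context {R : realType} {n : nat}.
Local Notation mu := (lebesgue_rV (R := R) n).
Local Notation D := (@unit_box R n).
Variable m : nat.
Hypothesis m_gt0 : (0 < m)%N.

Lemma vanishing_osc_cst (c : R) : vanishing_osc (n := n) m (cst c).
Proof.
move=> e e0; exists 1 => // eta psi _ _; rewrite /osc.
under eq_integral do rewrite subrr normr0 expr0n gtn_eqF// !mulr0.
by rewrite integral0 lee_fin ltW.
Qed.

Lemma vanishing_osc_sum k (c : 'I_k -> R) (A : 'I_k -> set 'rV[R]_n) :
  (forall i, measurable (A i)) ->
  vanishing_osc m (fun x => \sum_(i < k) c i * \1_(A i) x).
Proof.
move=> mA.
suff H (s : seq 'I_k) : measurable_fun setT (fun x : 'rV[R]_n => \sum_(i <- s) c i * \1_(A i) x) /\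
    vanishing_osc m (fun x => \sum_(i <- s) c i * \1_(A i) x).
  by have [] := H (index_enum 'I_k).
elim: s => [|i s [ms vs]].
  under eq_fun do rewrite big_nil.
  by split; [exact: measurable_cst|exact: vanishing_osc_cst].
have mi : measurable_fun setT (\1_(A i) : 'rV[R]_n -> R) by exact: measurable_indic.
have mci : measurable_fun setT (fun x : 'rV[R]_n => c i * \1_(A i) x).
  exact: measurable_funM.
under eq_fun do rewrite big_cons.
split; first exact: measurable_funD.
apply: (vanishing_oscD m_gt0) => //; apply: vanishing_oscZ => //.
by apply: vanishing_osc_indicX => //; exact: vanishing_osc_indic.
Qed.

(** Simple functions below f converge to f and are dominated by f. *)
Lemma vanishing_osc_ge0 (f : 'rV[R]_n -> R) : measurable_fun setT f ->
  (forall x, 0 <= f x) ->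
  mu.-integrable setT (fun x => (\1_D x * f x ^+ m)%:E) -> vanishing_osc m f.
Proof.
move=> mf f0 intf.
have mEf : measurable_fun setT (EFin \o f) by apply/measurable_EFinP.
pose g := nnsfun_approx measurableT mEf.
have f0' : forall x, setT x -> (0 <= (EFin \o f) x)%E by move=> x _; rewrite lee_fin.
have gf k x : g k x <= f x.
  by rewrite -lee_fin /g nnsfun_approxE; exact: le_approx.
apply: (vanishing_osc_dominated m_gt0 (g_ := g) (G := f)) => //.
- move=> k.
  have /funext E := fimfunEord (g k); rewrite E.
  apply: vanishing_osc_sum => i.
  by rewrite -[X in measurable X]setTI; exact: measurable_funP.
- move=> x; have := cvg_nnsfun_approx measurableT mEf f0' (x := x) I.
  by move=> /fine_cvgP[].
- by move=> k x; rewrite ger0_norm ?subr_ge0// gerBl fun_ge0.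
Qed.

(** The positive and negative parts of f are treated separately. *)
Lemma vanishing_osc_Lm (f : 'rV[R]_n -> R) : measurable_fun setT f ->
  mu.-integrable setT (fun x => (\1_D x * `|f x| ^+ m)%:E) -> vanishing_osc m f.
Proof.
move=> mf intf.
have H (g : 'rV[R]_n -> R) : measurable_fun setT g -> (forall x, 0 <= g x) ->
    (forall x, g x <= `|f x|) -> vanishing_osc m g.
  move=> mg g0 gf; apply: vanishing_osc_ge0 => //.
  apply: le_integrable intf => //.
    apply/measurable_EFinP; apply: measurable_funM; last exact: measurable_funX.
    exact: measurable_indic_unit_box.
  move=> x _ /=; rewrite lee_fin [X in X <= _]ger0_norm ?mulr_ge0 ?exprn_ge0//.
  rewrite [X in _ <= X]ger0_norm ?mulr_ge0 ?exprn_ge0//.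
  by rewrite ler_wpM2l//; apply: lerXn2r; rewrite ?nnegrE.
have -> : f = (fun x => Num.max (f x) 0 + (-1) * Num.max (- f x) 0).
  apply/funext => x; rewrite mulN1r.
  by case: (leP (f x) 0) => fx; case: leP => fx'; lra.
have mp : measurable_fun setT (fun x => Num.max (f x) 0).
  exact: measurable_maxr.
have mn : measurable_fun setT (fun x => Num.max (- f x) 0).
  by apply: measurable_maxr => //; exact: measurableT_comp.
apply: (vanishing_oscD m_gt0) => //; first exact: measurable_funM.
- apply: H => // x; first by rewrite le_max lexx orbT.
  by rewrite ge_max ler_norm normr_ge0.
- apply: vanishing_oscZ => //.
  apply: H => // x; first by rewrite le_max lexx orbT.
  by rewrite ge_max normr_ge0 -normrN ler_norm.
Qed.

End vanishing_oscillation_Lm.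

(** * Balls inside the unit ball *)

Lemma integrable_EFinD d (T : measurableType d) (R : realType)
    (mu : {measure set T -> \bar R}) (f g : T -> R) :
  mu.-integrable setT (EFin \o f) -> mu.-integrable setT (EFin \o g) ->
  mu.-integrable setT (EFin \o (fun x => f x + g x)).
Proof.
move=> intf intg; have := integrableD measurableT intf intg.
by apply: eq_integrable.
Qed.

Lemma integrable_EFinB d (T : measurableType d) (R : realType)
    (mu : {measure set T -> \bar R}) (f g : T -> R) :
  mu.-integrable setT (EFin \o f) -> mu.-integrable setT (EFin \o g) ->
  mu.-integrable setT (EFin \o (fun x => f x - g x)).
Proof.
move=> intf intg; have := integrableB measurableT intf intg.
by apply: eq_integrable.
Qed.

Lemma continuous_bigsum (R : realType) (T : topologicalType) (I : Type) (s : seq I)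
    (f : I -> T -> R) :
  (forall i, continuous (f i)) -> continuous (fun x => \sum_(i <- s) f i x).
Proof.
move=> cf; elim: s => [|i s IH].
  by under eq_fun do rewrite big_nil; exact: cst_continuous.
under eq_fun do rewrite big_cons.
by move=> x; apply: cvgD; [exact: cf|exact: IH].
Qed.

Section smaller_balls.
Context {R : realType} {n : nat}.
Implicit Types x y : 'rV[R]_n.

(** Closed Euclidean balls, indexed by the square of the radius so that no
    square root occurs. *)
Definition sq_ball (rho : R) : set 'rV[R]_n := [set x | \sum_(i < n) x ord0 i ^+ 2 <= rho].

Lemma continuous_sq_norm : continuous (fun x : 'rV[R]_n => \sum_(i < n) x ord0 i ^+ 2 : R).
Proof.
refine (@continuous_bigsum R 'rV[R]_n 'I_n (index_enum 'I_n)
  (fun i (z : 'rV[R]_n) => z ord0 i ^+ 2) _) => i x.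
apply: (@continuous_comp _ _ _ (fun z : 'rV[R]_n => z ord0 i) (fun t : R => t ^+ 2)).
  exact: (@coord_continuous R 1 n ord0 i).
exact: exprn_continuous.
Qed.

Lemma sq_ball_coord (rho : R) x i : rho <= 1 -> sq_ball rho x -> `|x ord0 i| <= 1.
Proof.
move=> rho1 xrho; rewrite -(@ler_pXn2r _ 2)// ?nnegrE// expr1n real_normK ?num_real//.
apply: (le_trans _ (le_trans xrho rho1)).
by rewrite (bigD1 i)//= lerDl sumr_ge0// => j _; rewrite sqr_ge0.
Qed.

Lemma sq_ball_unit_box (rho : R) : rho <= 1 -> sq_ball rho `<=` @unit_box R n.
Proof. by move=> rho1 x xrho i; rewrite -ler_norml; exact: sq_ball_coord xrho. Qed.

Lemma sub_sq_ball (rho rho' : R) : rho <= rho' -> sq_ball rho `<=` sq_ball rho'.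
Proof. by move=> rr x /le_trans; exact. Qed.

Lemma sq_ball_unit_ball (rho : R) : rho < 1 -> sq_ball rho `<=` @unit_ball R n.
Proof. by move=> rho1 x /le_lt_trans; exact. Qed.

(** The coordinates are at most 1 in absolute value, so changing one of them
    by eta changes its square by at most 2 eta + eta ^+ 2 <= 3 eta. *)
Lemma sq_ball_near (rho eta : R) x y : rho <= 1 -> eta <= 1 ->
  sq_ball rho x -> (forall i, `|y ord0 i - x ord0 i| <= eta) ->
  sq_ball (rho + (3 * n)%:R * eta) y.
Proof.
move=> rho1 eta1 xrho yx.
have H i : y ord0 i ^+ 2 <= x ord0 i ^+ 2 + 3 * eta.
  have := yx i; have := sq_ball_coord i rho1 xrho.
  rewrite !ler_norml => /andP[x1 x2] /andP[d1 d2].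
  have -> : y ord0 i = x ord0 i + (y ord0 i - x ord0 i) by ring.
  by set d := y ord0 i - x ord0 i in d1 d2 *; nra.
apply: (@le_trans _ _ (\sum_(i < n) (x ord0 i ^+ 2 + 3 * eta))).
  exact: ler_sum.
rewrite big_split/= lerD// sumr_const card_ord -[leLHS]mulr_natr natrM.
by rewrite mulrAC.
Qed.

Lemma measurable_sq_ball (rho : R) : measurable (sq_ball rho).
Proof.
have m : measurable_fun setT (fun x : 'rV[R]_n => \sum_(i < n) x ord0 i ^+ 2).
  by apply: measurable_sum => i; apply: measurable_funX; exact: measurable_coord.
rewrite -[X in measurable X]setTI.
rewrite (_ : sq_ball rho = (fun x : 'rV[R]_n => \sum_(i < n) x ord0 i ^+ 2) @^-1` `]-oo, rho]).
  exact: m.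
by apply/seteqP; split => x; rewrite /= in_itv.
Qed.

Lemma compact_sq_ball (rho : R) : rho <= 1 -> compact (sq_ball rho).
Proof.
move=> rho1.
have cB : compact [set v : 'rV[R]_n | forall i, `[(-1 : R), 1]%classic (v ord0 i)].
  apply: (@rV_compact _ _ (fun i => `[(-1 : R), 1]%classic)) => i.
  exact: segment_compact.
apply: (subclosed_compact _ cB); last first.
  by move=> x xrho i /=; rewrite in_itv/= -ler_norml; exact: sq_ball_coord xrho.
rewrite (_ : sq_ball rho = (fun x : 'rV[R]_n => \sum_(i < n) x ord0 i ^+ 2) @^-1` [set t | t <= rho])//.
apply: closed_comp; last exact: closed_le.
by move=> x _; exact: continuous_sq_norm.
Qed.

End smaller_balls.

(** * Distance of a function to its mollification *)

Section jensen.
Context {R : realType} {n : nat}.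
Local Notation mu := (lebesgue_rV (R := R) n).
Local Notation D := (@unit_box R n).
Variables (eta : R) (psi : nat -> R -> R).
Hypothesis mpsi : mollifier eta psi.
Local Notation phi := (kern psi (fun=> 0%N)).
Implicit Types (f : 'rV[R]_n -> R) (x y : 'rV[R]_n).

Definition local_osc m f x : \bar R :=
  (\int[mu]_y (\1_D y * (phi x y * `|f y - f x| ^+ m))%:E)%E.

(** Convexity of the m-th power, in the form used for Jensen's inequality. *)
Lemma tangent_pow (m : nat) (s t : R) : 0 <= s -> 0 <= t ->
  s ^+ m + m%:R * s ^+ m.-1 * (t - s) <= t ^+ m.
Proof.
move=> s0 t0; elim: m => [|m IH]; first by rewrite !mul0r addr0.
have IH' := ler_wpM2l t0 IH; rewrite -exprS in IH'.
apply: le_trans IH'.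
case: m {IH} => [|m]; first by rewrite !expr0 mul0r mul0r !expr1 addr0 mulr1; lra.
rewrite /= !exprS !mulrSr.
have sm : 0 <= s ^+ m by exact: exprn_ge0.
have m0 : 0 <= m%:R :> R by [].
have H : 0 <= (m%:R + 1) * s ^+ m * (t - s) ^+ 2 by rewrite mulr_ge0 ?sqr_ge0// mulr_ge0// addr_ge0.
by rewrite -subr_ge0; apply: le_trans H _; rewrite le_eqVlt; apply/orP; left; apply/eqP; ring.
Qed.

Let intphi x : mu.-integrable setT (EFin \o phi x).
Proof.
apply/integrableP; split.
  by apply/measurable_EFinP; apply: measurable_kern; have [_ []] := mpsi.
under eq_integral do rewrite /= ger0_norm ?(phi_ge0 mpsi)//.
by rewrite (integral_phi mpsi) ltry.
Qed.

Lemma Rintegral_phi x : \int[mu]_y phi x y = 1.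
Proof. by rewrite /Rintegral (integral_phi mpsi). Qed.

(** Jensen's inequality for the probability density phi x. The tangent to t ^+
    m at the mean s of |f y - f x| is integrated against phi x; this avoids
    any general theory of convex functions. *)
Lemma moll_sub_le f x (m : nat) : measurable_fun setT f ->
  mu.-integrable setT (EFin \o f) ->
  (forall y, (forall i, `|y ord0 i - x ord0 i| <= eta) -> D y) ->
  ((`|moll psi f (fun=> 0%N) x - f x| ^+ m)%:E <= local_osc m f x)%E.
Proof.
move=> mf intf xD.
have mphi : measurable_fun setT (phi x).
  by apply: measurable_kern; have [_ []] := mpsi.
have intd : mu.-integrable setT (EFin \o (fun y => (f y - f x) * phi x y)).
  under eq_fun do rewrite mulrBl.
  apply: integrable_EFinB; first exact: (integrable_mul_kern mpsi).
  by apply: integrable_EFinZ; exact: intphi.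
have E : moll psi f (fun=> 0%N) x - f x = \int[mu]_y ((f y - f x) * phi x y).
  under eq_Rintegral do rewrite mulrBl.
  rewrite RintegralB//; last 2 first.
  - exact: (integrable_mul_kern mpsi).
  - exact: integrable_EFinZ.
  by rewrite RintegralZl// ?Rintegral_phi ?mulr1//; exact: intphi.
pose s := \int[mu]_y (`|f y - f x| * phi x y).
have ints : mu.-integrable setT (EFin \o (fun y => `|f y - f x| * phi x y)).
  apply: (eq_integrable _ (EFin \o (fun y => `|(f y - f x) * phi x y|))) => //.
    by move=> y _; rewrite /= normrM [X in _ * X]ger0_norm// (phi_ge0 mpsi).
  exact: integrable_norm.
have s0 : 0 <= s.
  by apply: Rintegral_ge0 => y _; rewrite mulr_ge0// (phi_ge0 mpsi).
have Es : `|moll psi f (fun=> 0%N) x - f x| <= s.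
  rewrite E (le_trans (le_normr_Rintegral _ intd))// /s.
  by under eq_Rintegral do rewrite normrM [X in _ * X]ger0_norm ?(phi_ge0 mpsi)//.
apply: (@le_trans _ _ (s ^+ m)%:E).
  by rewrite lee_fin; apply: lerXn2r; rewrite ?nnegrE.
have DE y : \1_D y * (phi x y * `|f y - f x| ^+ m) = `|f y - f x| ^+ m * phi x y.
  have [yx|] := pselect (forall i, `|y ord0 i - x ord0 i| <= eta).
    by rewrite indicE mem_set ?mul1r 1?mulrC//; exact: xD.
  move=> /existsNP[i /negP]; rewrite -ltNge => yx.
  by rewrite (kern_support mpsi _ yx) mul0r !mulr0.
have [fin|] := ltP (local_osc m f x) +oo%E; last first.
  by rewrite leye_eq => /eqP ->; rewrite leey.
have intm : mu.-integrable setT (EFin \o (fun y => `|f y - f x| ^+ m * phi x y)).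
  apply/integrableP; split.
    apply/measurable_EFinP; apply: measurable_funM => //.
    apply: measurable_funX; apply: measurableT_comp => //.
    exact: measurable_funB.
  apply: le_lt_trans fin; rewrite le_eqVlt; apply/orP; left; apply/eqP.
  apply: eq_integral => y _; rewrite /= DE ger0_norm//.
  by rewrite mulr_ge0 ?exprn_ge0// (phi_ge0 mpsi).
(* The tangent s ^+ m + c * (t - s) has mean s ^+ m, since s is the mean of t
   = |f y - f x|. *)
pose c := m%:R * s ^+ m.-1.
have intt : mu.-integrable setT
    (EFin \o (fun y => (s ^+ m - c * s) * phi x y + c * (`|f y - f x| * phi x y))).
  by apply: integrable_EFinD; apply: integrable_EFinZ => //; exact: intphi.
have <- : \int[mu]_y ((s ^+ m - c * s) * phi x y + c * (`|f y - f x| * phi x y)) = s ^+ m.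
  rewrite RintegralD//; last 2 first.
  - exact: integrable_EFinZ.
  - exact: integrable_EFinZ.
  rewrite (RintegralZl _ measurableT (intphi x)) (RintegralZl _ measurableT ints).
  by rewrite Rintegral_phi -/s; ring.
rewrite /local_osc; under eq_integral do rewrite DE.
rewrite /Rintegral fineK; last first.
  exact: integrable_fin_num.
apply: le_integral => // y _; rewrite lee_fin.
rewrite mulrA -mulrDl ler_wpM2r ?(phi_ge0 mpsi)//.
have := tangent_pow m s0 (normr_ge0 (f y - f x)).
by rewrite -/c; lra.
Qed.

Lemma measurable_local_osc m f : measurable_fun setT f ->
  measurable_fun setT (local_osc m f).
Proof.
move=> mf; apply: (@measurable_fun_fubini_tonelli_F _ _ _ _ _ mu
  (fun p : 'rV[R]_n * 'rV[R]_n => (\1_D p.2 * (phi p.1 p.2 * `|f p.2 - f p.1| ^+ m))%:E)).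
- apply/measurable_EFinP; apply: measurable_funM.
    by apply: measurableT_comp => //; exact: measurable_indic_unit_box.
  apply: measurable_funM; first by apply: measurable_kern2; have [_ []] := mpsi.
  apply: measurable_funX; apply: measurableT_comp => //.
  by apply: measurable_funB; exact: measurableT_comp.
- by move=> p; rewrite lee_fin !mulr_ge0 ?exprn_ge0// (phi_ge0 mpsi).
Qed.

Lemma local_osc_ge0 m f x : (0 <= local_osc m f x)%E.
Proof.
apply: integral_ge0 => y _.
by rewrite lee_fin !mulr_ge0 ?exprn_ge0// (phi_ge0 mpsi).
Qed.

Lemma integral_local_osc m f : measurable_fun setT f ->
  (\int[mu]_(x in D) local_osc m f x = osc psi m f)%E.
Proof.
move=> mf; rewrite integral_mkcond /osc fubini_tonelli1; last 2 first.
- by apply/measurable_EFinP; exact: (measurable_osc_integrand mpsi).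
- by move=> p; rewrite lee_fin (osc_integrand_ge0 mpsi).
apply: eq_integral => x _; rewrite patchE /fubini_F/=.
case: ifPn => xD.
  by apply: eq_integral => y _; rewrite [\1_D x]indicE xD mul1r.
by under eq_integral do rewrite [\1_D x]indicE (negbTE xD) !mul0r; rewrite integral0.
Qed.

End jensen.

(** * Weak derivatives *)

Section local_functions.
Context {R : realType} {n : nat}.
Local Notation mu := (lebesgue_rV (R := R) n).
Local Notation D := (@unit_box R n).
Local Notation B1 := (@unit_ball R n).
Implicit Types (f u v : 'rV[R]_n -> R) (x y : 'rV[R]_n) (rho p : R).

Lemma Lp_loc_restrict p rho f : 1 <= p -> rho < 1 -> Lp_loc p B1 f ->
  f \_ (sq_ball rho) \in Lfun mu p%:E.
Proof.
move=> p1 rho1; apply; first by apply: compact_sq_ball; exact: ltW.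
exact: sq_ball_unit_ball.
Qed.

Lemma measurable_restrict_ball p rho f : 1 <= p -> rho < 1 -> Lp_loc p B1 f ->
  measurable_fun setT (f \_ (sq_ball rho)).
Proof.
move=> p1 rho1 /(Lp_loc_restrict p1 rho1) /sub_Lfun_mfun.
by rewrite inE.
Qed.

Lemma restrict_unit_box rho f x : rho < 1 ->
  \1_D x * (f \_ (sq_ball rho)) x = (f \_ (sq_ball rho)) x.
Proof.
move=> rho1; rewrite patchE; case: ifPn => [|_]; last by rewrite mulr0.
rewrite inE => xrho; rewrite indicE mem_set ?mul1r//.
exact: sq_ball_unit_box (ltW rho1) _ xrho.
Qed.

(** Here t ^+ m <= 1 + t `^ p, and the box has finite measure. *)
Lemma integrable_restrict_exp p rho f (m : nat) : (0 < m)%N -> m%:R <= p -> rho < 1 ->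
  Lp_loc p B1 f ->
  mu.-integrable setT (fun x => (\1_D x * `|(f \_ (sq_ball rho)) x| ^+ m)%:E).
Proof.
move=> m0 mp rho1 fp.
have p1 : 1 <= p by apply: le_trans mp; rewrite ler1n.
have mf := measurable_restrict_ball p1 rho1 fp.
have := Lfun_integrable p1 (Lp_loc_restrict p1 rho1 fp) => intp.
have := integrable_EFinD (@integrable_unit_box R n) intp.
apply: le_integrable => //.
  apply/measurable_EFinP; apply: measurable_funM; first exact: measurable_indic_unit_box.
  by apply: measurable_funX; exact: measurableT_comp.
move=> x _ /=; set t := `|(f \_ (sq_ball rho)) x|.
have t0 : 0 <= t by exact: normr_ge0.
rewrite lee_fin [X in X <= _]ger0_norm ?mulr_ge0 ?exprn_ge0//.
rewrite [X in _ <= X]ger0_norm ?addr_ge0 ?powR_ge0//.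
have [t1|t1] := leP t 1.
  apply: (@le_trans _ _ (\1_D x)); last by rewrite lerDl powR_ge0.
  by rewrite ler_piMr// exprn_ile1.
apply: (@le_trans _ _ (t `^ p)); last by rewrite lerDr.
apply: (@le_trans _ _ (t ^+ m)).
  by rewrite ler_piMl ?exprn_ge0.
rewrite -powR_mulrn//; apply: ler_powR => //; exact: ltW.
Qed.

Lemma integrable_restrict p rho f : 1 <= p -> rho < 1 -> Lp_loc p B1 f ->
  mu.-integrable setT (EFin \o (f \_ (sq_ball rho))).
Proof.
move=> p1 rho1 fp.
have := integrable_restrict_exp (ltn0Sn 0) p1 rho1 fp.
apply: le_integrable => //.
  by apply/measurable_EFinP; exact: measurable_restrict_ball fp.
move=> x _ /=; rewrite lee_fin -{1}(restrict_unit_box f x rho1) normrM ger0_norm// expr1.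
exact: ler_norm.
Qed.

Section fixed_mollifier.
Variables (eta : R) (psi : nat -> R -> R).
Hypothesis mpsi : mollifier eta psi.
Local Notation phi := (kern psi (fun=> 0%N)).

(** The kernel vanishes outside the smaller ball, so extending f by zero there
    changes nothing. *)
Lemma integral_ball_kern rho f al x : rho < 1 ->
  (forall y, (forall i, `|y ord0 i - x ord0 i| <= eta) -> sq_ball rho y) ->
  \int[mu]_(y in B1) (f y * kern psi al x y) = moll psi (f \_ (sq_ball rho)) al x.
Proof.
move=> rho1 xrho; rewrite Rintegral_mkcond; apply: eq_Rintegral => y _.
rewrite !patchE.
have [yx|] := pselect (forall i, `|y ord0 i - x ord0 i| <= eta).
  have yrho := xrho _ yx.
  by rewrite !mem_set//; exact: (sq_ball_unit_ball rho1).
move=> /existsNP[i /negP]; rewrite -ltNge => yx.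
rewrite (kern_support mpsi _ yx) !mulr0.
by case: ifP.
Qed.

(** The kernel centred at x is a test function, and its partial derivatives
    are the kernels with other multi-indices. *)
Lemma moll_weak_derivative rho s u v x : rho < 1 ->
  (forall y, (forall i, `|y ord0 i - x ord0 i| <= eta) -> sq_ball rho y) ->
  weak_derivative B1 s u v ->
  moll psi (u \_ (sq_ball rho)) (fun i => count_mem i s) x =
  (-1) ^+ size s * moll psi (v \_ (sq_ball rho)) (fun=> 0%N) x.
Proof.
move=> rho1 xrho [_ /(_ (phi x))].
rewrite (partials_kern _ s x); last by have [_ []] := mpsi.
rewrite !(integral_ball_kern _ _ rho1 xrho); apply.
apply: (test_function_phi mpsi) => y yx.
by apply: (sq_ball_unit_ball rho1); exact: xrho.
Qed.

End fixed_mollifier.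

(** Going from rho to rho' leaves room to mollify at every scale up to eta0.
    *)
Lemma near_sq_ball rho rho' : rho < rho' -> rho <= 1 ->
  exists2 eta0 : R, 0 < eta0 & forall eta x y, eta <= eta0 -> sq_ball rho x ->
    (forall i, `|y ord0 i - x ord0 i| <= eta) -> sq_ball rho' y.
Proof.
move=> rr rho1; pose c : R := (3 * n)%:R + 1.
have c0 : 0 < c by rewrite ltr_wpDl.
exists (Num.min 1 ((rho' - rho) / c)).
  by rewrite lt_min ltr01 divr_gt0// subr_gt0.
move=> eta x y; rewrite le_min => /andP[eta1 eta2] xrho yx.
have := sq_ball_near rho1 eta1 xrho yx; apply: sub_sq_ball.
have [eta0|eta0] := leP 0 eta.
  have : eta * c <= rho' - rho by rewrite -ler_pdivlMr.
  by rewrite /c; nra.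
rewrite (@le_trans _ _ rho)//; last exact: ltW.
by rewrite gerDl mulr_ge0_le0// ltW.
Qed.

(** The two derivatives have the same mollifications, and each is close to its
    mollification in L^1 when the scale is small. *)
Lemma weak_derivative_unique_ball p q rho s u v w : 1 <= p -> 1 <= q -> 0 <= rho -> rho < 1 ->
  Lp_loc p B1 v -> Lp_loc q B1 w ->
  weak_derivative B1 s u v -> weak_derivative B1 s u w ->
  {ae mu, forall x, sq_ball rho x -> v x = w x}.
Proof.
move=> p1 q1 rho0 rho1 vp wq uv uw.
pose rho' := (rho + 1) / 2.
have rr : rho < rho' by rewrite /rho'; lra.
have rho'1 : rho' < 1 by rewrite /rho'; lra.
have [eta0 eta0_gt0 near0] := near_sq_ball rr (ltW rho1).
pose v' := v \_ (sq_ball rho'); pose w' := w \_ (sq_ball rho').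
have mv := measurable_restrict_ball p1 rho'1 vp; rewrite -/v' in mv.
have mw := measurable_restrict_ball q1 rho'1 wq; rewrite -/w' in mw.
have osv : vanishing_osc 1 v'.
  by apply: vanishing_osc_Lm => //; exact: integrable_restrict_exp vp.
have osw : vanishing_osc 1 w'.
  by apply: vanishing_osc_Lm => //; exact: integrable_restrict_exp wq.
pose K := @sq_ball R n rho.
have mK : measurable K by exact: measurable_sq_ball.
have KD : K `<=` D by apply: sq_ball_unit_box; exact: ltW.
have small e : 0 < e -> (\int[mu]_(x in K) `|(v' x - w' x)%:E| <= e%:E)%E.
  move=> e0; have e2 : 0 < e / 2 by exact: divr_gt0.
  have [a a0 va] := osv _ e2; have [b b0 wb] := osw _ e2.
  pose eta := Num.min eta0 (Num.min a b).
  have eta_gt0 : 0 < eta by rewrite !lt_min eta0_gt0 a0.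
  have [psi mpsi] := mollifier_exists eta_gt0.
  have etaE : [/\ eta <= eta0, eta <= a & eta <= b].
    by rewrite !ge_min !lexx !orbT; split.
  have [etaeta0 etaa etab] := etaE.
  have xnear x y : K x -> (forall i, `|y ord0 i - x ord0 i| <= eta) -> sq_ball rho' y.
    exact: near0.
  apply: (@le_trans _ _ (\int[mu]_(x in D) (local_osc psi 1 v' x + local_osc psi 1 w' x))%E); last first.
    rewrite ge0_integralD//; last 5 first.
    - exact: measurable_unit_box.
    - by move=> x _; exact: (local_osc_ge0 mpsi).
    - by apply: measurable_funTS; exact: (measurable_local_osc mpsi).
    - by move=> x _; exact: (local_osc_ge0 mpsi).
    - by apply: measurable_funTS; exact: (measurable_local_osc mpsi).
    rewrite !(integral_local_osc mpsi)// [leRHS](_ : _ = (e / 2)%:E + (e / 2)%:E)%E.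
      by rewrite leeD ?(va eta)// (wb eta).
    by rewrite -EFinD -splitr.
  have mlo : measurable_fun setT (fun x => (local_osc psi 1 v' x + local_osc psi 1 w' x)%E).
    by apply: emeasurable_funD; exact: (measurable_local_osc mpsi).
  have md : measurable_fun setT (fun x => `|(v' x - w' x)%:E|%E).
    by apply: measurableT_comp => //; apply/measurable_EFinP; exact: measurable_funB.
  apply: (@le_trans _ _ (\int[mu]_(x in K) (local_osc psi 1 v' x + local_osc psi 1 w' x))%E); last first.
    apply: ge0_subset_integral => //; first exact: measurable_unit_box.
    - exact: measurable_funTS.
    - by move=> x _; rewrite adde_ge0// (local_osc_ge0 mpsi).
  apply: ge0_le_integral => //.
  - exact: measurable_funTS.
  - exact: measurable_funTS.
  - move=> x Kx.
    have xD y : (forall i, `|y ord0 i - x ord0 i| <= eta) -> D y.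
      by move=> yx; apply: (sq_ball_unit_box (ltW rho'1)); exact: xnear Kx yx.
    have Jv := moll_sub_le mpsi 1 mv (integrable_restrict p1 rho'1 vp) xD.
    have Jw := moll_sub_le mpsi 1 mw (integrable_restrict q1 rho'1 wq) xD.
    have Mv := moll_weak_derivative mpsi rho'1 (fun y => xnear x y Kx) uv.
    have Mw := moll_weak_derivative mpsi rho'1 (fun y => xnear x y Kx) uw.
    have E : moll psi v' (fun=> 0%N) x = moll psi w' (fun=> 0%N) x.
      by apply: (@mulfI _ ((-1) ^+ size s)); [rewrite signr_eq0|rewrite -Mv -Mw].
    apply: le_trans (leeD Jv Jw); rewrite -EFinD lee_fin !expr1 -E -/v' -/w'.
    rewrite (_ : v' x - w' x = (moll psi v' (fun=> 0%N) x - w' x) - (moll psi v' (fun=> 0%N) x - v' x)); last by ring.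
    by rewrite [leRHS]addrC; exact: ler_normB.
have int0 : (\int[mu]_(x in K) `|(v' x - w' x)%:E| = 0)%E.
  apply/eqP; rewrite eq_le integral_ge0// andbT.
  by apply/lee_addgt0Pr => e e0; rewrite add0e; exact: small.
have md : measurable_fun K (fun x => (v' x - w' x)%:E).
  by apply: measurable_funTS; apply/measurable_EFinP; exact: measurable_funB.
have := (ae_eq_integral_abs mu mK md).1 int0.
apply: filterS => x + Kx => /(_ Kx) /=.
have xrho' : x \in sq_ball rho' by rewrite inE; exact: sub_sq_ball (ltW rr) _ Kx.
by rewrite /v' /w' !patchE xrho' => -[/eqP]; rewrite subr_eq0 => /eqP.
Qed.

Lemma weak_derivative_unique p q s u v w : 1 <= p -> 1 <= q ->
  Lp_loc p B1 v -> Lp_loc q B1 w ->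
  weak_derivative B1 s u v -> weak_derivative B1 s u w ->
  {ae mu, forall x, B1 x -> v x = w x}.
Proof.
move=> p1 q1 vp wq uv uw.
have k1 k : 1 - k.+1%:R^-1 < 1 :> R by rewrite gtrBl invr_gt0.
have k0 k : 0 <= 1 - k.+1%:R^-1 :> R by rewrite subr_ge0 invf_le1 ?ler1n.
have H := fun k => weak_derivative_unique_ball p1 q1 (k0 k) (k1 k) vp wq uv uw.
have := (ae_foralln H).
apply: filterS => x Hx B1x.
pose e : R := 1 - \sum_(i < n) x ord0 i ^+ 2.
have e0 : 0 < e by rewrite subr_gt0.
have [k ke] := ltr_add_invr e0.
apply: (Hx k); rewrite /sq_ball /=; rewrite lerBrDr -lerBrDl.
by move: ke; rewrite add0r => /ltW.
Qed.

End local_functions.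

(** * Matrix inequalities *)

Section quadratic_forms.
Context {R : realFieldType} {n : nat}.
Implicit Types (M B : 'I_n -> 'I_n -> R) (xi zeta : 'I_n -> R).

Definition bform M xi zeta : R := \sum_i \sum_j xi i * M i j * zeta j.

Definition psd M : Prop :=
  (forall i j, M i j = M j i) /\ forall xi, 0 <= bform M xi xi.

Definition delta (i : 'I_n) : 'I_n -> R := fun j => (j == i)%:R.

Lemma bform_shift M xi i t : (forall i j, M i j = M j i) ->
  bform M (fun j => xi j + t * delta i j) (fun j => xi j + t * delta i j) =
  bform M xi xi + 2 * t * (\sum_j M i j * xi j) + t ^+ 2 * M i i.
Proof.
move=> sM; rewrite /bform.
have dl (F : 'I_n -> R) : \sum_j delta i j * F j = F i.
  rewrite (bigD1 i)//= /delta eqxx mul1r big1 ?addr0// => j /negbTE ->.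
  by rewrite mul0r.
under eq_bigr => k _.
  rewrite (eq_bigr (fun j => xi k * M k j * xi j + t * (delta i k * (M k j * xi j))
      + (t * (delta i j * (xi k * M k j))
      + t ^+ 2 * (delta i k * (delta i j * M k j))))); last by move=> j _; ring.
  rewrite !big_split/= -!mulr_sumr !dl.
  over.
rewrite !big_split/= -!mulr_sumr !dl -!addrA; congr (_ + _).
rewrite addrA; congr (_ + _).
rewrite [X in _ + t * X](eq_bigr (fun k => M i k * xi k)); last first.
  by move=> k _; rewrite sM mulrC.
by ring.
Qed.

Lemma bform0 M : bform M (fun=> 0) (fun=> 0) = 0.
Proof. by rewrite /bform big1// => i _; rewrite big1// => j _; rewrite mulr0. Qed.

Lemma bform_delta2 M i j s t : (forall i j, M i j = M j i) ->
  bform M (fun k => s * delta i k + t * delta j k)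
    (fun k => s * delta i k + t * delta j k) =
  s ^+ 2 * M i i + 2 * s * t * M i j + t ^+ 2 * M j j.
Proof.
move=> sM; rewrite bform_shift//.
have := bform_shift (fun=> 0) i s sM.
rewrite bform0 !add0r [X in 2 * s * X]big1 ?mulr0 ?add0r; last by move=> k _; rewrite mulr0.
rewrite (_ : (fun k => 0 + s * delta i k) = (fun k => s * delta i k)); last first.
  by apply/funext => k; rewrite add0r.
move=> ->; congr (_ + _ + _).
rewrite (bigD1 i)//= big1 ?addr0; last first.
  by move=> k /negbTE ki; rewrite /delta ki !mulr0.
by rewrite /delta eqxx mulr1 sM; ring.
Qed.

Lemma psd_diag M i : psd M -> 0 <= M i i.
Proof.
move=> [sM pM]; have := pM (fun k => 1 * delta i k + 0 * delta i k).
by rewrite bform_delta2// expr1n expr0n/= !mulr0 !mul0r !addr0 mul1r.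
Qed.

Lemma psd_entry M i j : psd M -> `|M i j| <= (M i i + M j j) / 2.
Proof.
move=> [sM pM].
have h1 := pM (fun k => 1 * delta i k + 1 * delta j k).
have h2 := pM (fun k => 1 * delta i k + (-1) * delta j k).
rewrite bform_delta2// in h1; rewrite bform_delta2// in h2.
by rewrite ler_norml; apply/andP; split; nra.
Qed.

Lemma psd_entry_trace M i j : psd M -> `|M i j| <= \sum_k M k k.
Proof.
move=> pM.
have D k : M k k <= \sum_k M k k.
  by rewrite (bigD1 k)//= lerDl sumr_ge0// => l _; exact: psd_diag.
have := psd_entry i j pM; have := D i; have := D j; lra.
Qed.

(** Otherwise the form takes negative values on s e_i + e_j for suitable s,
    being affine in s. *)
Lemma psd_diag0 M i j : psd M -> M i i = 0 -> M i j = 0.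
Proof.
move=> [sM pM] Mii; apply/eqP; apply: contraT => Mij.
have Mjj : 0 <= M j j by exact: psd_diag.
have := pM (fun k => (- (M j j + 1) / (2 * M i j)) * delta i k + 1 * delta j k).
rewrite bform_delta2// Mii mulr0 add0r.
rewrite (_ : 2 * _ * 1 * _ = - (M j j + 1)); last by field.
by rewrite expr1n; lra.
Qed.

(** One step of symmetric Gaussian elimination; the new form at xi is the old
    one at the vector that minimises it along the i-th axis. *)
Lemma psd_elim M i : psd M -> M i i != 0 ->
  psd (fun j k => M j k - M j i * M i k / M i i).
Proof.
move=> [sM pM] Mii; split=> [j k|xi].
  by rewrite (sM j k) (sM j i) (sM i k) [M i j * _]mulrC.
pose r := \sum_j M i j * xi j.
have := pM (fun j => xi j + (- r / M i i) * delta i j).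
rewrite bform_shift// -/r.
suff -> : bform (fun j k => M j k - M j i * M i k / M i i) xi xi =
    bform M xi xi - r ^+ 2 / M i i.
  by congr (_ <= _); field.
rewrite /bform.
under eq_bigr => j _.
  rewrite (eq_bigr (fun k => xi j * M j k * xi k - (M i j * xi j) * ((M i k * xi k) / M i i))); last first.
    by move=> k _; rewrite (sM j i); ring.
  rewrite sumrB -mulr_sumr -mulr_suml -/r.
  over.
by rewrite sumrB -mulr_suml -/r expr2 mulrA.
Qed.

(** Elimination decomposes M into rank-one matrices, and each of them
    contributes a value of the quadratic form of B. The induction runs over a
    list of indices outside which M is already zero. *)
Lemma psd_trace_ge0 B M : psd B -> psd M -> 0 <= \sum_i \sum_j B i j * M i j.
Proof.
move=> pB.
suff H (s : seq 'I_n) M' : psd M' -> (forall i j, i \notin s -> M' i j = 0) ->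
    0 <= \sum_i \sum_j B i j * M' i j.
  by move=> pM; apply: (H (index_enum 'I_n)) => // i j; rewrite mem_index_enum.
elim: s M' => [|i s IH] M' pM Ms.
  by rewrite big1// => i _; rewrite big1// => j _; rewrite Ms ?mulr0.
have [Mii|Mii] := eqVneq (M' i i) 0.
  apply: IH => // k j ks; have [->|ki] := eqVneq k i; first exact: psd_diag0.
  by apply: Ms; rewrite inE negb_or ki.
have Mi0 : 0 < M' i i by rewrite lt_neqAle eq_sym Mii psd_diag.
have [sM _] := pM.
have := IH _ (psd_elim pM Mii).
have -> : \sum_j \sum_k B j k * (M' j k - M' j i * M' i k / M' i i) =
    \sum_j \sum_k B j k * M' j k - bform B (M' i) (M' i) / M' i i.
  rewrite /bform mulr_suml -sumrB; apply: eq_bigr => j _.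
  rewrite mulr_suml -sumrB; apply: eq_bigr => k _.
  by rewrite (sM j i); ring.
have : 0 <= bform B (M' i) (M' i) / M' i i.
  by apply: divr_ge0; [case: pB|exact: ltW].
move=> h1 h2; have := h2 _; rewrite subr_ge0 => h3; apply: le_trans h1 (h3 _).
move=> k j ks; have [->|ki] := eqVneq k i.
  by rewrite mulrC mulrA mulVf// mul1r subrr.
have kis : k \notin i :: s by rewrite inE negb_or ki.
by rewrite (Ms k j kis) (Ms k i kis) !mul0r subrr.
Qed.

Lemma bform_scalar (c : R) xi :
  bform (fun i j => c *+ (i == j)) xi xi = c * \sum_i xi i ^+ 2.
Proof.
rewrite /bform mulr_sumr; apply: eq_bigr => i _.
rewrite (bigD1 i)//= eqxx mulr1n big1 ?addr0; first by ring.
by move=> j ji; rewrite eq_sym (negbTE ji) mulr0n mulr0 mul0r.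
Qed.

Lemma bformB M B xi : bform (fun i j => M i j - B i j) xi xi = bform M xi xi - bform B xi xi.
Proof.
rewrite /bform -sumrB; apply: eq_bigr => i _; rewrite -sumrB.
by apply: eq_bigr => j _; ring.
Qed.

(** Let M = c I - H, which is positive semidefinite. The trace of a M is at
    least lam times the trace of M by ellipticity, and it is bounded above
    because the sum of a_ij V_ij is nonnegative. The trace of M bounds all
    entries of M, hence those of H. *)
Lemma hessian_bound (a H V : 'I_n -> 'I_n -> R) (lam Lam c : R) :
  0 < lam -> 0 <= c ->
  (forall i j, a i j = a j i) ->
  (forall xi, lam * (\sum_i xi i ^+ 2) <= bform a xi xi) ->
  (forall xi, bform a xi xi <= Lam * (\sum_i xi i ^+ 2)) ->
  (forall i j, H i j = H j i) ->
  (forall xi, bform H xi xi <= c * \sum_i xi i ^+ 2) ->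
  0 <= \sum_i \sum_j a i j * V i j ->
  forall i j, `|H i j| <=
    Lam / lam * (n%:R * c + \sum_i \sum_j `|V i j - H i j|) + c.
Proof.
move=> lam0 c0 sa alam aLam sH Hc aV i j.
pose M i j := c *+ (i == j) - H i j.
have pM : psd M.
  split => [k l|xi]; first by rewrite /M sH eq_sym.
  by rewrite bformB bform_scalar subr_ge0.
have pa : psd (fun i j => a i j - lam *+ (i == j)).
  split => [k l|xi]; first by rewrite sa eq_sym.
  by rewrite bformB bform_scalar subr_ge0.
have pa' : psd a.
  split => // xi; apply: le_trans (alam xi).
  apply: mulr_ge0; first exact: ltW.
  by apply: sumr_ge0 => k _; exact: sqr_ge0.
have paL : psd (fun i j => Lam *+ (i == j) - a i j).
  split => [k l|xi]; first by rewrite sa eq_sym.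
  by rewrite bformB bform_scalar subr_ge0.
have aii k : a k k <= Lam.
  by have := psd_diag k paL; rewrite eqxx mulr1n subr_ge0.
have aij k l : `|a k l| <= Lam.
  by have := psd_entry k l pa'; have := aii k; have := aii l; lra.
have T := psd_trace_ge0 pa pM.
have TE : \sum_i \sum_j (a i j - lam *+ (i == j)) * M i j =
    c * \sum_k a k k - \sum_k \sum_l a k l * H k l - lam * \sum_k M k k.
  rewrite !mulr_sumr -!sumrB; apply: eq_bigr => k _.
  under eq_bigr do rewrite mulrBl {1}/M mulrBr.
  rewrite !sumrB; congr (_ - _ - _).
    rewrite (bigD1 k)//= eqxx mulr1n big1 ?addr0; first exact: mulrC.
    by move=> l lk; rewrite eq_sym (negbTE lk) mulr0n mulr0.
  rewrite (bigD1 k)//= eqxx mulr1n big1 ?addr0//.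
  by move=> l lk; rewrite eq_sym (negbTE lk) mulr0n mul0r.
rewrite TE in T.
pose S := \sum_i \sum_j `|V i j - H i j|.
have tra : \sum_k a k k <= n%:R * Lam.
  apply: (@le_trans _ _ (\sum_(k < n) Lam)); first by apply: ler_sum.
  by rewrite sumr_const card_ord mulr_natl.
have aE : - \sum_k \sum_l a k l * H k l <= Lam * S.
  have -> : - \sum_k \sum_l a k l * H k l =
      \sum_k \sum_l a k l * (V k l - H k l) - \sum_k \sum_l a k l * V k l.
    rewrite -sumrB -sumrN; apply: eq_bigr => k _; rewrite -sumrB -sumrN.
    by apply: eq_bigr => l _; ring.
  apply: (@le_trans _ _ (\sum_k \sum_l a k l * (V k l - H k l))); first by rewrite gerBl.
  rewrite /S mulr_sumr; apply: ler_sum => k _; rewrite mulr_sumr; apply: ler_sum => l _.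
  apply: le_trans (ler_norm _) _; rewrite normrM ler_wpM2r//.
have trM : \sum_k M k k <= Lam / lam * (n%:R * c + S).
  rewrite mulrAC ler_pdivlMr// mulrDr mulrCA mulrA.
  have : c * (\sum_k a k k) <= c * (n%:R * Lam) by rewrite ler_wpM2l.
  move=> h; lra.
have Mij := psd_entry_trace i j pM.
have -> : H i j = c *+ (i == j) - M i j by rewrite /M; ring.
apply: le_trans (ler_normB _ _) _; rewrite addrC lerD//.
  exact: le_trans Mij trM.
by case: (i == j); rewrite ?mulr1n ?mulr0n ?normr0// ger0_norm.
Qed.

End quadratic_forms.

(** * Gradient and Hessian of a mollified function *)

Section second_order.
Context {R : realType}.

(** If d were positive, F' would be positive just to the right of 0 and F
    would exceed its maximum by the mean value theorem. *)
Lemma second_derivative_at_max (F F' : R -> R) (d r : R) : 0 < r ->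
  (forall t : R, is_derive t 1 F (F' t)) -> is_derive (0 : R) 1 F' d ->
  (forall t, `|t| < r -> F t <= F 0) -> F' 0 = 0 /\ d <= 0.
Proof.
move=> r0 dF dF' Fmax.
have F'0 : F' 0 = 0.
  have [_ <-] := dF 0.
  have [_ ->] // : is_derive (0 : R) 1 F 0.
  apply: (@derive1_at_max _ F (- r) r).
  - by rewrite ge0_cp// ltW.
  - by move=> t _; have [] := dF t.
  - by rewrite in_itv/= oppr_lt0 r0.
  - by move=> t; rewrite in_itv/= -ltr_norml; exact: Fmax.
split => //; rewrite leNgt; apply/negP => d0.
have [dv de] := dF'.
have cv : h^-1 *: ((F' \o shift 0) (h *: 1) - F' 0) @[h --> 0^'] --> d.
  by rewrite -de; exact: dv.
have : \forall h \near 0^', 0 < h^-1 *: ((F' \o shift 0) (h *: 1) - F' 0).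
  exact: (cvgr_gt d).
rewrite near_withinE => /nbhs_ballP[e /= e0 He].
pose s := Num.min e r / 2.
have m0 : 0 < Num.min e r by rewrite lt_min e0.
have s0 : 0 < s by rewrite divr_gt0.
have sm : s < Num.min e r by rewrite /s; lra.
have [se sr] : s < e /\ s < r by move: sm; rewrite lt_min => /andP.
have [c] : exists2 c, c \in `]0, s[ & F s - F 0 = F' c * (s - 0).
  apply: MVT => //.
  by apply: continuous_subspaceT; exact: is_derive_continuous dF.
rewrite in_itv/= => /andP[c0 cs] Fs.
have : 0 < F' c.
  have := He c; rewrite /ball/= sub0r normrN gtr0_norm// => /(_ (lt_trans cs se)).
  have c1 : c != 0 by rewrite gt_eqF.
  move=> /(_ c1); rewrite F'0 subr0 addr0 [c%:A]mulr1 /GRing.scale/= pmulr_rgt0//.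
  by rewrite invr_gt0.
move=> F'c; have := Fmax s; rewrite gtr0_norm// => /(_ sr).
by rewrite -subr_le0 Fs subr0 leNgt mulr_gt0.
Qed.

End second_order.

Section moll_calculus.
Context {R : realType} {n : nat}.
Local Notation mu := (lebesgue_rV (R := R) n).
Variables (eta : R) (psi : nat -> R -> R).
Hypothesis mpsi : mollifier eta psi.
Variable f : 'rV[R]_n -> R.
Hypothesis intf : mu.-integrable setT (EFin \o f).
Implicit Types (al : 'I_n -> nat) (x y v : 'rV[R]_n).
Local Notation F := (moll psi f).
Local Notation al0 := (fun _ : 'I_n => 0%N).

Lemma is_derive_moll_line al x v (t : R) :
  is_derive t 1 (fun s : R => F al (x + s *: v))
    (- \sum_j v ord0 j * F (incr j al) (x + t *: v)).
Proof. by apply: is_derive_line; exact: (is_derive_moll mpsi). Qed.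

Lemma moll_mvt al x y : exists2 t : R, 0 <= t <= 1 &
  F al y - F al x = - \sum_j (y ord0 j - x ord0 j) * F (incr j al) (x + t *: (y - x)).
Proof.
have c : continuous (fun s : R => F al (x + s *: (y - x))).
  by apply: is_derive_continuous => t; exact: is_derive_moll_line.
have [t] := MVT_segment ler01 (fun t _ => is_derive_moll_line al x (y - x) t)
  (continuous_subspaceT c).
rewrite in_itv/= => t01; rewrite subr0 mulr1 scale1r scale0r addr0 [x + _]addrC subrK => E.
exists t => //; rewrite E; congr (- _); apply: eq_bigr => j _.
by rewrite !mxE.
Qed.

Lemma moll_close al x y (h C : R) : 0 <= h ->
  (forall j, `|y ord0 j - x ord0 j| <= h) ->
  (forall j (t : R), 0 <= t <= 1 -> `|F (incr j al) (x + t *: (y - x))| <= C) ->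
  `|F al y - F al x| <= n%:R * h * C.
Proof.
move=> h0 yx FC; have [t t01 ->] := moll_mvt al x y.
rewrite normrN (le_trans (ler_norm_sum _ _ _))//.
apply: (@le_trans _ _ (\sum_(j < n) h * C)).
  by apply: ler_sum => j _; rewrite normrM ler_pM//; exact: FC.
by rewrite sumr_const card_ord -[leLHS]mulr_natl mulrA.
Qed.

Lemma continuous_moll al : continuous (F al).
Proof.
have bC j : exists C : R, 0 <= C /\ forall x, `|F (incr j al) x| <= C.
  by have [C C0 FC] := moll_bounded mpsi (incr j al) intf; exists C.
have [C CP] := choice bC.
pose L := \sum_j C j.
have FL j x : `|F (incr j al) x| <= L.
  rewrite (le_trans ((CP j).2 x))// /L (bigD1 j)//= lerDl.
  by apply: sumr_ge0 => k _; exact: (CP k).1.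
have L0 : 0 <= L by apply: sumr_ge0 => k _; exact: (CP k).1.
move=> x; apply/(@cvgrPdist_le _ _ _ (nbhs x) (nbhs_filter x)) => /= e e0.
have c0 : 0 < n%:R * L + 1 by rewrite ltr_wpDl// mulr_ge0.
near=> y.
have yx : ball x (e / (n%:R * L + 1)) y by near: y; apply: nbhsx_ballx; exact: divr_gt0.
rewrite distrC.
apply: (le_trans (@moll_close al x y (e / (n%:R * L + 1)) L _ _ _)) => //.
- by rewrite ltW// divr_gt0.
- by move=> j; have [_ /(_ ord0 j)] := yx; rewrite /ball/= distrC => /ltW.
- rewrite mulrAC mulrCA ger_pMr// ler_pdivrMr// mul1r lerDl//.
Unshelve. all: by end_near. Qed.

(** Each derivative of the kernel with respect to its centre brings a sign;
    the two signs in the Hessian cancel. *)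
Definition mgrad (i : 'I_n) x : R := - F (incr i al0) x.
Definition mhess (i j : 'I_n) x : R := F (incr i (incr j al0)) x.

Lemma mhess_sym i j x : mhess i j x = mhess j i x.
Proof.
by rewrite /mhess; congr (moll psi f _ x); apply/funext => k; rewrite /incr addnCA.
Qed.

(** Restricting to the lines through x reduces the claim to functions of one
    variable. *)
Lemma mgrad_mhess_at_max (p : 'I_n -> R) x (r : R) : 0 < r ->
  (forall y, (forall i, `|y ord0 i - x ord0 i| <= r) ->
     F al0 y - \sum_i p i * y ord0 i <= F al0 x - \sum_i p i * x ord0 i) ->
  (forall i, mgrad i x = p i) /\
  (forall xi : 'I_n -> R, bform (fun i j => mhess i j x) xi xi <= 0).
Proof.
move=> r0 xmax.
have key (xi : 'I_n -> R) : \sum_j xi j * (mgrad j x - p j) = 0 /\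
    bform (fun i j => mhess i j x) xi xi <= 0.
  pose v : 'rV[R]_n := \row_j xi j.
  have vE j : v ord0 j = xi j by rewrite mxE.
  pose g (t : R) := F al0 (x + t *: v) - \sum_i p i * (x ord0 i + t * xi i).
  pose g' (t : R) := \sum_j xi j * (mgrad j (x + t *: v) - p j).
  have dg (t : R) : is_derive t 1 g (g' t).
    have d2 : is_derive t 1 (fun t => \sum_i p i * (x ord0 i + t * xi i)) (\sum_i p i * xi i).
      apply: (@is_derive_quadratic _ _ _ _ _ _ 0) => h.
      rewrite mul0r normr_le0 [_%:A]mulr1 mulr_sumr -!sumrB; apply/eqP.
      by rewrite big1// => i _; ring.
    apply: (is_derive_eq (is_deriveB (is_derive_moll_line al0 x v t) d2)).
    rewrite -sumrN -sumrB; apply: eq_bigr => j _; rewrite vE /mgrad; ring.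
  have dg' : is_derive (0 : R) 1 g' (bform (fun i j => mhess i j x) xi xi).
    have dj j : is_derive (0 : R) 1 (fun t => xi j * (mgrad j (x + t *: v) - p j))
        (xi j * \sum_i xi i * mhess i j x).
      have d1 := is_deriveZ (xi j) (is_deriveB (is_deriveN
        (is_derive_moll_line (incr j al0) x v 0)) (is_derive_cst (p j) (0 : R) 1)).
      apply: (is_derive_eq d1); rewrite subr0 opprK scale0r addr0 /GRing.scale/=.
      by congr (_ * _); apply: eq_bigr => i _; rewrite vE.
    have := @is_derive_sum _ _ _ n _ (0 : R) 1 _ dj.
    have -> : \sum_(j < n) (fun t => xi j * (mgrad j (x + t *: v) - p j)) = g'.
      by apply/funext => t; rewrite /g' fct_sumE.
    move=> /is_derive_eq; apply; rewrite /bform exchange_big/=.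
    apply: eq_bigr => j _; rewrite mulr_sumr; apply: eq_bigr => i _.
    by ring.
  pose c := \sum_i `|xi i| + 1.
  have c0 : 0 < c by rewrite ltr_wpDl// sumr_ge0.
  have rc0 : 0 < r / c by rewrite divr_gt0.
  have gmax t : `|t| < r / c -> g t <= g 0.
    move=> tr; rewrite /g scale0r addr0.
    have -> : \sum_i p i * (x ord0 i + t * xi i) = \sum_i p i * (x + t *: v) ord0 i.
      by apply: eq_bigr => i _; rewrite !mxE.
    have -> : \sum_i p i * (x ord0 i + 0 * xi i) = \sum_i p i * x ord0 i.
      by apply: eq_bigr => i _; rewrite mul0r addr0.
    apply: xmax => i; rewrite !mxE [x ord0 i + _]addrC addrK normrM.
    apply: (@le_trans _ _ (r / c * c)); last by rewrite divfK// gt_eqF.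
    apply: ler_pM => //; first exact: ltW.
    rewrite /c (bigD1 i)//= -addrA lerDl addr_ge0// sumr_ge0//.
  have [g0 b0] := second_derivative_at_max rc0 dg dg' gmax.
  by split => //; move: g0; rewrite /g' scale0r addr0.
split => [i|xi]; last by have [] := key xi.
have [+ _] := key (delta i); rewrite (bigD1 i)//= /delta eqxx mul1r big1 ?addr0.
  by move=> /eqP; rewrite subr_eq0 => /eqP.
by move=> j /negbTE ->; rewrite mul0r.
Qed.

End moll_calculus.

(** * Volume of an image through a grid of cubes *)

Section cover.
Local Open Scope ereal_scope.

Lemma measure_le_seq d (T : measurableType d) (R : realType)
    (mu : {measure set T -> \bar R}) (I : Type) (s : seq I) (B : I -> set T) (S : set T) :
  measurable S -> (forall i, measurable (B i)) ->
  S `<=` \big[setU/set0]_(i <- s) B i -> mu S <= \sum_(i <- s) mu (B i).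
Proof.
move=> mS mB SB.
have mU (s' : seq I) : measurable (\big[setU/set0]_(i <- s') B i).
  by apply: bigsetU_measurable.
apply: (@le_trans _ _ (mu (\big[setU/set0]_(i <- s) B i))).
  by apply: le_measure; rewrite ?inE.
elim: s {SB} => [|i s IH]; first by rewrite !big_nil measure0.
rewrite !big_cons; apply: (le_trans (measureU2 _ (mB i) (mU s))).
by rewrite leeD2l.
Qed.

(** Bounds on the pieces B i by integrals over disjoint cells add up to one
    integral. *)
Lemma cover_measure_le d (T : measurableType d) (R : realType)
    (mu : {measure set T -> \bar R}) (I : choiceType) (s : seq I) (Q B : I -> set T)
    (F : T -> \bar R) (K S : set T) :
  uniq s -> trivIset [set` s] Q -> (forall i, measurable (Q i)) ->
  (forall i, measurable (B i)) -> measurable K -> measurable S ->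
  measurable_fun setT F -> (forall x, 0 <= F x) ->
  (forall i, i \in s -> Q i `<=` K) ->
  (forall i, i \in s -> mu (B i) <= \int[mu]_(x in Q i) F x) ->
  S `<=` \big[setU/set0]_(i <- s) B i ->
  mu S <= \int[mu]_(x in K) F x.
Proof.
move=> us tQ mQ mB mK mS mF F0 QK BQ SB.
apply: (le_trans (measure_le_seq mu mS mB SB)).
apply: (@le_trans _ _ (\sum_(i <- s) \int[mu]_(x in Q i) F x)).
  by rewrite big_seq [leRHS]big_seq; apply: lee_sum => i; exact: BQ.
rewrite -ge0_integral_bigsetU//; last exact: measurable_funTS.
apply: ge0_subset_integral => //.
- exact: bigsetU_measurable.
- exact: measurable_funTS.
- by rewrite -bigcup_seq => x [i /= iss]; exact: QK.
Qed.

End cover.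

Section grid.
Context {R : realType} {n : nat}.
Local Notation mu := (lebesgue_rV (R := R) n).
Variable N : nat.
Hypothesis N_gt0 : (0 < N)%N.

Definition mesh : R := 2 / N%:R.

Lemma mesh_gt0 : 0 < mesh.
Proof. by rewrite divr_gt0// ltr0n. Qed.

(** Half-open cubes, so that those with all indices below N partition the cube
    [-1, 1[^n. *)
Definition gcube (k : 'I_n -> nat) : set 'rV[R]_n :=
  rect (fun i => `[-1 + mesh * (k i)%:R, -1 + mesh * (k i).+1%:R[%classic).

Lemma measurable_gcube k : measurable (gcube k).
Proof. exact: measurable_rect. Qed.

Lemma lebesgue_gcube k : mu (gcube k) = (mesh ^+ n)%:E.
Proof.
rewrite (@lebesgue_rV_rect _ _ _ (fun=> mesh))//.
  by rewrite big_const_ord iter_mulr_1.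
move=> i; rewrite lebesgue_measure_itv/= lte_fin ltrD2l ltr_pM2l ?mesh_gt0//.
rewrite ltr_nat ltnS leqnn -EFinD; congr EFin.
by rewrite mulrSr; ring.
Qed.

Lemma gcube_disjoint k l x : gcube k x -> gcube l x -> k =1 l.
Proof.
move=> kx lx i; have := kx i; have := lx i; rewrite /= !in_itv/=.
move=> /andP[l1 l2] /andP[k1 k2].
have kl : (k i)%:R < (l i).+1%:R :> R.
  by rewrite -(ltr_pM2l mesh_gt0); lra.
have lk : (l i)%:R < (k i).+1%:R :> R.
  by rewrite -(ltr_pM2l mesh_gt0); lra.
by move: kl lk; rewrite !ltr_nat !ltnS => kl lk; apply/eqP; rewrite eqn_leq kl.
Qed.

Lemma gcube_cover (x : 'rV[R]_n) : (forall i, -1 <= x ord0 i < 1) ->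
  exists k : {ffun 'I_n -> 'I_N}, gcube (fun i => k i) x.
Proof.
move=> x1.
have t0 i : 0 <= (x ord0 i + 1) / mesh.
  have /andP[h1 _] := x1 i.
  by apply: divr_ge0; [lra|exact/ltW/mesh_gt0].
have tN i : (Num.truncn ((x ord0 i + 1) / mesh) < N)%N.
  rewrite truncn_lt_nat// ltr_pdivrMr ?mesh_gt0// /mesh mulrCA divff ?mulr1.
    by have /andP[_ h] := x1 i; lra.
  by rewrite pnatr_eq0 -lt0n.
exists [ffun i => Ordinal (tN i)] => i; rewrite ffunE /= in_itv/=.
have /andP[h1 h2] := truncn_itv (t0 i).
move: h1 h2; rewrite ler_pdivlMr ?mesh_gt0// ltr_pdivrMr ?mesh_gt0//.
set m := Num.truncn _ => h1 h2.
by rewrite [mesh * _]mulrC [mesh * _]mulrC; apply/andP; split; lra.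
Qed.

Lemma gcube_diam k x y i : gcube k x -> gcube k y ->
  `|y ord0 i - x ord0 i| <= mesh.
Proof.
move=> kx ky; have := kx i; have := ky i; rewrite /= !in_itv/=.
move=> /andP[y1 y2] /andP[x1 x2].
have E : mesh * (k i).+1%:R = mesh * (k i)%:R + mesh by rewrite mulrSr mulrDr mulr1.
by rewrite E in x2 y2; rewrite ler_norml; apply/andP; split; lra.
Qed.

(** Takes the place of the change of variables formula: G maps the part of Gam
    in one grid cube into a box of side 2 s, and these boxes cover the whole
    cube of values [0, delta]^n. *)
Lemma image_volume_le (G : 'I_n -> 'rV[R]_n -> R) (Gam K : set 'rV[R]_n)
    (F : 'rV[R]_n -> \bar R) (delta : R) : 0 <= delta ->
  measurable K -> measurable_fun setT F -> (forall x, 0 <= F x)%E ->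
  (forall p : 'I_n -> R, (forall i, 0 <= p i <= delta) ->
     exists2 x, Gam x & forall i, G i x = p i) ->
  (forall x, Gam x -> forall i, -1 <= x ord0 i < 1) ->
  (forall x k, Gam x -> gcube k x -> gcube k `<=` K /\
     exists s : R, [/\ 0 <= s,
       forall y, Gam y -> gcube k y -> forall i, `|G i y - G i x| <= s &
       (((2 * s) ^+ n)%:E <= \int[mu]_(z in gcube k) F z)%E]) ->
  ((delta ^+ n)%:E <= \int[mu]_(z in K) F z)%E.
Proof.
move=> delta0 mK mF F0 surj Gam1 loc.
pose meets (k : {ffun 'I_n -> 'I_N}) := exists x, Gam x /\ gcube (fun i => k i) x.
(* For each cube meeting Gam: a point of Gam in it, and the radius s of the
   box around its image. *)
have /choice[xs xsP] : forall k : {ffun 'I_n -> 'I_N}, exists xs : 'rV[R]_n * R, meets k ->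
    [/\ Gam xs.1, gcube (fun i => k i) xs.1, 0 <= xs.2,
     forall y, Gam y -> gcube (fun i => k i) y -> forall i, `|G i y - G i xs.1| <= xs.2 &
     (((2 * xs.2) ^+ n)%:E <= \int[mu]_(z in gcube (fun i => k i)) F z)%E].
  move=> k; have [[x [Gx kx]]|nb] := pselect (meets k); last by exists (0, 0).
  by have [_ [s [s0 sG sF]]] := loc _ _ Gx kx; exists (x, s).
pose B k : set 'rV[R]_n := box (fun i => G i (xs k).1 - (xs k).2) (fun i => G i (xs k).1 + (xs k).2).
pose S : set 'rV[R]_n := box (fun=> 0) (fun=> delta).
have -> : (delta ^+ n)%:E = mu S.
  by rewrite lebesgue_rV_box// big_const_ord iter_mulr_1 subr0.
apply: (@cover_measure_le _ _ _ mu _ [seq k <- enum {ffun 'I_n -> 'I_N} | `[< meets k >]]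
  (fun k => gcube (fun i => k i)) B) => //.
- by rewrite filter_uniq// enum_uniq.
- move=> k l _ _ [x [kx lx]]; apply/ffunP => i; apply: val_inj.
  exact: gcube_disjoint kx lx i.
- by move=> k; exact: measurable_gcube.
- by move=> k; exact: measurable_box.
- exact: measurable_box.
- move=> k; rewrite mem_filter => /andP[/asboolP[x [Gx kx]] _].
  by have [] := loc _ _ Gx kx.
- move=> k; rewrite mem_filter => /andP[/asboolP/xsP[_ _ s0 _ sF] _].
  suff H : (lebesgue_rV n (B k) <= ((2 * (xs k).2) ^+ n)%:E)%E by exact: le_trans H sF.
  rewrite /B lebesgue_rV_box; last by move=> i; lra.
  rewrite lee_fin -[leRHS]iter_mulr_1 -big_const_ord; apply: ler_prod => i _.
  by apply/andP; split; lra.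
- move=> p pS; have [x Gx Gxp] := surj (fun i => p ord0 i) pS.
  have [k kx] := gcube_cover (Gam1 _ Gx).
  have bk : meets k by exists x.
  rewrite -bigcup_seq; exists k; first by rewrite /= mem_filter mem_enum andbT; apply/asboolP.
  have [_ _ _ kG _] := xsP k bk.
  by move=> i; have := kG x Gx kx i; rewrite Gxp ler_distl.
Qed.

End grid.

(** * Uniformity on the closed unit ball *)

Section compactness.
Context {R : realType} {n : nat}.
Local Notation B1 := (@unit_ball R n).
Local Notation C1 := (closure B1).
Implicit Types (x y : 'rV[R]_n) (u : 'rV[R]_n -> R).

Lemma ball_rV x y (e : R) : 0 < e -> ball x e y <-> forall i, `|y ord0 i - x ord0 i| < e.
Proof.
move=> e0; split=> [[_ xy] i|xy].
  by have := xy ord0 i; rewrite /ball/= distrC.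
split => // i j; rewrite (ord1 i) /ball/= distrC; exact: xy.
Qed.

(** One radius for all of K, from radii that depend on the point. Asking for P
    at every nearby y and every smaller radius is what allows finitely many
    neighbourhoods to suffice. *)
Lemma compact_uniform_radius (K : set 'rV[R]_n) (P : R -> 'rV[R]_n -> Prop) :
  compact K ->
  (forall x, K x -> exists2 r : R, 0 < r & forall y e, K y ->
     (forall i, `|y ord0 i - x ord0 i| < r) -> 0 < e -> e < r -> P e y) ->
  exists2 e : R, 0 < e & forall x, K x -> P e x.
Proof.
move=> /compact_near_coveringP/near_covering_withinP cK H.
have := cK R (0 : R)^'+ P _.
move=> /(_ _) [|e0 /= e0_gt0 He0].
  move=> x Kx; have [r r0 xr] := H x Kx.
  exists (ball x r, [set e : R | 0 < e < r]) => /=.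
    split; first exact: nbhsx_ballx.
    near=> e; apply/andP; split; near: e; first exact: nbhs_right_gt.
    exact: nbhs_right_lt.
  move=> [y e] /= [/(ball_rV x y r0) xy /andP[e1 e2]] Ky.
  exact: xr.
exists (e0 / 2); first by rewrite divr_gt0.
apply: He0; rewrite /ball/= ?sub0r ?normrN ?gtr0_norm//; rewrite ?divr_gt0//; lra.
Unshelve. all: by end_near. Qed.

Lemma closure_unit_ball_sub : C1 `<=` sq_ball 1.
Proof.
have cl : closed (@sq_ball R n 1).
  by apply: compact_closed; [exact: norm_hausdorff|exact: compact_sq_ball].
rewrite [X in _ `<=` X](closure_id _).1//.
by apply: closureS => x; rewrite /sq_ball /unit_ball /= => /ltW.
Qed.

Lemma compact_closure_unit_ball : compact C1.
Proof.
apply: subclosed_compact closure_unit_ball_sub; first exact: closed_closure.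
exact: compact_sq_ball.
Qed.

Variable u : 'rV[R]_n -> R.
Hypothesis cu : {within C1, continuous u}.

Lemma within_cont_closure x (e : R) : C1 x -> 0 < e ->
  exists2 r : R, 0 < r & forall y, C1 y -> (forall i, `|y ord0 i - x ord0 i| < r) ->
    `|u y - u x| < e.
Proof.
move=> Cx e0; have /subspace_continuousP/(_ x Cx) := cu.
move=> /cvgrPdist_lt/(_ _ e0); rewrite near_withinE => /nbhs_ballP[r /= r0 Hr].
exists r => // y Cy xy; rewrite distrC; apply: Hr => //.
by apply/ball_rV.
Qed.

Lemma unif_cont_closure (e : R) : 0 < e ->
  exists2 eta : R, 0 < eta & forall x y, C1 x -> C1 y ->
    (forall i, `|y ord0 i - x ord0 i| <= eta) -> `|u y - u x| <= e.
Proof.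
move=> e0.
have [|eta eta0 H] := @compact_uniform_radius C1
  (fun eta x => forall y, C1 y -> (forall i, `|y ord0 i - x ord0 i| <= eta) -> `|u y - u x| <= e)
  compact_closure_unit_ball; last by exists eta => // x y Cx; exact: H.
move=> x Cx; have e2 : 0 < e / 2 by exact: divr_gt0.
have [r r0 xr] := within_cont_closure Cx e2.
exists (r / 2) => [|y d Cy yx d0 dr z Cz zy]; first exact: divr_gt0.
have h1 := xr y Cy; have h2 := xr z Cz.
have -> : u z - u y = (u z - u x) - (u y - u x) by ring.
apply: (le_trans (ler_normB _ _)).
have : `|u y - u x| < e / 2 by apply: h1 => i; apply: lt_trans (yx i) _; lra.
have : `|u z - u x| < e / 2.
  apply: h2 => i.
  have -> : z ord0 i - x ord0 i = (z ord0 i - y ord0 i) + (y ord0 i - x ord0 i) by ring.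
  apply: (le_lt_trans (ler_normD _ _)).
  by have := yx i; have := zy i; lra.
lra.
Qed.

(** The superlevel set is compact and does not meet the sphere. *)
Lemma superlevel_interior (M : R) : (forall x, unit_sphere x -> u x < M) ->
  exists rho : R, [/\ 0 <= rho, rho < 1 & forall x, C1 x -> M <= u x -> sq_ball rho x].
Proof.
move=> uM.
have [|e e0 H] := @compact_uniform_radius C1
  (fun e x => M <= u x -> \sum_(i < n) x ord0 i ^+ 2 <= 1 - e)
  compact_closure_unit_ball; last first.
  exists (Num.max 0 (1 - e)); split.
  - by rewrite le_max lexx.
  - by rewrite gt_max ltr01/=; lra.
  - by move=> x Cx Mu; rewrite /sq_ball /= le_max H// orbT.
move=> x Cx; have [B1x|nB1x] := pselect (B1 x); last first.
  have ux : u x < M by apply: uM; split.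
  have d0 : 0 < M - u x by rewrite subr_gt0.
  have [r r0 xr] := within_cont_closure Cx d0.
  exists r => // y d Cy yx _ _ My; have := xr y Cy yx.
  by rewrite ltr_norml => /andP[_ h]; exfalso; lra.
pose s := \sum_(i < n) x ord0 i ^+ 2.
have s1 : s < 1 by exact: B1x.
have d0 : 0 < (1 - s) / 2 by rewrite divr_gt0// subr_gt0.
have /cvgrPdist_lt/(_ _ d0)/nbhs_ballP[r /= r0 Hr] := @continuous_sq_norm R n x.
exists (Num.min r ((1 - s) / 2)); first by rewrite lt_min r0.
move=> y d Cy yx d1; rewrite lt_min => /andP[_ d2] _.
have : `|s - \sum_(i < n) y ord0 i ^+ 2| < (1 - s) / 2.
  apply: Hr; apply/ball_rV => // i.
  by apply: lt_le_trans (yx i) _; rewrite ge_min lexx.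
by rewrite ltr_norml => /andP[h _]; lra.
Qed.

End compactness.

(** * Elementary estimates *)

Section auxiliary.
Context {R : realType}.

Lemma sum_exp_le (I : Type) (s : seq I) (m : nat) : (0 < m)%N ->
  exists2 C : R, 0 <= C & forall t : I -> R, (forall i, 0 <= t i) ->
    (\sum_(i <- s) t i) ^+ m <= C * \sum_(i <- s) t i ^+ m.
Proof.
move=> m0; elim: s => [|i s [C C0 IH]].
  by exists 0 => // t _; rewrite !big_nil expr0n gtn_eqF// mul0r.
exists (3 ^+ m * (C + 1)); first by rewrite mulr_ge0 ?exprn_ge0// addr_ge0.
move=> t t0; rewrite !big_cons.
have s0 : 0 <= \sum_(j <- s) t j by apply: sumr_ge0.
have := norm3_exp m (t i) (\sum_(j <- s) t j) 0.
rewrite subr0 normr0 expr0n gtn_eqF// add0r ger0_norm ?addr_ge0// !ger0_norm//.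
move=> /le_trans; apply; rewrite -mulrA ler_wpM2l ?exprn_ge0//.
have ti : 0 <= t i ^+ m by exact: exprn_ge0.
have ts : 0 <= \sum_(j <- s) t j ^+ m by apply: sumr_ge0 => j _; exact: exprn_ge0.
have := IH t t0; have : 0 <= C * t i ^+ m by exact: mulr_ge0.
by rewrite mulrDl mulrDr mul1r; lra.
Qed.

Lemma bform_close n (M M' : 'I_n -> 'I_n -> R) (e : R) (xi : 'I_n -> R) : 0 <= e ->
  (forall i j, `|M i j - M' i j| <= e) ->
  bform M xi xi <= bform M' xi xi + n%:R * e * \sum_i xi i ^+ 2.
Proof.
move=> e0 MM'; rewrite -lerBlDl -bformB.
have key i j : xi i * (M i j - M' i j) * xi j <= e / 2 * xi i ^+ 2 + e / 2 * xi j ^+ 2.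
  have := MM' i j; rewrite ler_norml; set d := M i j - M' i j => /andP[d1 d2].
  have h1 := sqr_ge0 (xi i + xi j); have h2 := sqr_ge0 (xi i - xi j).
  have h3 : 0 <= (e - d) * (xi i - xi j) ^+ 2 by rewrite mulr_ge0//; lra.
  have h4 : 0 <= (e + d) * (xi i + xi j) ^+ 2 by rewrite mulr_ge0//; lra.
  have h5 : 0 <= (e - d) * (xi i + xi j) ^+ 2 by rewrite mulr_ge0//; lra.
  have h6 : 0 <= (e + d) * (xi i - xi j) ^+ 2 by rewrite mulr_ge0//; lra.
  by move: h3 h4 h5 h6; rewrite !sqrrD !sqrrN !expr2; nra.
apply: (@le_trans _ _ (\sum_(i < n) \sum_(j < n) (e / 2 * xi i ^+ 2 + e / 2 * xi j ^+ 2))).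
  by apply: ler_sum => i _; apply: ler_sum => j _; exact: key.
under eq_bigr do rewrite big_split/= sumr_const card_ord -mulr_sumr.
rewrite big_split/= sumr_const card_ord sumrMnl -mulr_sumr.
set S := \sum_(_ < n) _; rewrite -mulrnDl -[leLHS]mulr_natl.
by rewrite -mulrDl -splitr mulrA.
Qed.

Lemma mulmx_bform n (A : 'M[R]_n) (xi : 'rV[R]_n) :
  (xi *m A *m xi^T) ord0 ord0 = bform (fun i j => A i j) (fun i => xi ord0 i) (fun i => xi ord0 i).
Proof.
rewrite mxE /bform exchange_big/=; apply: eq_bigr => j _.
by rewrite !mxE mulr_suml.
Qed.

Lemma loewner_le_bform n (A B : 'M[R]_n) (xi : 'I_n -> R) : loewner_le A B ->
  bform (fun i j => A i j) xi xi <= bform (fun i j => B i j) xi xi.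
Proof.
move=> /(_ (\row_i xi i)); rewrite !mulmx_bform.
by rewrite (_ : (fun i => (\row_i xi i) ord0 i) = xi)//; apply/funext => i; rewrite mxE.
Qed.

Lemma bform_scalar_mx n (c : R) (xi : 'I_n -> R) :
  bform (fun i j => (c%:M : 'M[R]_n) i j) xi xi = c * \sum_i xi i ^+ 2.
Proof.
rewrite -bform_scalar; congr (bform _ xi xi).
by apply/funext => i; apply/funext => j; rewrite mxE.
Qed.

Lemma mesh_small (tau : R) : 0 < tau -> exists2 N : nat, (0 < N)%N & @mesh R N <= tau.
Proof.
move=> tau0; exists (Num.truncn (2 / tau)).+1 => //.
rewrite /mesh ler_pdivrMr ?ltr0n// mulrC -ler_pdivrMr//.
have t0 : 0 <= 2 / tau by rewrite divr_ge0// ltW.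
by have /andP[_ /ltW] := truncn_itv t0.
Qed.

Section moll_uniform.
Context {n : nat}.
Local Notation mu := (lebesgue_rV (R := R) n).
Local Notation D := (@unit_box R n).

(** Jensen's inequality with exponent 1, the oscillation being bounded
    pointwise. *)
Lemma moll_uniform (eta : R) (psi : nat -> R -> R) (f : 'rV[R]_n -> R)
    (x : 'rV[R]_n) (e : R) :
  mollifier eta psi -> measurable_fun setT f -> mu.-integrable setT (EFin \o f) -> 0 <= e ->
  (forall y : 'rV[R]_n, (forall i, `|y ord0 i - x ord0 i| <= eta) -> D y /\ `|f y - f x| <= e) ->
  `|moll psi f (fun=> 0%N) x - f x| <= e.
Proof.
move=> mpsi mf intf e0 fe.
have := moll_sub_le mpsi 1 mf intf (fun y yx => (fe y yx).1).
rewrite expr1 -lee_fin => /le_trans; apply.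
have mphi : measurable_fun setT (kern psi (fun=> 0%N) x).
  by apply: measurable_kern; have [_ []] := mpsi.
apply: (@le_trans _ _ (\int[mu]_y (e%:E * (kern psi (fun=> 0%N) x y)%:E))%E); last first.
  rewrite ge0_integralZl_EFin//.
  - by rewrite (integral_phi mpsi) mule1.
  - by move=> y _; rewrite lee_fin (phi_ge0 mpsi).
  - by apply/measurable_EFinP.
apply: ge0_le_integral => //.
- by move=> y _; rewrite lee_fin !mulr_ge0 ?exprn_ge0// (phi_ge0 mpsi).
- apply/measurable_EFinP; apply: measurable_funM; first exact: measurable_indic_unit_box.
  apply: measurable_funM => //; apply: measurable_funX; apply: measurableT_comp => //.
  exact: measurable_funB.
- by apply: measurable_funeM; apply/measurable_EFinP.
- move=> y _; rewrite -EFinM lee_fin expr1.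
  have [yx|] := pselect (forall i, `|y ord0 i - x ord0 i| <= eta); last first.
    move=> /existsNP[i /negP]; rewrite -ltNge => yx.
    by rewrite (kern_support mpsi _ yx) mul0r !mulr0.
  have [Dy fy] := fe y yx.
  by rewrite indicE mem_set// mul1r mulrC ler_wpM2r// (phi_ge0 mpsi).
Qed.

(** Here |f| <= 1 + |f| ^+ m on the box, whose measure is finite. *)
Lemma integrable_of_exp (f : 'rV[R]_n -> R) (m : nat) : (0 < m)%N ->
  measurable_fun setT f -> (forall x, \1_D x * f x = f x) ->
  mu.-integrable setT (fun x => (\1_D x * `|f x| ^+ m)%:E) ->
  mu.-integrable setT (EFin \o f).
Proof.
move=> m0 mf fD intf; have := integrable_EFinD (@integrable_unit_box R n) intf.
apply: le_integrable => //; first by apply/measurable_EFinP.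
move=> x _ /=; rewrite lee_fin -{1}(fD x) normrM ger0_norm//.
rewrite [X in _ <= X]ger0_norm ?addr_ge0// ?mulr_ge0 ?exprn_ge0//.
rewrite -[X in _ <= X + _]mulr1 -mulrDr ler_wpM2l//.
have [f1|f1] := leP `|f x| 1; first by rewrite (le_trans f1)// lerDl exprn_ge0.
apply: (@le_trans _ _ (`|f x| ^+ m)); last by rewrite lerDr.
by rewrite -{1}[`|f x|]expr1 ler_eXn2l.
Qed.

End moll_uniform.
End auxiliary.

(** * Estimates on one grid cube *)

Section cube_estimates.
Context {R : realType} {n : nat}.
Local Notation mu := (lebesgue_rV (R := R) n).
Variables (eta : R) (psi : nat -> R -> R).
Hypothesis mpsi : mollifier eta psi.
Variable f : 'rV[R]_n -> R.
Hypothesis intf : mu.-integrable setT (EFin \o f).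
Implicit Types x y z : 'rV[R]_n.
Local Notation F := (moll psi f).
Local Notation al0 := (fun _ : 'I_n => 0%N).
Local Notation grad := (mgrad psi f).
Local Notation hess := (mhess psi f).
Variable L : R.
Hypothesis L_ge0 : 0 <= L.
Hypothesis third_le : forall i j k x, `|F (incr k (incr i (incr j al0))) x| <= L.

Definition hess_sum x : R := \sum_i \sum_j `|hess i j x|.

Lemma hess_le_sum i j x : `|hess i j x| <= hess_sum x.
Proof.
rewrite /hess_sum (bigD1 i)//= (bigD1 j)//= -addrA lerDl.
by apply: addr_ge0; apply: sumr_ge0 => // k _; apply: sumr_ge0.
Qed.

Lemma hess_close i j x y (h : R) : 0 <= h -> (forall k, `|y ord0 k - x ord0 k| <= h) ->
  `|hess i j y - hess i j x| <= n%:R * h * L.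
Proof.
by move=> h0 yx; apply: (moll_close mpsi intf) => // k t _; exact: third_le.
Qed.

Lemma grad_close i x y (h : R) : 0 <= h -> (forall k, `|y ord0 k - x ord0 k| <= h) ->
  `|grad i y - grad i x| <= n%:R * h * (hess_sum x + n%:R * h * L).
Proof.
move=> h0 yx; rewrite /mgrad -opprD normrN.
apply: (moll_close mpsi intf) => // j t /andP[t0 t1].
set q := x + _.
have qx k : `|q ord0 k - x ord0 k| <= h.
  rewrite /q !mxE [x ord0 k + _]addrC addrK normrM ger0_norm//.
  by rewrite (le_trans _ (yx k))// ler_piMl.
rewrite (_ : F (incr j (incr i al0)) q = hess j i x + (hess j i q - hess j i x)); last first.
  by rewrite addrC subrK.
apply: (le_trans (ler_normD _ _)); apply: lerD; first exact: hess_le_sum.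
exact: hess_close.
Qed.

(** The Hessian is nonpositive at x and the sign condition on V holds at z.
    Both points lie in a cube of side h, and the third derivatives transport
    the Hessian from one to the other at the price of a term in h. *)
Lemma hess_sum_bound (a V : 'I_n -> 'I_n -> R) (lam Lam h : R) x z :
  0 < lam -> 0 <= h -> (forall k, `|z ord0 k - x ord0 k| <= h) ->
  (forall xi, bform (fun i j => hess i j x) xi xi <= 0) ->
  (forall i j, a i j = a j i) ->
  (forall xi, lam * (\sum_i xi i ^+ 2) <= bform a xi xi) ->
  (forall xi, bform a xi xi <= Lam * (\sum_i xi i ^+ 2)) ->
  0 <= \sum_i \sum_j a i j * V i j ->
  hess_sum x + n%:R * h * L <=
   n%:R * n%:R * (`|Lam| / lam) * (\sum_i \sum_j `|V i j - hess i j z|) +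
   (n%:R * n%:R * (((`|Lam| / lam) * n%:R + 1) * n%:R * n%:R + n%:R) + n%:R) * L * h.
Proof.
move=> lam0 h0 zx hx sa alam aLam aV; set kap := `|Lam| / lam.
set S := \sum_i \sum_j _.
have S0 : 0 <= S by apply: sumr_ge0 => i _; apply: sumr_ge0.
pose c := n%:R * (n%:R * h * L).
have nhL : 0 <= n%:R * h * L by rewrite !mulr_ge0.
have c0 : 0 <= c by rewrite mulr_ge0.
have hz (xi : 'I_n -> R) : bform (fun i j => hess i j z) xi xi <= c * \sum_i xi i ^+ 2.
  apply: (le_trans (@bform_close _ _ _ (fun i j => hess i j x) _ xi nhL _)).
    by move=> i j; exact: hess_close.
  by rewrite gerDr.
have hb := hessian_bound lam0 c0 sa alam aLam (fun i j => mhess_sym psi f i j z) hz aV.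
have hxb i j : `|hess i j x| <= kap * (n%:R * c + S) + c + n%:R * h * L.
  rewrite (_ : hess i j x = hess i j z - (hess i j z - hess i j x)); last by ring.
  apply: (le_trans (ler_normB _ _)); apply: lerD; last exact: hess_close.
  apply: (le_trans (hb i j)); rewrite lerD2r ler_wpM2r//.
    by rewrite addr_ge0// mulr_ge0.
  by rewrite ler_wpM2r ?invr_ge0 ?ler_norm// ltW.
have : hess_sum x <= n%:R * n%:R * (kap * (n%:R * c + S) + c + n%:R * h * L).
  apply: (@le_trans _ _ (\sum_(i < n) \sum_(j < n) (kap * (n%:R * c + S) + c + n%:R * h * L))).
    by apply: ler_sum => i _; apply: ler_sum => j _; exact: hxb.
  by rewrite !sumr_const !card_ord -mulrnA -[leLHS]mulr_natl natrM.
rewrite -(lerD2r (n%:R * h * L)) => /le_trans; apply.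
by rewrite le_eqVlt; apply/orP; left; apply/eqP; rewrite /c; ring.
Qed.

End cube_estimates.

(** * The maximum principle *)

Section abp.
Context {R : realType} {n : nat}.
Local Notation mu := (lebesgue_rV (R := R) n).
Local Notation D := (@unit_box R n).
Local Notation B1 := (@unit_ball R n).
Local Notation C1 := (closure B1).
Implicit Types x y z : 'rV[R]_n.
Local Notation al0 := (fun _ : 'I_n => 0%N).

(** The extension by zero from a smaller ball is a function on the whole
    space, which can be mollified. *)
Definition locally_Lm (m : nat) (f : 'rV[R]_n -> R) : Prop := forall rho, rho < 1 ->
  measurable_fun setT (f \_ (sq_ball rho)) /\
  mu.-integrable setT (fun x => (\1_D x * `|(f \_ (sq_ball rho)) x| ^+ m)%:E).

(** All that the maximum principle needs to know about the weak Hessian V of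
    u; in this form it passes to differences at once. *)
Definition mollified_hessian (u : 'rV[R]_n -> R) (V : 'I_n -> 'I_n -> 'rV[R]_n -> R) : Prop :=
  forall rho eta psi x i j, rho < 1 -> mollifier eta psi ->
    (forall y, (forall k, `|y ord0 k - x ord0 k| <= eta) -> sq_ball rho y) ->
    mhess psi (u \_ (sq_ball rho)) i j x = moll psi (V i j \_ (sq_ball rho)) al0 x.

Hypothesis n_gt0 : (0 < n)%N.

(** The hypothesis on slopes says that the gradient of the mollified function
    maps the contact set onto [0, delta]^n. On a grid cube that meets the
    contact set, grad_close bounds the variation of the gradient by the size
    of the Hessian at a contact point, hess_sum_bound bounds this by |V - H|
    at almost every point of the cube, and Jensen's inequality bounds the
    latter by the oscillation of V. *)
Lemma contact_volume (a : 'rV[R]_n -> 'M[R]_n) (lam Lam : R)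
    (u : 'rV[R]_n -> R) (V : 'I_n -> 'I_n -> 'rV[R]_n -> R)
    (rho0 rho1 rho2 M eta : R) (psi : nat -> R -> R) (delta : R) :
  0 < lam ->
  {ae mu, forall x, B1 x ->
       [/\ (a x)^T = a x, loewner_le lam%:M (a x) & loewner_le (a x) Lam%:M]} ->
  {within C1, continuous u} ->
  locally_Lm 1 u -> (forall i j, locally_Lm n (V i j)) -> mollified_hessian u V ->
  {ae mu, forall x, B1 x -> 0 < u x -> 0 <= \sum_i \sum_j a x i j * V i j x} ->
  rho0 < 1 -> rho0 < rho1 -> rho1 < 1 -> rho2 < 1 -> rho1 <= rho2 -> 0 < M ->
  mollifier eta psi ->
  (forall x y, sq_ball rho1 x -> (forall k, `|y ord0 k - x ord0 k| <= eta) -> sq_ball rho2 y) ->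
  0 <= delta ->
  (forall p : 'I_n -> R, (forall i, 0 <= p i <= delta) -> exists2 x,
     [/\ sq_ball rho0 x, M <= u x & forall xi, bform (fun i j => mhess psi (u \_ (sq_ball rho2)) i j x) xi xi <= 0] &
     forall i, mgrad psi (u \_ (sq_ball rho2)) i x = p i) ->
  forall C5 : R, 0 <= C5 ->
  (forall t : option ('I_n * 'I_n) -> R, (forall i, 0 <= t i) ->
    (\sum_i t i) ^+ n <= C5 * \sum_i t i ^+ n) ->
  (((delta) ^+ n)%:E <= (C5 * (2 * n%:R * (n%:R * n%:R * (`|Lam| / lam))) ^+ n)%:E *
     \sum_i \sum_j osc psi n (V i j \_ (sq_ball rho2)))%E.
Proof.
move=> lam0 ell cu Lu LV hV sub rho01 rr0 rho11 rho21 rr1 M0 mpsi near12 delta0 surj C5 C50 HC5.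
set u' := u \_ (sq_ball rho2) in surj *.
have [mu' intu'0] := Lu _ rho21.
have intu' : mu.-integrable setT (EFin \o u').
  exact: (integrable_of_exp (ltn0Sn 0) mu' (fun x => restrict_unit_box u x rho21) intu'0).
pose V' i j := V i j \_ (sq_ball rho2).
have mV' i j : measurable_fun setT (V' i j) by have [] := LV i j _ rho21.
have intV' i j : mu.-integrable setT (EFin \o V' i j).
  have [_ intV0] := LV i j _ rho21.
  exact: (integrable_of_exp n_gt0 (mV' i j) (fun x => restrict_unit_box (V i j) x rho21) intV0).
(* This bound on third derivatives degenerates as eta tends to 0, which is why
   the mesh tends to 0 first, with eta fixed. *)
have [L L0 HL] : exists2 L : R, 0 <= L &
    forall i j k x, `|moll psi u' (incr k (incr i (incr j al0))) x| <= L.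
  have bL (t : 'I_n * 'I_n * 'I_n) : exists C : R, 0 <= C /\
      forall x, `|moll psi u' (incr t.2 (incr t.1.1 (incr t.1.2 al0))) x| <= C.
    by have [C C0 FC] := moll_bounded mpsi (incr t.2 (incr t.1.1 (incr t.1.2 al0))) intu'; exists C.
  have [C CP] := choice bL.
  exists (\sum_t C t); first by apply: sumr_ge0 => t _; exact: (CP t).1.
  move=> i j k x; apply: (le_trans ((CP (i, j, k)).2 x)).
  by rewrite (bigD1 (i, j, k))//= lerDl; apply: sumr_ge0 => t _; exact: (CP t).1.
set kap := `|Lam| / lam.
have kap0 : 0 <= kap by rewrite divr_ge0// ltW.
pose A1 : R := n%:R * n%:R * kap.
have A10 : 0 <= A1 by rewrite mulr_ge0// mulr_ge0.
have n2 : 0 <= 2 * n%:R :> R by rewrite mulr_ge0.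
pose A2 : R := (n%:R * n%:R * ((kap * n%:R + 1) * n%:R * n%:R + n%:R) + n%:R) * L.
have A20 : 0 <= A2.
  have k1 : 0 <= kap * n%:R + 1 by rewrite addr_ge0// mulr_ge0.
  have k2 : 0 <= (kap * n%:R + 1) * n%:R * n%:R + n%:R.
    by rewrite addr_ge0// mulr_ge0// mulr_ge0.
  have k3 : 0 <= n%:R * n%:R * ((kap * n%:R + 1) * n%:R * n%:R + n%:R).
    by rewrite mulr_ge0// mulr_ge0.
  by apply: mulr_ge0 => //; apply: addr_ge0.
have [e01 e01_gt0 near01] := near_sq_ball (n := n) rr0 (ltW rho01).
have M2 : 0 < M / 2 by exact: divr_gt0.
have [eu eu_gt0 Heu] := unif_cont_closure cu M2.
have rho1C : sq_ball rho1 `<=` C1.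
  by move=> x /(sq_ball_unit_ball rho11); exact: subset_closure.
have rho1D : sq_ball rho1 `<=` D by apply: sq_ball_unit_box; exact: ltW.
have osc0 i j : (0 <= osc psi n (V' i j))%E.
  by apply: integral_ge0 => p _; rewrite lee_fin (osc_integrand_ge0 mpsi).
pose P i j z := local_osc psi n (V' i j) z.
have mP i j : measurable_fun setT (P i j) by exact: (measurable_local_osc mpsi).
have P0 i j z : (0 <= P i j z)%E by exact: (local_osc_ge0 mpsi).
pose B1c := C5 * (2 * n%:R * A1) ^+ n.
have B1c0 : 0 <= B1c by rewrite mulr_ge0// exprn_ge0// mulr_ge0.
pose B2 := C5 * (2 * n%:R * A2) ^+ n.
have B20 : 0 <= B2 by rewrite mulr_ge0// exprn_ge0// mulr_ge0.
have main (N : nat) : (0 < N)%N -> @mesh R N <= e01 -> @mesh R N <= eu ->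
  ((delta ^+ n)%:E <= B1c%:E * \sum_i \sum_j osc psi n (V' i j) + (B2 * @mesh R N ^+ n * 2 ^+ n)%:E)%E.
  move=> N0 he01 heu; set h := @mesh R N in he01 heu *.
  have h0 : 0 < h by exact: mesh_gt0.
  pose F z : \bar R := (B1c%:E * (\sum_i \sum_j P i j z) + (B2 * h ^+ n)%:E)%E.
  have mS : measurable_fun setT (fun z => (\sum_i \sum_j P i j z)%E).
    by apply: emeasurable_sum => i; apply: emeasurable_sum => j; exact: mP.
  have S0 z : (0 <= \sum_i \sum_j P i j z)%E.
    by apply: sume_ge0 => i _; apply: sume_ge0 => j _; exact: P0.
  have mF : measurable_fun setT F.
    by apply: emeasurable_funD => //; apply: measurable_funeM.
  have F0 z : (0 <= F z)%E.
    by rewrite adde_ge0// ?mule_ge0// lee_fin mulr_ge0// exprn_ge0// ltW.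
  have -> : (B1c%:E * (\sum_i \sum_j osc psi n (V' i j)) + (B2 * h ^+ n * 2 ^+ n)%:E =
      \int[mu]_(z in D) F z)%E.
    rewrite ge0_integralD//; last 4 first.
    - exact: measurable_unit_box.
    - by move=> z _; rewrite mule_ge0.
    - by apply: measurable_funTS; exact: measurable_funeM.
    - by move=> z _; rewrite lee_fin mulr_ge0// exprn_ge0// ltW.
    rewrite ge0_integralZl_EFin//; last 2 first.
    - exact: measurable_unit_box.
    - exact: measurable_funTS.
    congr (_ + _)%E.
      rewrite ge0_integral_sum//; last 3 first.
      - exact: measurable_unit_box.
      - by move=> i; apply: measurable_funTS; apply: emeasurable_sum => j; exact: mP.
      - by move=> i z _; apply: sume_ge0 => j _; exact: P0.
      congr (_ * _)%E; apply: eq_bigr => i _.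
      rewrite ge0_integral_sum//; last 2 first.
      - exact: measurable_unit_box.
      - by move=> j; apply: measurable_funTS; exact: mP.
      by apply: eq_bigr => j _; rewrite (integral_local_osc mpsi).
    rewrite integral_cst; last exact: measurable_unit_box.
    have muD : mu D = (2 ^+ n)%:E.
      rewrite /unit_box lebesgue_rV_box; last by move=> i; lra.
      by rewrite big_const_ord iter_mulr_1; congr ((_ ^+ _)%:E); lra.
    by rewrite [in LHS]EFinM; congr (_ * _)%E; rewrite -muD.
  apply: (@image_volume_le _ _ N N0 (mgrad psi u') [set x | [/\ sq_ball rho0 x, M <= u x &
      forall xi, bform (fun i j => mhess psi u' i j x) xi xi <= 0]]) => //.
  - exact: measurable_unit_box.
  - move=> x [xrho0 _ _] i.
    have x1 : `|x ord0 i| < 1.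
      rewrite -(@ltr_pXn2r _ 2)// ?nnegrE// expr1n real_normK ?num_real//.
      apply: (le_lt_trans _ (le_lt_trans xrho0 rho01)).
      by rewrite (bigD1 i)//= lerDl sumr_ge0// => j _; rewrite sqr_ge0.
    by move: x1; rewrite ltr_norml => /andP[/ltW -> ->].
  - move=> x k [xrho0 Mux hx] kx.
    have Qnear z : gcube N k z -> forall i, `|z ord0 i - x ord0 i| <= h.
      by move=> kz i; apply: gcube_diam kx kz.
    have Q1 z : gcube N k z -> sq_ball rho1 z.
      by move=> kz; apply: near01 he01 xrho0 _; exact: Qnear.
    have Qu z : gcube N k z -> 0 < u z.
      move=> kz.
      have Cx : C1 x by apply: rho1C; exact: sub_sq_ball (ltW rr0) _ xrho0.
      have := Heu x z Cx (rho1C _ (Q1 z kz)) (fun i => le_trans (Qnear z kz i) heu).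
      by rewrite ler_norml => /andP[h1 _]; lra.
    split; first by move=> z kz; apply: rho1D; exact: Q1.
    (* By grad_close, the gradient moves by at most n * h * sig from x to any
       other contact point of the cube. *)
    pose sig := hess_sum psi u' x + n%:R * h * L.
    have sig0 : 0 <= sig.
      rewrite addr_ge0 ?mulr_ge0// ?(ltW h0)//.
      by apply: sumr_ge0 => i _; apply: sumr_ge0.
    exists (n%:R * h * sig); split.
    + by rewrite mulr_ge0// mulr_ge0// ltW.
    + move=> y _ ky i; apply: (grad_close mpsi intu' HL) (ltW h0) (Qnear y ky).
    + have -> : (2 * (n%:R * h * sig)) ^+ n = (2 * n%:R * sig) ^+ n * h ^+ n.
        by rewrite -exprMn; congr (_ ^+ _); ring.
      rewrite EFinM -(lebesgue_gcube N0 k) -integral_cst; last exact: measurable_gcube.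
      apply: ae_ge0_le_integral => //.
      * exact: measurable_gcube.
      * by move=> z _; rewrite lee_fin exprn_ge0// !mulr_ge0.
      * exact: measurable_funTS.
      near=> z => kz.
      have B1z : B1 z by apply: (sq_ball_unit_ball rho11); exact: Q1.
      have [sa la aL] : [/\ (a z)^T = a z, loewner_le lam%:M (a z) & loewner_le (a z) Lam%:M].
        by move: B1z; near: z.
      have aV : 0 <= \sum_i \sum_j a z i j * V i j z.
        by move: B1z (Qu z kz); near: z.
      have z2 : z \in sq_ball rho2 by rewrite inE; exact: sub_sq_ball rr1 _ (Q1 z kz).
      have zD y : (forall i, `|y ord0 i - z ord0 i| <= eta) -> D y.
        by move=> yz; apply: (sq_ball_unit_box (ltW rho21)); exact: near12 (Q1 z kz) yz.
      have Ez i j : ((`|V' i j z - mhess psi u' i j z| ^+ n)%:E <= P i j z)%E.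
        rewrite (hV _ _ _ _ i j rho21 mpsi (fun y => near12 z y (Q1 z kz))) distrC.
        exact: (moll_sub_le mpsi n (mV' i j) (intV' i j) zD).
      have bound := hess_sum_bound mpsi intu' L0 HL (a := fun i j => a z i j) (V := fun i j => V' i j z)
        lam0 (ltW h0) (Qnear z kz) hx.
      have {bound} : sig <= A1 * (\sum_i \sum_j `|V' i j z - mhess psi u' i j z|) + A2 * h.
        apply: bound.
        - by move=> i j; rewrite -[in LHS]sa mxE.
        - by move=> xi; rewrite -bform_scalar_mx; exact: loewner_le_bform.
        - by move=> xi; rewrite -bform_scalar_mx; exact: loewner_le_bform.
        - by rewrite /V'; under eq_bigr do under eq_bigr do rewrite patchE z2.
      move=> sigle.
      (* HC5 is applied to the entries of V - H and, at the index None, to the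
         error term in h. *)
      pose t (o : option ('I_n * 'I_n)) : R := 2 * n%:R * (if o is Some ij
        then A1 * `|V' ij.1 ij.2 z - mhess psi u' ij.1 ij.2 z| else A2 * h).
      have t0 o : 0 <= t o.
        by rewrite !mulr_ge0//; case: o => [ij|]; rewrite mulr_ge0// ltW.
      have sumo (G : option ('I_n * 'I_n) -> R) :
          \sum_o G o = \sum_i \sum_j G (Some (i, j)) + G None.
        rewrite (bigD1 None)//= addrC; congr (_ + _).
        rewrite (reindex_omap Some id)/=; last by case.
        rewrite pair_bigA/=; apply: eq_big => [ij|[i j] _//]; exact: eqxx.
      have sigt : (2 * n%:R * sig) ^+ n <= (\sum_o t o) ^+ n.
        apply: lerXn2r; rewrite ?nnegrE ?mulr_ge0//; first exact: sumr_ge0.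
        apply: (le_trans (ler_wpM2l n2 sigle)); rewrite sumo /t mulrDr lerD2r.
        by under [leRHS]eq_bigr do rewrite -!mulr_sumr; rewrite -!mulr_sumr.
      have {}sigt : (2 * n%:R * sig) ^+ n <= B1c * (\sum_i \sum_j `|V' i j z - mhess psi u' i j z| ^+ n)
          + B2 * h ^+ n.
        have pw (c d e : R) : (c * (d * e)) ^+ n = (c * d) ^+ n * e ^+ n by rewrite mulrA exprMn.
        apply: (le_trans sigt); apply: (le_trans (HC5 t t0)); rewrite sumo /t.
        rewrite mulrDr; apply: lerD; last by rewrite pw mulrA.
        rewrite /B1c -mulrA ler_wpM2l//.
        rewrite mulr_sumr ler_sum// => i _; rewrite mulr_sumr ler_sum// => j _.
        by rewrite /= pw.
      apply: (@le_trans _ _ (B1c * (\sum_i \sum_j `|V' i j z - mhess psi u' i j z| ^+ n)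
          + B2 * h ^+ n)%:E); first by rewrite lee_fin.
      rewrite EFinD /F leeD2r// EFinM lee_wpmul2l ?lee_fin// -sumEFin lee_sum// => i _.
      by rewrite -sumEFin lee_sum.
have S0 : (0 <= \sum_i \sum_j osc psi n (V' i j))%E.
  by apply: sume_ge0 => i _; apply: sume_ge0.
apply/lee_addgt0Pr => e e0.
(* The error is B2 * 2 ^+ n * h ^+ n, and h ^+ n <= h for h <= 1. *)
pose tau := Num.min (Num.min e01 eu) (Num.min 1 (e / (B2 * 2 ^+ n + 1))).
have B22 : 0 <= B2 * 2 ^+ n by rewrite mulr_ge0// exprn_ge0.
have tau0 : 0 < tau by rewrite !lt_min e01_gt0 eu_gt0 ltr01 divr_gt0// ltr_wpDl.
have [N N0] := mesh_small tau0.
rewrite !le_min => /andP[/andP[h1 h2] /andP[h3 h4]].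
apply: (le_trans (main N N0 h1 h2)); rewrite leeD2l// lee_fin.
have h0 : 0 < @mesh R N by exact: mesh_gt0.
move: h4; rewrite ler_pdivlMr ?ltr_wpDl// => h4.
have hn : @mesh R N ^+ n <= @mesh R N.
  by rewrite -[leRHS]expr1 ler_wiXn2l// ltW.
rewrite mulrAC mulrC; have := ler_wpM2r B22 hn; rewrite mulrDr mulr1 in h4; lra.
Unshelve. all: by end_near. Qed.

End abp.

Section abp_principle.
Context {R : realType} {n : nat}.
Local Notation mu := (lebesgue_rV (R := R) n).
Local Notation D := (@unit_box R n).
Local Notation B1 := (@unit_ball R n).
Local Notation C1 := (closure B1).
Implicit Types x y z : 'rV[R]_n.
Local Notation al0 := (fun _ : 'I_n => 0%N).

(** Subtracting a linear function of slope at most delta changes values by at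
    most m / 16, too little to move the maximum to a point where u < m / 2. *)
Lemma slope_attained (eta : R) (psi : nat -> R -> R) (u f : 'rV[R]_n -> R)
    (rho0 rho1 m delta : R) x0 (p : 'I_n -> R) :
  mollifier eta psi -> mu.-integrable setT (EFin \o f) ->
  rho0 < rho1 -> rho1 <= 1 -> 0 < m ->
  (forall x, sq_ball rho1 x -> m / 2 <= u x -> sq_ball rho0 x) ->
  (forall x, sq_ball rho1 x -> `|moll psi f al0 x - u x| <= m / 16) ->
  sq_ball rho0 x0 -> u x0 = m -> n%:R * delta <= m / 16 ->
  (forall i, 0 <= p i <= delta) ->
  exists2 x, [/\ sq_ball rho0 x, m / 2 <= u x &
      forall xi, bform (fun i j => mhess psi f i j x) xi xi <= 0] &
    forall i, mgrad psi f i x = p i.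
Proof.
move=> mpsi intf r01 r11 m0 sup close xrho ux0 dm pd.
have sub1 : sq_ball rho1 `<=` D by exact: sq_ball_unit_box.
have rho0x0 : sq_ball rho1 x0 by exact: sub_sq_ball (ltW r01) _ xrho.
have px x : sq_ball rho1 x -> `|\sum_i p i * x ord0 i| <= m / 16.
  move=> /sub1 Dx; apply: (le_trans (ler_norm_sum _ _ _)).
  apply: (@le_trans _ _ (\sum_(i < n) delta)); last first.
    by rewrite sumr_const card_ord -[leLHS]mulr_natl.
  apply: ler_sum => i _; have /andP[p0 p1] := pd i.
  rewrite normrM ger0_norm// -[leRHS]mulr1; apply: ler_pM => //.
  by rewrite ler_norml; exact: Dx.
pose g x := moll psi f al0 x - \sum_i p i * x ord0 i.
have cg : continuous g.
  have c1 : continuous (moll psi f al0) by exact: continuous_moll mpsi f intf al0.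
  have c2 : continuous (fun x : 'rV[R]_n => \sum_i p i * x ord0 i).
    apply: continuous_bigsum => i x; apply: (@continuousM _ _ (cst (p i)) (fun x : 'rV[R]_n => x ord0 i)).
      exact: cst_continuous.
    exact: coord_continuous.
  by move=> x; exact: (continuousB (c1 x) (c2 x)).
have [||c] := @EVT_max_rV R n g (sq_ball rho1) _ (compact_sq_ball r11).
- by exists x0.
- exact: continuous_subspaceT.
rewrite inE => cb cmax.
have cm y : sq_ball rho1 y -> g y <= g c by move=> yb; apply: cmax; rewrite inE.
(* Compared with x0, the maximum c loses at most two mollification errors and
   two linear terms, each at most m / 16, and 12 / 16 >= 1 / 2. *)
have uc : m / 2 <= u c.
  have := cm _ rho0x0; have := close _ cb; have := close _ rho0x0.
  have := px _ cb; have := px _ rho0x0; rewrite ux0 /g !ler_norml.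
  by move=> /andP[? ?] /andP[? ?] /andP[? ?] /andP[? ?] ?; lra.
have cr0 := sup _ cb uc.
have r0le : rho0 <= 1 by exact: le_trans (ltW r01) r11.
have [r r0 near] := near_sq_ball (n := n) r01 r0le.
have [h1 h2] := mgrad_mhess_at_max mpsi intf r0 (p := p) (x := c)
  (fun y yc => cm y (near _ _ _ (lexx r) cr0 yc)).
by exists c.
Qed.

Hypothesis n_gt0 : (0 < n)%N.

(** A positive value m of u would give a lower bound delta ^+ n in
    contact_volume that depends on m and n only, whereas the oscillation on
    the other side tends to 0 with the scale of the mollifier. *)
Lemma abp_max_principle (a : 'rV[R]_n -> 'M[R]_n) (lam Lam : R)
    (u : 'rV[R]_n -> R) (V : 'I_n -> 'I_n -> 'rV[R]_n -> R) :
  0 < lam ->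
  {ae mu, forall x, B1 x ->
       [/\ (a x)^T = a x, loewner_le lam%:M (a x) & loewner_le (a x) Lam%:M]} ->
  {within C1, continuous u} -> (forall x, unit_sphere x -> u x <= 0) ->
  locally_Lm 1 u -> (forall i j, locally_Lm n (V i j)) -> mollified_hessian u V ->
  {ae mu, forall x, B1 x -> 0 < u x -> 0 <= \sum_i \sum_j a x i j * V i j x} ->
  forall x, B1 x -> u x <= 0.
Proof.
move=> lam0 ell cu us Lu LV hV sub x0 Bx0; rewrite leNgt; apply/negP => ux0.
set m := u x0 in ux0.
have m2 : 0 < m / 2 by rewrite divr_gt0.
have [rho0 [rho00 rho01 sup]] := superlevel_interior cu (fun x sx => le_lt_trans (us x sx) m2).
(* Contact points lie in sq_ball rho0, the maxima are taken over sq_ball rho1,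
   and the kernels centred there are supported in sq_ball rho2. *)
pose rho1 := (1 + rho0) / 2; pose rho2 := (1 + rho1) / 2.
have r01 : rho0 < rho1 by rewrite /rho1; lra.
have r1 : rho1 < 1 by rewrite /rho1; lra.
have r12 : rho1 < rho2 by rewrite /rho2; lra.
have r2 : rho2 < 1 by rewrite /rho2; lra.
have m16 : 0 < m / 16 by rewrite divr_gt0.
have [eu eu0 Heu] := unif_cont_closure cu m16.
pose delta := m / 16 / n%:R.
have nR : 0 < n%:R :> R by rewrite ltr0n.
have delta0 : 0 < delta by rewrite divr_gt0.
have [C5 C50 HC5] := @sum_exp_le R _ (index_enum (option ('I_n * 'I_n))) n n_gt0.
pose B := C5 * (2 * n%:R * (n%:R * n%:R * (`|Lam| / lam))) ^+ n.
have B0 : 0 <= B.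
  rewrite mulr_ge0// exprn_ge0//; apply: mulr_ge0; first by rewrite mulr_ge0.
  by apply: mulr_ge0; [exact: mulr_ge0|rewrite divr_ge0// ltW].
pose q := B * (n%:R * n%:R).
have q0 : 0 <= q by rewrite mulr_ge0// mulr_ge0.
(* Chosen so that q * eps < delta ^+ n, where q * eps bounds the right-hand
   side of contact_volume once all oscillations are at most eps. *)
pose eps := delta ^+ n / (2 * (q + 1)).
have dn0 : 0 < delta ^+ n by rewrite exprn_gt0.
have eps0 : 0 < eps by rewrite divr_gt0// mulr_gt0// ltr_wpDl.
have voscP (t : 'I_n * 'I_n) : exists e0 : R, 0 < e0 /\ forall eta psi, eta <= e0 ->
    mollifier eta psi -> (osc psi n (V t.1 t.2 \_ (sq_ball rho2)) <= eps%:E)%E.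
  have [mV iV] := LV t.1 t.2 _ r2.
  by have [e0 e00 He0] := vanishing_osc_Lm n_gt0 mV iV eps0; exists e0.
have [ev evP] := choice voscP.
have [en en0 Hen] := near_sq_ball (n := n) r12 (ltW r1).
pose eta := \big[Num.min/Num.min en eu]_t ev t.
have eta0 : 0 < eta.
  by apply: lt_bigmin => [|t _]; [rewrite lt_min en0|exact: (evP t).1].
have eta_id : eta <= Num.min en eu by exact: bigmin_le_id.
have etan : eta <= en by apply: (le_trans eta_id); rewrite ge_min lexx.
have etau : eta <= eu by apply: (le_trans eta_id); rewrite ge_min lexx orbT.
have etav t : eta <= ev t by exact: bigmin_le_cond.
have [psi mpsi] := mollifier_exists eta0.
have near12 x y : sq_ball rho1 x -> (forall k, `|y ord0 k - x ord0 k| <= eta) -> sq_ball rho2 y.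
  exact: Hen.
have [mu' intu0] := Lu _ r2.
have intu' : mu.-integrable setT (EFin \o (u \_ (sq_ball rho2))).
  exact: (integrable_of_exp (ltn0Sn 0) mu' (fun x => restrict_unit_box u x r2) intu0).
have CB r x : r < 1 -> sq_ball r x -> C1 x.
  by move=> r_1 /(sq_ball_unit_ball r_1); exact: subset_closure.
have close x : sq_ball rho1 x -> `|moll psi (u \_ (sq_ball rho2)) al0 x - u x| <= m / 16.
  move=> xb; have xb2 : sq_ball rho2 x by exact: sub_sq_ball (ltW r12) _ xb.
  have -> : u x = (u \_ (sq_ball rho2)) x by rewrite patchE mem_set.
  apply: (moll_uniform mpsi mu' intu' (ltW m16)) => y yx.
  have yb2 := near12 _ _ xb yx.
  split; first exact: (sq_ball_unit_box (ltW r2)) yb2.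
  rewrite !patchE !mem_set//; apply: Heu; [exact: CB xb2|exact: CB yb2|].
  by move=> i; exact: le_trans (yx i) etau.
have x0b : sq_ball rho0 x0.
  by apply: sup; [exact: subset_closure|rewrite -/m; lra].
have dm : n%:R * delta <= m / 16 by rewrite /delta mulrC divfK ?gt_eqF.
have surj (p : 'I_n -> R) (pd : forall i, 0 <= p i <= delta) :=
  slope_attained mpsi intu' r01 (ltW r1) ux0 (fun x xb => sup x (CB _ _ r1 xb)) close x0b
    (erefl m) dm pd.
have := contact_volume n_gt0 lam0 ell cu Lu LV hV sub rho01 r01 r1 r2 (ltW r12) m2 mpsi near12
  (ltW delta0) surj C50 HC5.
rewrite leNgt => /negP; apply.
apply: (@le_lt_trans _ _ (B%:E * (\sum_(i < n) \sum_(j < n) eps%:E))%E).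
  rewrite lee_wpmul2l ?lee_fin// lee_sum// => i _; apply: lee_sum => j _.
  exact: (evP (i, j)).2 (etav (i, j)) mpsi.
under eq_bigr do rewrite sumEFin; rewrite sumEFin -EFinM lte_fin.
rewrite !sumr_const !card_ord -mulrnA -[X in B * X]mulr_natl natrM mulrA -/q.
rewrite /eps mulrA ltr_pdivrMr ?mulr_gt0// ?ltr_wpDl//.
by nra.
Qed.

End abp_principle.

(** * Comparison of two solutions *)

Section comparison.
Context {R : realType} {n : nat}.
Local Notation mu := (lebesgue_rV (R := R) n).
Local Notation D := (@unit_box R n).
Local Notation B1 := (@unit_ball R n).
Local Notation C1 := (closure B1).
Implicit Types (x y : 'rV[R]_n) (f g u v w : 'rV[R]_n -> R).
Implicit Types (U V : 'I_n -> 'I_n -> 'rV[R]_n -> R).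

Lemma restrictB f g (K : set 'rV[R]_n) x :
  ((fun y => f y - g y) \_ K) x = (f \_ K) x - (g \_ K) x.
Proof. by rewrite !patchE; case: ifP => // _; rewrite subr0. Qed.

Lemma locally_Lm_integrable (m : nat) f rho : (0 < m)%N -> rho < 1 -> locally_Lm m f ->
  mu.-integrable setT (EFin \o (f \_ (sq_ball rho))).
Proof.
move=> m0 rho1 /(_ _ rho1)[mf intf].
exact: (integrable_of_exp m0 mf (fun x => restrict_unit_box f x rho1) intf).
Qed.

Lemma locally_LmB (m : nat) f g : (0 < m)%N -> locally_Lm m f -> locally_Lm m g ->
  locally_Lm m (fun x => f x - g x).
Proof.
move=> m0 Lf Lg rho rho1; have [mf intf] := Lf _ rho1; have [mg intg] := Lg _ rho1.
have E : (fun y => f y - g y) \_ (sq_ball rho) = (f \_ (sq_ball rho)) \- (g \_ (sq_ball rho)).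
  by apply/funext => x; exact: restrictB.
rewrite E; have mB : measurable_fun setT ((f \_ (sq_ball rho)) \- (g \_ (sq_ball rho))).
  exact: measurable_funB.
split => //.
have := integrable_EFinZ (3 ^+ m) (integrable_EFinD intf intg).
apply: le_integrable => //.
  apply/measurable_EFinP; apply: measurable_funM; first exact: measurable_indic_unit_box.
  by apply: measurable_funX; exact: measurableT_comp.
move=> x _ /=; rewrite lee_fin ger0_norm ?mulr_ge0 ?exprn_ge0//.
apply: le_trans (ler_norm _).
rewrite -mulrDr mulrCA ler_wpM2l//.
have := norm3_exp m 0 ((f \_ (sq_ball rho)) x) ((g \_ (sq_ball rho)) x).
by rewrite add0r normr0 expr0n gtn_eqF// addr0.
Qed.

Lemma Lp_loc_locally_Lm (p : R) (m : nat) f : (0 < m)%N -> m%:R <= p ->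
  Lp_loc p B1 f -> locally_Lm m f.
Proof.
move=> m0 mp fp rho rho1; split; last exact: integrable_restrict_exp mp rho1 fp.
by apply: measurable_restrict_ball fp => //; apply: le_trans mp; rewrite ler1n.
Qed.

Lemma weak_hessian_mollified w V : (forall i j, weak_derivative B1 [:: i; j] w (V i j)) ->
  mollified_hessian w V.
Proof.
move=> wV rho eta psi x i j rho1 mpsi near.
have := moll_weak_derivative mpsi rho1 near (wV i j).
by rewrite /= sqrrN expr1n mul1r.
Qed.

Lemma mollB (eta : R) (psi : nat -> R -> R) f g al x : mollifier eta psi ->
  mu.-integrable setT (EFin \o f) -> mu.-integrable setT (EFin \o g) ->
  moll psi (f \- g) al x = moll psi f al x - moll psi g al x.
Proof.
move=> mpsi intf intg; rewrite /moll; under eq_Rintegral do rewrite mulrBl.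
exact: (RintegralB measurableT (integrable_mul_kern mpsi al x intf)
  (integrable_mul_kern mpsi al x intg)).
Qed.

Lemma mollified_hessianB (m : nat) u v U V : (0 < m)%N ->
  locally_Lm 1 u -> locally_Lm 1 v ->
  (forall i j, locally_Lm m (U i j)) -> (forall i j, locally_Lm m (V i j)) ->
  mollified_hessian u U -> mollified_hessian v V ->
  mollified_hessian (fun x => u x - v x) (fun i j x => U i j x - V i j x).
Proof.
move=> m0 Lu Lv LU LV uU vV rho eta psi x i j rho1 mpsi near.
have E f g : (fun y => f y - g y) \_ (sq_ball rho) = (f \_ (sq_ball rho)) \- (g \_ (sq_ball rho)).
  by apply/funext => y; exact: restrictB.
have i1 h : locally_Lm 1 h -> mu.-integrable setT (EFin \o (h \_ (sq_ball rho))).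
  exact: locally_Lm_integrable.
have im h : locally_Lm m h -> mu.-integrable setT (EFin \o (h \_ (sq_ball rho))).
  exact: locally_Lm_integrable.
rewrite /mhess !E (mollB _ _ mpsi (i1 _ Lu) (i1 _ Lv)) (mollB _ _ mpsi (im _ (LU i j)) (im _ (LV i j))).
by congr (_ - _); [exact: uU mpsi near|exact: vV mpsi near].
Qed.

Hypothesis n_gt0 : (0 < n)%N.

(** The Hessian in the equation is a priori only locally integrable; by
    uniqueness of weak derivatives it coincides almost everywhere with the one
    in L^p, p >= n, of the Sobolev space. *)
Lemma strong_solution_weak_hessian (a : 'rV[R]_n -> 'M[R]_n) f w : strong_solution a f w ->
  locally_Lm 1 w /\ exists V, [/\ forall i j, locally_Lm n (V i j), mollified_hessian w V &
    {ae mu, forall x, B1 x -> \sum_i \sum_j a x i j * V i j x = f x}].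
Proof.
move=> [[p np [wp sob]] _ [D2w wD2 eqD2]].
have p1 : 1 <= p by apply: le_trans np; rewrite ler1n.
split; first exact: (@Lp_loc_locally_Lm p 1 w (ltn0Sn 0) p1 wp).
have vP (t : 'I_n * 'I_n) : exists v, Lp_loc p B1 v /\ weak_derivative B1 [:: t.1; t.2] w v.
  by have [//|v vp wv] := sob [:: t.1; t.2]; exists v.
have [v vPP] := choice vP.
exists (fun i j => v (i, j)); split.
- by move=> i j; exact: (@Lp_loc_locally_Lm p n _ n_gt0 np (vPP (i, j)).1).
- by apply: weak_hessian_mollified => i j; exact: (vPP (i, j)).2.
have vD : \forall x \ae mu, forall t, B1 x -> v t x = D2w t.1 t.2 x.
  apply: filter_forall => t.
  exact: (weak_derivative_unique p1 (lexx 1) (vPP t).1 (wD2 t.1 t.2).1 (vPP t).2 (wD2 t.1 t.2)).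
apply: filterS2 vD eqD2 => x vx eqx Bx; rewrite -eqx//.
by apply: eq_bigr => i _; apply: eq_bigr => j _; rewrite vx.
Qed.

(** Where w1 > w2 the right-hand sides are 1 for w1 and at most 1 for w2, so
    the difference satisfies the sign condition of the maximum principle
    there. *)
Lemma strong_solution_le (a : 'rV[R]_n -> 'M[R]_n) (lam Lam : R) (w1 w2 : 'rV[R]_n -> R) :
  0 < lam ->
  {ae mu, forall x, B1 x ->
       [/\ (a x)^T = a x, loewner_le lam%:M (a x) & loewner_le (a x) Lam%:M]} ->
  (forall x, C1 x -> 0 <= w2 x) ->
  strong_solution a \1_[set x | 0 < w1 x] w1 ->
  strong_solution a \1_[set x | 0 < w2 x] w2 ->
  (forall x, unit_sphere x -> w1 x = w2 x) ->
  forall x, B1 x -> w1 x <= w2 x.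
Proof.
move=> lam0 ell w20 sol1 sol2 bd x Bx.
have [L1 [V1 [LV1 hV1 eq1]]] := strong_solution_weak_hessian sol1.
have [L2 [V2 [LV2 hV2 eq2]]] := strong_solution_weak_hessian sol2.
have [_ c1 _] := sol1; have [_ c2 _] := sol2.
rewrite -subr_le0.
apply: (@abp_max_principle R n n_gt0 a lam Lam (fun x => w1 x - w2 x)
  (fun i j x => V1 i j x - V2 i j x)) => //.
- by move=> y; apply: continuousB; [exact: c1|exact: c2].
- by move=> y /bd ->; rewrite subrr.
- exact: locally_LmB.
- by move=> i j; exact: locally_LmB.
- exact: mollified_hessianB n_gt0 _ _ _ _ _ _.
apply: filterS2 eq1 eq2 => y e1 e2 By; rewrite subr_gt0 => w12.
have w2y : 0 <= w2 y by apply: w20; exact: subset_closure.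
have -> : \sum_i \sum_j a y i j * (V1 i j y - V2 i j y) =
    \sum_i \sum_j a y i j * V1 i j y - \sum_i \sum_j a y i j * V2 i j y.
  rewrite -sumrB; apply: eq_bigr => i _; rewrite -sumrB; apply: eq_bigr => j _.
  by rewrite mulrBr.
rewrite e1// e2// !indicE mem_set; last exact: le_lt_trans w12.
by rewrite subr_ge0; case: (_ \in _).
Qed.

End comparison.

Theorem corollary4p4 (R : realType) (n : nat) (n_gt0 : (0 < n)%N)
    (a : 'rV[R]_n -> 'M[R]_n) (lam Lam : R)
    (a_measurable : forall i j : 'I_n,
       Lebesgue_measurable_fun unit_ball (fun x => a x i j))
    (lam_gt0 : 0 < lam)
    (a_elliptic : {ae lebesgue_rV n, forall x, unit_ball x ->
       [/\ (a x)^T = a x, loewner_le lam%:M (a x)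
         & loewner_le (a x) Lam%:M]})
    (w1 w2 : 'rV[R]_n -> R)
    (w1_ge0 : forall x, closure unit_ball x -> 0 <= w1 x)
    (w2_ge0 : forall x, closure unit_ball x -> 0 <= w2 x)
    (w1_sol : strong_solution a \1_[set x | 0 < w1 x] w1)
    (w2_sol : strong_solution a \1_[set x | 0 < w2 x] w2)
    (w12_boundary : forall x, unit_sphere x -> w1 x = w2 x) :
  forall x, unit_ball x -> w1 x = w2 x.
Proof.
move=> x Bx; apply/eqP; rewrite eq_le.
rewrite (strong_solution_le n_gt0 lam_gt0 a_elliptic w2_ge0 w1_sol w2_sol)//.
rewrite (strong_solution_le n_gt0 lam_gt0 a_elliptic w1_ge0 w2_sol w1_sol)//.
by move=> y /w12_boundary.
Qed.
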